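(* Let $a_{20},a_{11},a_{02},a_{30},a_{21},a_{12},a_{03},b_{20},b_{11},b_{02},b_{30},b_{21},b_{12},b_{03}$ be independent complex parameters and consider the system $$\begin{cases}\dot z=z+\varepsilon\left(a_{20}z^2+a_{11}zw+a_{02}w^2+a_{30}z^3+a_{21}z^2w+a_{12}zw^2+a_{03}w^3\right),\\ \dot w=-w-\varepsilon\left(b_{20}w^2+b_{11}zw+b_{02}z^2+b_{30}w^3+b_{21}zw^2+b_{12}z^2w+b_{03}z^3\right).\end{cases}$$ The origin of this system is a weakly persistent isochronous center if and only if $a_{21}=b_{21}=0$ and one of the following conditions holds: (I01) $a_{20}=a_{30}=b_{11}=b_{02}=b_{12}=b_{03}=0$; (I02) $b_{20}=b_{30}=a_{11}=a_{02}=a_{12}=a_{03}=0$; (I03) $a_{11}=a_{02}=a_{12}=a_{03}=b_{11}=b_{30}=0$; (I04) $b_{11}=b_{02}=b_{12}=b_{03}=a_{11}=a_{30}=0$; (I05) $a_{11}=a_{02}=a_{12}=a_{03}=b_{11}=b_{02}=b_{12}=b_{03}=0$; (I06) $a_{11}=b_{11}=a_{02}=a_{03}=b_{03}=a_{12}+b_{30}=a_{30}+b_{12}=0$; (I07) $a_{11}=b_{11}=b_{02}=b_{03}=a_{03}=a_{30}+b_{12}=a_{12}+b_{30}=0$; (I08) $a_{20}=a_{02}=a_{12}=a_{03}=b_{11}=b_{02}=b_{12}=b_{03}=2a_{11}-b_{20}=0$; (I09) $b_{20}=b_{02}=b_{12}=b_{03}=a_{11}=a_{02}=a_{12}=a_{03}=2b_{11}-a_{20}=0$;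 (I10) $a_{20}=a_{02}=a_{12}=a_{03}=b_{11}=b_{30}=b_{03}=2a_{11}+b_{20}=2a_{30}+b_{12}=0$; (I11) $b_{20}=b_{02}=b_{12}=b_{03}=a_{11}=a_{30}=a_{03}=a_{20}+2b_{11}=a_{12}+2b_{30}=0$; (I12) $a_{20}=a_{02}=a_{30}=a_{12}=a_{03}=b_{11}=b_{02}=b_{30}=b_{12}=3a_{11}+b_{20}=0$; (I13) $b_{20}=b_{02}=b_{30}=b_{12}=b_{03}=a_{11}=a_{02}=a_{30}=a_{12}=a_{20}+3b_{11}=0$; (I14) $a_{20}=a_{02}=a_{30}=a_{03}=b_{11}=b_{02}=b_{12}=3a_{11}-b_{20}=3a_{12}+b_{30}=0$; (I15) $b_{20}=b_{02}=b_{30}=b_{03}=a_{11}=a_{02}=a_{12}=3b_{11}-a_{20}=a_{30}+3b_{12}=0$; (I16) $a_{20}=a_{11}=a_{02}=a_{30}=a_{03}=b_{20}=b_{11}=b_{12}=b_{03}=2a_{12}+b_{30}=0$; (I17) $b_{20}=b_{11}=b_{02}=b_{30}=b_{03}=a_{20}=a_{11}=a_{12}=a_{03}=a_{30}+2b_{12}=0$; (I18) $a_{02}=b_{02}=a_{03}=b_{03}=a_{11}+b_{20}=a_{20}+b_{11}=a_{12}+b_{30}=a_{30}+b_{12}=a_{30}b_{20}^2-a_{20}^2b_{30}=0$; (I19) $a_{20}b_{20}\neq0$ and $a_{30}=a_{12}=a_{03}=b_{30}=b_{12}=b_{03}=7a_{11}+6b_{20}=6a_{20}+7b_{11}=7a_{02}a_{20}-3b_{20}^2=-3a_{20}^2+7b_{02}b_{20}=0$;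 (I20) $a_{20}b_{20}\neq0$ and $a_{30}=a_{12}=a_{03}=b_{30}=b_{12}=b_{03}=5a_{11}+2b_{20}=2a_{20}+5b_{11}=5a_{02}a_{20}+3b_{20}^2=3a_{20}^2+5b_{02}b_{20}=0$; (I21) $a_{30}b_{30}\neq0$ and $a_{20}=a_{11}=a_{02}=b_{20}=b_{11}=b_{02}=7a_{12}+3b_{30}=3a_{30}+7b_{12}=49a_{03}b_{03}-16a_{30}b_{30}=a_{03}a_{30}^2-b_{03}b_{30}^2=0$. In each case the displayed relations are imposed together with $a_{21}=b_{21}=0$, while all coefficients not explicitly restricted are arbitrary complex numbers.
   Context: Here $z,w$ are independent complex variables (no conjugacy relation is imposed). For fixed coefficients, the origin is called a weakly persistent isochronous center if, for every $\varepsilon\in\mathbb R$, there exists a local analytic near-identity transformation $Z=z+O(2)$, $W=w+O(2)$ (where $O(2)$ denotes terms of total degree at least $2$ in $(z,w)$) which transforms the system, without any rescaling of the time variable, into the linear system $\dot Z=Z$, $\dot W=-W$. A chain of expressions ''$=\dots=0$'' means that every expression in the chain vanishes. *)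

(* Defs.v *)
From HB Require Import structures.
From mathcomp Require Import all_boot all_order all_algebra.
From mathcomp Require Import all_classical all_reals all_analysis.
From mathcomp Require Import complex.
Set Implicit Arguments.
Unset Strict Implicit.
Unset Printing Implicit Defensive.
Import Order.TTheory GRing.Theory Num.Theory.
Import numFieldNormedType.Exports.
Local Open Scope classical_set_scope.
Local Open Scope ring_scope.

(* Stated over an arbitrary numFieldType K because a variable K, unlike the
   concrete R[i], canonically carries the norm topology; used at K := R[i]. *)

(* F is analytic at the origin with Taylor coefficients c: on some polydisc of
   radius r the double series sum_(i, j) c_ij z^i w^j converges absolutely, with
   sum F (z, w).  In view of the absolute convergence, summing over squares
   involves no choice. *)
Definition power_series_at0 (K : numFieldType)
    (F : K * K -> K) (c : nat -> nat -> K) : Prop :=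
  exists r : K,
    [/\ 0 < r,
        exists M : K, forall n : nat,
          \sum_(i < n) \sum_(j < n) `|c i j| * r ^+ (i + j) <= M
      & forall z w : K, `|z| < r -> `|w| < r ->
          (\sum_(i < n) \sum_(j < n) c i j * z ^+ i * w ^+ j)
            @[n --> \oo] --> F (z, w)].

(* F (z, w) = l * z + m * w + O(2), with F analytic at the origin. *)
Definition analytic_with_linear_part (K : numFieldType)
    (F : K * K -> K) (l m : K) : Prop :=
  exists c : nat -> nat -> K,
    [/\ power_series_at0 F c, c 0%N 0%N = 0, c 1%N 0%N = l & c 0%N 1%N = m].

(* For an autonomous system (z', w') = X (z, w), the derivative of F along the
   solutions is 'D_(X p) F p = F_z * z' + F_w * w'.  The derivatives below exist
   because Z and W are analytic, so the totality of 'D is harmless. *)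
Definition analytically_linearizable (K : numFieldType)
    (X : K * K -> K * K) : Prop :=
  exists Z W : K * K -> K,
    [/\ analytic_with_linear_part Z 1 0,
        analytic_with_linear_part W 0 1
      & \forall p \near (0 : K * K),
          'D_(X p) Z p = Z p /\ 'D_(X p) W p = - W p].

Definition weakly_persistent_isochronous_center (R : realType)
    (X : R -> complex R * complex R -> complex R * complex R) : Prop :=
  forall eps : R, analytically_linearizable (X eps).

Definition vanish (K : nzRingType) (s : seq K) : bool := all (fun x => x == 0) s.

(* Main.v *)
(* A system is analytically linearizable as soon as it is formally linearizable: the inverse
   normalising map solves a fixed point equation whose divisors i - j -+ 1 are integers, hence
   bounded below when they do not vanish, so it converges; and the existence of a formal
   linearization forces all the resonant terms of the normal form to vanish.  Conversely Taylor
   coefficients of analytic linearizing functions satisfy the formal equations.  Everything thus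
   takes place in formal power series.

   Sufficiency: in each case (I01)-(I21) a linearization is given by an explicit formal
   substitution, completed by scalar linear differential equations; the cases come in pairs
   exchanged by z <-> w.

   Necessity: if Z and W linearize the system then Z W is a first integral, so Z can be multiplied
   by a series in Z W to have no resonant terms.  Its coefficients are then given by a recursion,
   and the resonant equations are polynomial relations between the parameters.  These hold for all
   multiples of the parameters by eps, hence for every homogeneous part.  A computer-found case
   distinction, checked by computation in Z[parameters], shows that the obstructions up to order 5
   leave exactly the 21 families. *)

Require Import Defs.
From HB Require Import structures.
From Stdlib Require Import ZArith.
From mathcomp Require Import all_boot all_order all_algebra.
From mathcomp Require Import all_classical all_reals all_analysis.
From mathcomp Require Import complex ring zify ssrZ.
Set Implicit Arguments.
Unset Strict Implicit.
Unset Printing Implicit Defensive.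
Import Order.TTheory GRing.Theory Num.Theory.
Local Open Scope ring_scope.

(** * Formal power series *)

(** Most explicit linearizations are of Darboux type. An invariant curve [D] satisfies X D = k D
    along the field X, with a polynomial cofactor k; cofactors add under products and are multiplied
    by [a] under the power [a], so it suffices to combine curves and powers until the cofactors are
    the constants 1 and -1. The pairs (I06), (I07) and (I14), (I15) are treated differently. With p
    the factor of the second component -w p on the axis z = 0, the variables A = z / p, respectively
    A = z^3 / p^2, and r = A w turn the field into p times a polynomial field whose linear part, (A,
    0) or (3 A, 2 r), leaves no obstruction to the eigenfunctions that are wanted. The filtration of
    series by total degree plays the part of a topology: formal equations are solved by contraction
    in it, and a bound on all truncated norms survives the limit because each norm sees finitely
    many coefficients. Completeness of the field is therefore used only to give a value to an
    absolutely bounded series. The case distinction is data; what is proved is the soundness of its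
    checker. *)

Record fps (R : Type) := Fps { cf : nat -> R }.
Coercion cf : fps >-> Funclass.
Arguments Fps {R}.

Lemma fpsP (R : Type) (f g : fps R) : (forall n, f n = g n) -> f = g.
Proof. by case: f; case: g => g f /= H; congr Fps; apply/funext. Qed.

HB.instance Definition _ (R : Type) := gen_eqMixin (fps R).
HB.instance Definition _ (R : Type) := gen_choiceMixin (fps R).

(** The operations are locked so that conversion and [ring] see abstract ring operations;
    coefficients are reached only by rewriting. *)
Fact fps_key : unit. Proof. exact: tt. Qed.

Section Zmod.
Variable R : zmodType.
Definition fps_zero : fps R := locked_with fps_key (Fps (fun=> 0)).
Definition fps_opp : fps R -> fps R := locked_with fps_key (fun f => Fps (fun n => - f n)).
Definition fps_add : fps R -> fps R -> fps R :=
  locked_with fps_key (fun f g => Fps (fun n => f n + g n)).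
Fact fps_zeroE n : fps_zero n = 0. Proof. by rewrite /fps_zero unlock. Qed.
Fact fps_oppE f n : fps_opp f n = - f n. Proof. by rewrite /fps_opp unlock. Qed.
Fact fps_addE f g n : fps_add f g n = f n + g n. Proof. by rewrite /fps_add unlock. Qed.
Fact fps_addA : associative fps_add.
Proof. by move=> f g h; apply: fpsP => n; rewrite !fps_addE addrA. Qed.
Fact fps_addC : commutative fps_add.
Proof. by move=> f g; apply: fpsP => n; rewrite !fps_addE addrC. Qed.
Fact fps_add0 : left_id fps_zero fps_add.
Proof. by move=> f; apply: fpsP => n; rewrite fps_addE fps_zeroE add0r. Qed.
Fact fps_addN : left_inverse fps_zero fps_opp fps_add.
Proof. by move=> f; apply: fpsP => n; rewrite fps_addE fps_oppE fps_zeroE addNr. Qed.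
HB.instance Definition _ := GRing.isZmodule.Build (fps R) fps_addA fps_addC fps_add0 fps_addN.

Lemma fpsD (f g : fps R) n : (f + g) n = f n + g n. Proof. exact: fps_addE. Qed.
Lemma fpsN (f : fps R) n : (- f) n = - f n. Proof. exact: fps_oppE. Qed.
Lemma fpsB (f g : fps R) n : (f - g) n = f n - g n. Proof. by rewrite fpsD fpsN. Qed.
Lemma fps0 n : (0 : fps R) n = 0. Proof. exact: fps_zeroE. Qed.
Lemma fps_sum I (r : seq I) (P : pred I) (F : I -> fps R) n :
  (\sum_(i <- r | P i) F i) n = \sum_(i <- r | P i) F i n.
Proof.
by elim/big_rec2: _ => [|i y1 y2 _ <-]; rewrite ?fps0 ?fpsD.
Qed.
Lemma fpsMn (f : fps R) m n : (f *+ m) n = f n *+ m.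
Proof. by elim: m => [|m IH]; rewrite ?fps0 // !mulrS fpsD IH. Qed.
End Zmod.

Section Ring.
Variable R : comNzRingType.
Implicit Types f g h : fps R.

Definition trunc n f : {poly R} := \poly_(i < n) f i.
Definition fps_one : fps R := locked_with fps_key (Fps (fun n => (n == 0%N)%:R)).
Definition fps_mul : fps R -> fps R -> fps R :=
  locked_with fps_key (fun f g => Fps (fun n => \sum_(i < n.+1) f i * g (n - i)%N)).
Fact fps_oneE n : fps_one n = (n == 0%N)%:R. Proof. by rewrite /fps_one unlock. Qed.
Fact fps_mulE f g n : fps_mul f g n = \sum_(i < n.+1) f i * g (n - i)%N.
Proof. by rewrite /fps_mul unlock. Qed.

Lemma coef_trunc n f i : (trunc n f)`_i = if (i < n)%N then f i else 0.
Proof. by rewrite coef_poly. Qed.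

(** A coefficient of a product depends on finitely many coefficients of the factors. Associativity,
    commutativity and the Leibniz rule are thus inherited from polynomials. *)
Lemma fps_mul_poly n m f g : (m < n)%N -> fps_mul f g m = (trunc n f * trunc n g)`_m.
Proof.
move=> lt; rewrite coefM fps_mulE; apply: eq_bigr => i _.
rewrite !coef_trunc (leq_ltn_trans _ lt); last by rewrite -ltnS.
by rewrite (leq_ltn_trans _ lt) // leq_subr.
Qed.

Lemma coefM_eq (p q p' q' : {poly R}) n :
  (forall i, (i <= n)%N -> p`_i = p'`_i) -> (forall i, (i <= n)%N -> q`_i = q'`_i) ->
  (p * q)`_n = (p' * q')`_n.
Proof.
move=> Hp Hq; rewrite !coefM; apply: eq_bigr => i _.
by rewrite Hp ?Hq ?leq_subr // -ltnS.
Qed.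

Lemma trunc_mul n m f g : (m < n)%N -> (trunc n (fps_mul f g))`_m = (trunc n f * trunc n g)`_m.
Proof. by move=> lt; rewrite coef_trunc lt (fps_mul_poly _ _ lt). Qed.

Fact fps_mulA : associative fps_mul.
Proof.
move=> f g h; apply: fpsP => n.
rewrite !(fps_mul_poly _ _ (ltnSn n)).
rewrite (coefM_eq (p' := trunc n.+1 f) (q' := trunc n.+1 g * trunc n.+1 h)) //; last first.
  by move=> i le; rewrite trunc_mul.
by rewrite mulrA; apply: coefM_eq => // i le; rewrite trunc_mul.
Qed.
Fact fps_mulC : commutative fps_mul.
Proof. by move=> f g; apply: fpsP => n; rewrite !(fps_mul_poly _ _ (ltnSn n)) mulrC. Qed.
Fact fps_mul1 : left_id fps_one fps_mul.
Proof.
move=> f; apply: fpsP => n; rewrite fps_mulE big_ord_recl fps_oneE mul1r subn0 big1 ?addr0 // => i _.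
by rewrite fps_oneE mul0r.
Qed.
Fact fps_mulDl : left_distributive fps_mul (@fps_add R).
Proof.
move=> f g h; apply: fpsP => n; rewrite fps_addE !fps_mulE -big_split; apply: eq_bigr => i _.
by rewrite fps_addE mulrDl.
Qed.
Fact fps_one_neq0 : fps_one != 0.
Proof. by apply/eqP => /(congr1 (fun f : fps R => f 0%N))/eqP; rewrite fps_oneE fps0 oner_eq0. Qed.
HB.instance Definition _ := GRing.Zmodule_isComNzRing.Build (fps R)
  fps_mulA fps_mulC fps_mul1 fps_mulDl fps_one_neq0.

Lemma fpsM f g n : (f * g) n = \sum_(i < n.+1) f i * g (n - i)%N. Proof. exact: fps_mulE. Qed.
Lemma fps1 n : (1 : fps R) n = (n == 0%N)%:R. Proof. exact: fps_oneE. Qed.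

Definition cst : R -> fps R := locked_with fps_key (fun a => Fps (fun n => if n is 0%N then a else 0)).
Lemma cstE a n : cst a n = if n is 0%N then a else 0. Proof. by rewrite /cst unlock. Qed.
Fact cst_is_additive : {morph cst : a b / a - b}.
Proof. by move=> a b; apply: fpsP => -[|n]; rewrite fpsB !cstE ?subr0. Qed.
Fact cst_is_monoid : monoid_morphism cst.
Proof.
split=> [|a b]; first by apply: fpsP => -[|n]; rewrite cstE fps1.
apply: fpsP => n; rewrite fpsM big_ord_recl subn0 big1 ?addr0 ?cstE; last by move=> i _; rewrite cstE mul0r.
by case: n => //= n; rewrite mulr0.
Qed.
HB.instance Definition _ := GRing.isZmodMorphism.Build R (fps R) cst cst_is_additive.
HB.instance Definition _ := GRing.isMonoidMorphism.Build R (fps R) cst cst_is_monoid.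

Definition fpsX : fps R := locked_with fps_key (Fps (fun n => (n == 1%N)%:R)).
Lemma fpsXE n : fpsX n = (n == 1%N)%:R. Proof. by rewrite /fpsX unlock. Qed.

Lemma fps_cstM a f n : (cst a * f) n = a * f n.
Proof.
rewrite fpsM big_ord_recl subn0 cstE big1 ?addr0 // => i _.
by rewrite cstE mul0r.
Qed.
Lemma fpsXM f n : (fpsX * f) n = if n is m.+1 then f m else 0.
Proof.
rewrite fpsM; case: n => [|n]; first by rewrite big_ord_recl big_ord0 fpsXE mul0r addr0.
rewrite big_ord_recl fpsXE mul0r add0r big_ord_recl fpsXE mul1r subSS subn0 big1 ?addr0 // => i _.
by rewrite fpsXE mul0r.
Qed.

Definition fderiv : fps R -> fps R := locked_with fps_key (fun f => Fps (fun n => f n.+1 *+ n.+1)).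
Lemma fderivE f n : fderiv f n = f n.+1 *+ n.+1. Proof. by rewrite /fderiv unlock. Qed.
Lemma fderivD f g : fderiv (f + g) = fderiv f + fderiv g.
Proof. by apply: fpsP => n; rewrite fpsD !fderivE fpsD mulrnDl. Qed.
Lemma fderivM f g : fderiv (f * g) = fderiv f * g + f * fderiv g.
Proof.
apply: fpsP => n; rewrite fpsD.
have E : (f * g) n.+1 = (trunc n.+2 f * trunc n.+2 g)`_n.+1 by apply: fps_mul_poly.
rewrite fderivE.
rewrite E -coef_deriv derivM coefD.
have H (h : fps R) i : (i <= n)%N -> ((trunc n.+2 h)^`())`_i = (trunc n.+1 (fderiv h))`_i.
  by move=> le; rewrite coef_deriv !coef_trunc !ltnS le fderivE.
have H' (h : fps R) i : (i <= n)%N -> (trunc n.+2 h)`_i = (trunc n.+1 h)`_i.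
  by move=> le; rewrite !coef_trunc !ltnS le ltnW // ltnS.
congr (_ + _).
  rewrite -[fderiv f * g]/(fps_mul _ _) (fps_mul_poly _ _ (ltnSn n)).
  by apply: coefM_eq => i le; [apply: H | apply: H'].

rewrite -[f * fderiv g]/(fps_mul _ _) (fps_mul_poly _ _ (ltnSn n)).
by apply: coefM_eq => i le; [apply: H' | apply: H].
Qed.

(** Acts on the coefficients of an outer series; with the derivative of inner series it becomes the
    derivative in the second variable. *)
Definition fmap : (R -> R) -> fps R -> fps R :=
  locked_with fps_key (fun D f => Fps (fun n => D (f n))).
Lemma fmapE D f n : fmap D f n = D (f n). Proof. by rewrite /fmap unlock. Qed.
Lemma fmapD D f g : {morph D : a b / a + b} -> fmap D (f + g) = fmap D f + fmap D g.
Proof. by move=> H; apply: fpsP => n; rewrite fpsD !fmapE fpsD H. Qed.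
Lemma fmapM D f g : {morph D : a b / a + b} -> (forall a b, D (a * b) = D a * b + a * D b) ->
  fmap D (f * g) = fmap D f * g + f * fmap D g.
Proof.
move=> H1 H2; apply: fpsP => n; rewrite fpsD fmapE !fpsM -big_split.
have D0 : D 0 = 0 by apply/(addrI (D 0)); rewrite -H1 !addr0.
by rewrite (big_morph D H1 D0); apply: eq_bigr => i _; rewrite !fmapE H2.
Qed.
End Ring.

(** * Double series as series in [z] over series in [w]: derivations, order, monomials *)

Section Series.
Variable K : numFieldType.
Notation S := (fps (fps K)).
Implicit Types f g h u v : S.

Definition C2 (a : K) : S := cst (cst a).
HB.instance Definition _ := GRing.RMorphism.copy C2 (@cst (fps K) \o @cst K).
Definition Xz : S := @fpsX (fps K).
Definition Xw : S := cst (@fpsX K).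
Definition d1 f : S := fderiv f.
Definition d2 f : S := fmap (@fderiv K) f.

Lemma serP f g : (forall i j, f i j = g i j) -> f = g.
Proof. by move=> H; apply: fpsP => i; apply: fpsP. Qed.

Lemma cD f g i j : (f + g) i j = f i j + g i j. Proof. by rewrite !fpsD. Qed.
Lemma cN f i j : (- f) i j = - f i j. Proof. by rewrite !fpsN. Qed.
Lemma cB f g i j : (f - g) i j = f i j - g i j. Proof. by rewrite cD cN. Qed.
Lemma c0 i j : (0 : S) i j = 0. Proof. by rewrite !fps0. Qed.
Lemma c1 i j : (1 : S) i j = ((i == 0%N) && (j == 0%N))%:R.
Proof. by rewrite fps1; case: eqP => _; rewrite ?fps1 ?fps0. Qed.
Lemma cC a i j : C2 a i j = if (i == 0%N) && (j == 0%N) then a else 0.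
Proof. by rewrite /C2 cstE; case: i => [|i]; rewrite ?cstE ?fps0 //; case: j. Qed.
Lemma cCM a f i j : (C2 a * f) i j = a * f i j.
Proof. by rewrite fps_cstM fps_cstM. Qed.
Lemma cXz i j : Xz i j = ((i == 1%N) && (j == 0%N))%:R.
Proof. by rewrite /Xz fpsXE; case: eqP => _; rewrite ?fps1 ?fps0. Qed.
Lemma cXw i j : Xw i j = ((i == 0%N) && (j == 1%N))%:R.
Proof. by rewrite /Xw cstE; case: i => [|i]; rewrite ?fpsXE ?fps0. Qed.
Lemma cXzM f i j : (Xz * f) i j = if i is k.+1 then f k j else 0.
Proof. by rewrite fpsXM; case: i => [|i] //; rewrite fps0. Qed.
Lemma cXwM f i j : (Xw * f) i j = if j is k.+1 then f i k else 0.
Proof. by rewrite fps_cstM fpsXM. Qed.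
Lemma cd1 f i j : d1 f i j = f i.+1 j *+ i.+1.
Proof. by rewrite /d1 fderivE fpsMn. Qed.
Lemma cd2 f i j : d2 f i j = f i j.+1 *+ j.+1. Proof. by rewrite /d2 fmapE fderivE. Qed.
Lemma cM f g i j : (f * g) i j =
  \sum_(a < i.+1) \sum_(b < j.+1) f a b * g (i - a)%N (j - b)%N.
Proof. by rewrite fpsM fps_sum; apply: eq_bigr => a _; rewrite fpsM. Qed.
Lemma csum I (r : seq I) (P : pred I) (F : I -> S) i j :
  (\sum_(k <- r | P k) F k) i j = \sum_(k <- r | P k) F k i j.
Proof. by rewrite !fps_sum. Qed.

Lemma d1D f g : d1 (f + g) = d1 f + d1 g. Proof. exact: fderivD. Qed.
Lemma d1M f g : d1 (f * g) = d1 f * g + f * d1 g. Proof. exact: fderivM. Qed.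
Lemma d2D f g : d2 (f + g) = d2 f + d2 g.
Proof. exact: fmapD (@fderivD K). Qed.
Lemma d2M f g : d2 (f * g) = d2 f * g + f * d2 g.
Proof. exact: fmapM (@fderivD K) (@fderivM K). Qed.

Definition derivation (D : S -> S) :=
  [/\ {morph D : f g / f + g}, forall f g, D (f * g) = D f * g + f * D g
    & forall a, D (C2 a) = 0].
Lemma d1_derivation : derivation d1.
Proof.
split; [exact: d1D | exact: d1M | move=> a; apply: serP => i j].
by rewrite cd1 cC mul0rn c0.
Qed.
Lemma d2_derivation : derivation d2.
Proof.
split; [exact: d2D | exact: d2M | move=> a; apply: serP => i j].
by rewrite cd2 cC andbF mul0rn c0.
Qed.
Definition vf (p q f : S) := p * d1 f + q * d2 f.
Lemma vf_derivation p q : derivation (vf p q).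
Proof.
have [a1 m1 c1] := d1_derivation; have [a2 m2 c2] := d2_derivation.
split=> [f g|f g|a]; rewrite /vf ?a1 ?a2 ?m1 ?m2 ?c1 ?c2; ring.
Qed.

Section Der.
Variable D : S -> S.
Hypothesis HD : derivation D.
Lemma derD f g : D (f + g) = D f + D g. Proof. by have [-> _ _] := HD. Qed.
Lemma derM f g : D (f * g) = D f * g + f * D g. Proof. by have [_ -> _] := HD. Qed.
Lemma derC a : D (C2 a) = 0. Proof. by have [_ _ ->] := HD. Qed.
Lemma der0 : D 0 = 0. Proof. by have := derC 0; rewrite rmorph0. Qed.
Lemma der1 : D 1 = 0. Proof. by have := derC 1; rewrite rmorph1. Qed.
Lemma derN f : D (- f) = - D f.
Proof. by apply/eqP; rewrite -subr_eq0 opprK addrC -derD subrr der0. Qed.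
Lemma derB f g : D (f - g) = D f - D g. Proof. by rewrite derD derN. Qed.
Lemma derX f n : D (f ^+ n) = f ^+ n.-1 * D f *+ n.
Proof.
elim: n => [|n IH]; first by rewrite expr0 der1 mulr0n.
rewrite exprS derM IH; case: n {IH} => [|n]; first by rewrite expr0; ring.
by rewrite [n.+1.-1]/= [n.+2.-1]/= [in RHS]mulrS; rewrite exprS -!mulrnAr; ring.
Qed.
Lemma derCM a f : D (C2 a * f) = C2 a * D f.
Proof. by rewrite derM derC mul0r add0r. Qed.
End Der.

Lemma d1z : d1 Xz = 1.
Proof. by apply: serP => i j; rewrite cd1 cXz c1; case: i => [|i] //; rewrite mul0rn. Qed.
Lemma d1w : d1 Xw = 0.
Proof. by apply: serP => i j; rewrite cd1 cXw mul0rn c0. Qed.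
Lemma d2z : d2 Xz = 0.
Proof. by apply: serP => i j; rewrite cd2 cXz andbF mul0rn c0. Qed.
Lemma d2w : d2 Xw = 1.
Proof. by apply: serP => i j; rewrite cd2 cXw c1; case: j => [|j]; rewrite ?andbF ?mul0rn. Qed.
Lemma vfz p q : vf p q Xz = p. Proof. by rewrite /vf d1z d2z mulr1 mulr0 addr0. Qed.
Lemma vfw p q : vf p q Xw = q. Proof. by rewrite /vf d1w d2w mulr1 mulr0 add0r. Qed.

(** Membership in the N-th power of the maximal ideal. *)
Definition ord N f := forall i j, (i + j < N)%N -> f i j = 0.
Lemma ordW M N f : (M <= N)%N -> ord N f -> ord M f.
Proof. by move=> le H i j lt; apply: H; apply: leq_trans lt le. Qed.
Lemma ord_0 f : ord 0 f. Proof. by []. Qed.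
Lemma ord0 N : ord N 0. Proof. by move=> i j _; rewrite c0. Qed.
Lemma ordD N f g : ord N f -> ord N g -> ord N (f + g).
Proof. by move=> Hf Hg i j lt; rewrite cD Hf ?Hg ?addr0. Qed.
Lemma ordN N f : ord N f -> ord N (- f).
Proof. by move=> Hf i j lt; rewrite cN Hf ?oppr0. Qed.
Lemma ordB N f g : ord N f -> ord N g -> ord N (f - g).
Proof. by move=> Hf /ordN Hg; apply: ordD. Qed.
Lemma ordM M N f g : ord M f -> ord N g -> ord (M + N) (f * g).
Proof.
move=> Hf Hg i j lt; rewrite cM big1 // => a _; rewrite big1 // => b _.
case: (ltnP (a + b) M) => [/Hf ->|le]; first by rewrite mul0r.
rewrite Hg ?mulr0 //; have := ltn_ord a; have := ltn_ord b; lia.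
Qed.
Lemma ordMl N f g : ord N g -> ord N (f * g).
Proof. by move=> H; rewrite -[N]add0n; apply: ordM. Qed.
Lemma ordMr N f g : ord N f -> ord N (f * g).
Proof. by move=> H; rewrite mulrC; apply: ordMl. Qed.
Lemma ordX N f n : ord N f -> ord (n * N) (f ^+ n).
Proof.
by move=> H; elim: n => [|n IH] //; rewrite exprS mulSn; apply: ordM.
Qed.
Lemma ord_sum N I (r : seq I) (P : pred I) (F : I -> S) :
  (forall k, P k -> ord N (F k)) -> ord N (\sum_(k <- r | P k) F k).
Proof. by move=> H; apply: big_ind => //; [exact: ord0 | move=> *; exact: ordD]. Qed.
Lemma ord_eq f g : (forall N, ord N (f - g)) -> f = g.
Proof.
move=> H; apply: serP => i j; apply/eqP; rewrite -subr_eq0 -cB.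
by apply/eqP/(H (i + j).+1).
Qed.
Lemma ord_z : ord 1 Xz. Proof. by move=> [|i] [|j] //; rewrite cXz. Qed.
Lemma ord_w : ord 1 Xw. Proof. by move=> [|i] [|j] //; rewrite cXw. Qed.
Lemma ord_d1 N f : ord N.+1 f -> ord N (d1 f).
Proof. by move=> H i j lt; rewrite cd1 H ?mul0rn //; lia. Qed.
Lemma ord_d2 N f : ord N.+1 f -> ord N (d2 f).
Proof. by move=> H i j lt; rewrite cd2 H ?mul0rn //; lia. Qed.
Lemma ord_vf2 N p q f : ord 2 p -> ord 2 q -> ord N f -> ord N.+1 (vf p q f).
Proof.
case: N => [|N] Hp Hq Hf.
  by apply: ordD; apply: ordMr; [apply: ordW Hp | apply: ordW Hq].
rewrite -addn2 addnC; apply: ordD; apply: ordM => //; first exact: ord_d1.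
exact: ord_d2.
Qed.

Definition mono (a : K) i j : S := C2 a * (Xz ^+ i * Xw ^+ j).
Lemma cmono a i j k l : mono a i j k l = if (k == i) && (l == j) then a else 0.
Proof.
rewrite /mono cCM.
suff -> : (Xz ^+ i * Xw ^+ j) k l = ((k == i) && (l == j))%:R.
  by case: ifP; rewrite ?mulr1 ?mulr0.
elim: i k => [|i IH] k.
  rewrite expr0 mul1r; elim: j l => [|j IH] l; first by rewrite expr0 c1.
  by rewrite exprS cXwM; case: l => [|l]; rewrite ?andbF // IH eqSS.
by rewrite exprS -mulrA cXzM; case: k => [|k] //; rewrite IH eqSS.
Qed.
Definition trunc2 N f : S := \sum_(i < N) \sum_(j < N) mono (f i j) i j.
Lemma ctrunc2 N f k l : trunc2 N f k l = if (k < N)%N && (l < N)%N then f k l else 0.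
Proof.
rewrite csum; under eq_bigr => i _ do (rewrite csum; under eq_bigr => j _ do rewrite cmono).
case: ifP => [/andP[ltk ltl]|H].
  rewrite (bigD1 (Ordinal ltk)) //= (bigD1 (Ordinal ltl)) //= !eqxx /=.
  rewrite !big1 ?addr0 // => i.
    by rewrite -val_eqE /= eq_sym => /negbTE ne; rewrite big1 // => j _; rewrite ne.
  by rewrite -val_eqE /= eq_sym => /negbTE ->.
rewrite big1 // => i _; rewrite big1 // => j _; case: ifP => // /andP[/eqP e1 /eqP e2].
by move: H; rewrite e1 e2 !ltn_ord.
Qed.
Lemma ord_trunc2 N f : ord N (f - trunc2 N f).
Proof. by move=> i j lt; rewrite cB ctrunc2 !ifT ?subrr //; lia. Qed.

(** A series differs from a polynomial truncation by a term of arbitrarily high order, so an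
    additive operator that loses at most [c] orders is determined by its values on monomials.
    Identities that are additive in a series are proved in this way. *)
Lemma ser_ind (A : S -> S) (c : nat) : {morph A : f g / f + g} ->
  (forall N f, ord (N + c) f -> ord N (A f)) -> (forall a i j, A (mono a i j) = 0) -> forall f, A f = 0.
Proof.
move=> AD Aord Amono f; apply: ord_eq => N; rewrite subr0.
have A0 : A 0 = 0 by apply/(addrI (A 0)); rewrite -AD !addr0.
have -> : A f = A (f - trunc2 (N + c) f) + A (trunc2 (N + c) f) by rewrite -AD subrK.
have -> : A (trunc2 (N + c) f) = 0.
  rewrite (big_morph A AD A0) big1 // => i _.
  by rewrite (big_morph A AD A0) big1 // => j _; rewrite Amono.
by rewrite addr0; apply: Aord; apply: ord_trunc2.
Qed.
End Series.

Lemma comp_der_aux (R : comNzRingType) (a b c d e f g h : R) i j :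
  c * (a * g *+ i * b + e * (f * h *+ j)) = c * (a * b) *+ i * g + c * (e * f) *+ j * h.
Proof. by ring. Qed.

(** * Composition and formal differential equations *)

Section Comp.
Variable K : numFieldType.
Notation S := (fps (fps K)).
Implicit Types f g h u v : S.
Notation z := (Xz K).
Notation w := (Xw K).

Definition psum N f u v : S := \sum_(a < N) \sum_(b < N) C2 (f a b) * (u ^+ a * v ^+ b).
(** Substitution of [(u, v)] for [(z, w)]. When [u] and [v] have no constant term, only monomials of
    degree at most i + j reach the coefficient (i, j), hence the finite sum; for other [u], [v] the
    value is a mere convention. *)
Definition comp f u v : S :=
  locked_with fps_key (Fps (fun i => Fps (fun j => psum (i + j).+1 f u v i j))).

Lemma ccomp f u v i j : comp f u v i j = psum (i + j).+1 f u v i j.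
Proof. by rewrite /comp unlock. Qed.

Lemma ordXX u v a b : ord 1 u -> ord 1 v -> ord (a + b) (u ^+ a * v ^+ b).
Proof.
by move=> Hu Hv; apply: ordM; [have := ordX (n:=a) Hu | have := ordX (n:=b) Hv]; rewrite muln1.
Qed.

Section UV.
Variables u v : S.
Hypotheses (Hu : ord 1 u) (Hv : ord 1 v).

Lemma cpsum N f i j : psum N f u v i j = \sum_(a < N) \sum_(b < N) f a b * (u ^+ a * v ^+ b) i j.
Proof.
rewrite csum; apply: eq_bigr => a _; rewrite csum; apply: eq_bigr => b _.
by rewrite cCM.
Qed.

Lemma psum_comp N f : ord N (psum N f u v - comp f u v).
Proof.
move=> i j lt; rewrite cB ccomp.
pose G a b := f a b * (u ^+ a * v ^+ b) i j.
have cp M : psum M f u v i j = \sum_(a < M) \sum_(b < M) G a b by rewrite cpsum.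
rewrite !cp.
have G0 a b : (i + j < a + b)%N -> G a b = 0.
  by move=> lt'; rewrite /G (ordXX (a:=a) (b:=b) Hu Hv) ?mulr0.
set n := (i + j).+1; apply/eqP; rewrite subr_eq0; apply/eqP.
have -> : \sum_(a < n) \sum_(b < n) G a b = \sum_(a < n) \sum_(b < N) G a b.
  apply: eq_bigr => a _; rewrite (big_ord_widen N (G a)) // [RHS](bigID (fun b : 'I_N => (b < n)%N)) /=.
  by rewrite [X in _ + X]big1 ?addr0 // => b; rewrite -leqNgt => le; apply: G0; rewrite /n in le; lia.
rewrite [RHS](big_ord_widen N (fun a => \sum_(b < N) G a b)) //.
rewrite [LHS](bigID (fun a : 'I_N => (a < n)%N)) /= [X in _ + X]big1 ?addr0 // => a.
by rewrite -leqNgt => le; apply: big1 => b _; apply: G0; rewrite /n in le; lia.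
Qed.

Lemma compD f g : comp (f + g) u v = comp f u v + comp g u v.
Proof.
apply: serP => i j; rewrite cD !ccomp !cpsum -big_split; apply: eq_bigr => a _.
by rewrite -big_split; apply: eq_bigr => b _; rewrite cD mulrDl.
Qed.

Lemma ord_comp N f : ord N f -> ord N (comp f u v).
Proof.
move=> H i j lt; rewrite !ccomp cpsum big1 // => a _; rewrite big1 // => b _.
case: (ltnP (a + b) N) => [/H ->|le]; first by rewrite mul0r.
by rewrite (ordXX (a:=a) (b:=b) Hu Hv) ?mulr0 //; lia.
Qed.

Lemma comp_mono a i j : comp (mono a i j) u v = C2 a * (u ^+ i * v ^+ j).
Proof.
apply: ord_eq => N; set M := (N + (i + j).+1)%N.
have := @psum_comp M (mono a i j).
have -> : psum M (mono a i j) u v = C2 a * (u ^+ i * v ^+ j).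
  have Hi : (i < M)%N by rewrite /M; lia.
  have Hj : (j < M)%N by rewrite /M; lia.
  rewrite /psum (bigD1 (Ordinal Hi)) //= (bigD1 (Ordinal Hj)) //= cmono !eqxx /=.
  rewrite !big1 ?addr0 // => k; rewrite -val_eqE /= => /negbTE ne; last first.
    by rewrite cmono ne andbF rmorph0 mul0r.
  by rewrite big1 // => l _; rewrite cmono ne rmorph0 mul0r.
move=> /ordN; rewrite opprB; apply: ordW; rewrite /M; lia.
Qed.

Lemma comp0 : comp 0 u v = 0.
Proof. by apply/(addrI (comp 0 u v)); rewrite -compD !addr0. Qed.
Lemma compN f : comp (- f) u v = - comp f u v.
Proof. by apply/(addrI (comp f u v)); rewrite -compD !subrr comp0. Qed.
Lemma compB f g : comp (f - g) u v = comp f u v - comp g u v.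
Proof. by rewrite compD compN. Qed.
Lemma compC a : comp (C2 a) u v = C2 a.
Proof.
by have := comp_mono a 0 0; rewrite /mono !expr0 !mulr1.
Qed.
Lemma comp1 : comp 1 u v = 1. Proof. by have := compC 1; rewrite rmorph1. Qed.
Lemma compz : comp z u v = u.
Proof. by have := comp_mono 1 1 0; rewrite /mono !rmorph1 !expr0 !expr1 !mulr1 !mul1r. Qed.
Lemma compw : comp w u v = v.
Proof. by have := comp_mono 1 0 1; rewrite /mono !rmorph1 !expr0 !expr1 !mul1r. Qed.

Lemma monoM a i j b k l : mono a i j * mono b k l = mono (a * b) (i + k) (j + l) :> S.
Proof. by rewrite /mono rmorphM !exprD; ring. Qed.

Lemma compM f g : comp (f * g) u v = comp f u v * comp g u v.
Proof.
apply/eqP; rewrite -subr_eq0; apply/eqP.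
apply: (@ser_ind K (fun f => comp (f * g) u v - comp f u v * comp g u v) 0) => [f1 f2|N f1 H|a i j].
- by rewrite mulrDl !compD mulrDl opprD addrACA.
- by rewrite addn0 in H; apply: ordB; [apply/ord_comp/ordMr | apply/ordMr/ord_comp].
move: g; apply: (@ser_ind K (fun g => comp (mono a i j * g) u v - comp (mono a i j) u v * comp g u v) 0)
  => [f1 f2|N f1 H|b k l].
- by rewrite mulrDr !compD mulrDr opprD addrACA.
- by rewrite addn0 in H; apply: ordB; [apply/ord_comp/ordMl | apply/ordMl/ord_comp].
by rewrite monoM !comp_mono rmorphM !exprD; ring.
Qed.
Lemma compX f n : comp (f ^+ n) u v = comp f u v ^+ n.
Proof. by elim: n => [|n IH]; rewrite ?expr0 ?comp1 // !exprS compM IH. Qed.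
Lemma compMn f n : comp (f *+ n) u v = comp f u v *+ n.
Proof. by elim: n => [|n IH]; rewrite ?mulr0n ?comp0 // !mulrS compD IH. Qed.
Lemma comp_nat n : comp n%:R u v = n%:R.
Proof. by rewrite compMn comp1. Qed.

(** Chain rule for any derivation that loses at most one order, by comparison on monomials. *)
Lemma comp_der D f : derivation D -> (forall N g, ord N.+1 g -> ord N (D g)) ->
  D (comp f u v) = comp (d1 f) u v * D u + comp (d2 f) u v * D v.
Proof.
move=> HD Dord; apply/eqP; rewrite -subr_eq0; apply/eqP; move: f.
pose A f := D (comp f u v) - (comp (d1 f) u v * D u + comp (d2 f) u v * D v).
apply: (@ser_ind K A 1) => [f1 f2|N f1 H|a i j]; rewrite /A.
- by rewrite compD (derD HD) d1D d2D !compD; ring.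
- rewrite addn1 in H; apply: ordB; first exact/Dord/ord_comp.
  by apply: ordD; apply: ordMr; apply: ord_comp; [apply: ord_d1 | apply: ord_d2].
have H1 := d1_derivation K; have H2 := d2_derivation K.
have -> : d1 (mono a i j) = mono a i.-1 j *+ i.
  rewrite /mono (derCM H1) (derM H1) !(derX H1) d1z d1w !mulr0 mul0rn mulr0 addr0 mulr1.
  by rewrite mulrnAl mulrnAr.
have -> : d2 (mono a i j) = mono a i j.-1 *+ j.
  rewrite /mono (derCM H2) (derM H2) !(derX H2) d2z d2w !mulr0 mul0rn mul0r add0r mulr1.
  by rewrite !mulrnAr.
rewrite !compMn !comp_mono (derCM HD) (derM HD) !(derX HD).
by apply/eqP; rewrite subr_eq0; apply/eqP; apply: comp_der_aux.
Qed.
End UV.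

Lemma comp_id f : comp f z w = f.
Proof.
apply/eqP; rewrite -subr_eq0; apply/eqP; move: f.
apply: (@ser_ind K (fun f => comp f z w - f) 0) => [f g|N f H|a i j].
- by rewrite compD opprD addrACA.
- rewrite addn0 in H; apply: ordB => //; apply: ord_comp => //; [exact: ord_z | exact: ord_w].
by rewrite comp_mono ?subrr //; [exact: ord_z | exact: ord_w].
Qed.

Lemma vf_comp p q f u v : ord 1 u -> ord 1 v ->
  vf p q (comp f u v) = comp (d1 f) u v * vf p q u + comp (d2 f) u v * vf p q v.
Proof.
move=> Hu Hv; apply: comp_der => //; first exact: vf_derivation.
move=> N g H; apply: ordD; apply: ordMl; [exact: ord_d1 | exact: ord_d2].
Qed.

Lemma vf_pull p q a b f u v : ord 1 u -> ord 1 v ->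
  vf p q u = comp a u v -> vf p q v = comp b u v -> vf p q (comp f u v) = comp (vf a b f) u v.
Proof.
move=> Hu Hv Eu Ev; rewrite vf_comp // Eu Ev /vf compD // !compM //; ring.
Qed.

(** The factor [c] is a change of time, possibly depending on the point; c = -1 reverses time. *)
Lemma vf_pullM p q a b c f u v : ord 1 u -> ord 1 v ->
  vf p q u = c * comp a u v -> vf p q v = c * comp b u v ->
  vf p q (comp f u v) = c * comp (vf a b f) u v.
Proof.
move=> Hu Hv Eu Ev; rewrite vf_comp // Eu Ev /vf compD // !compM //; ring.
Qed.

Lemma ordXB N u u' n : ord 1 u -> ord 1 u' -> ord N (u - u') -> ord (N + n) (u ^+ n.+1 - u' ^+ n.+1).
Proof.
move=> Hu Hu' H; elim: n => [|n IH]; first by rewrite addn0.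
have -> : u ^+ n.+2 - u' ^+ n.+2 = u * (u ^+ n.+1 - u' ^+ n.+1) + (u - u') * u' ^+ n.+1.
  by rewrite (exprS u n.+1) (exprS u' n.+1); ring.
apply: ordD; first by rewrite addnS -add1n; apply: ordM.
by apply: ordM => //; have := ordX (n:=n.+1) Hu'; rewrite muln1.
Qed.

Lemma ordXXB N u u' v v' a b : ord 1 u -> ord 1 u' -> ord 1 v -> ord 1 v' ->
  ord N (u - u') -> ord N (v - v') -> (0 < a + b)%N ->
  ord (N + (a + b).-1) (u ^+ a * v ^+ b - u' ^+ a * v' ^+ b).
Proof.
move=> Hu Hu' Hv Hv' H1 H2; case: a b => [|a] [|b] // _.
- by rewrite !expr0 !mul1r add0n; apply: ordXB.
- by rewrite !expr0 !mulr1 addn0; apply: ordXB.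
have -> : u ^+ a.+1 * v ^+ b.+1 - u' ^+ a.+1 * v' ^+ b.+1 =
   (u ^+ a.+1 - u' ^+ a.+1) * v ^+ b.+1 + u' ^+ a.+1 * (v ^+ b.+1 - v' ^+ b.+1) by ring.
apply: ordD.
  have -> : (N + (a.+1 + b.+1).-1 = (N + a) + b.+1)%N by lia.
  by apply: ordM; [apply: ordXB | have := ordX (n:=b.+1) Hv; rewrite muln1].
have -> : (N + (a.+1 + b.+1).-1 = a.+1 + (N + b))%N by lia.
by apply: ordM; [have := ordX (n:=a.+1) Hu'; rewrite muln1 | apply: ordXB].
Qed.

(** In each monomial of degree at least k + 1, replacing one factor by a difference of order N
    leaves at least [k] factors of order 1. Already k = 1 makes substitution a contraction. *)
Lemma ord_compB N k f u u' v v' : ord 1 u -> ord 1 u' -> ord 1 v -> ord 1 v' ->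
  ord N (u - u') -> ord N (v - v') -> ord k.+1 f -> ord (N + k) (comp f u v - comp f u' v').
Proof.
move=> Hu Hu' Hv Hv' H1 H2 Hf; set M := (N + k)%N.
have -> : comp f u v - comp f u' v' = (psum M f u v - psum M f u' v')
   - ((psum M f u v - comp f u v) - (psum M f u' v' - comp f u' v')) by ring.
apply: ordB; last by apply: ordB; apply: psum_comp.
rewrite /psum -sumrB; apply: ord_sum => a _; rewrite -sumrB; apply: ord_sum => b _.
rewrite -mulrBr; move: (nat_of_ord a) (nat_of_ord b) => {}a {}b.
case: (ltnP (a + b) k.+1) => [/Hf ->|le].
  by rewrite rmorph0 mul0r; apply: ord0.
apply: ordMl; apply: (ordW _ (ordXXB Hu Hu' Hv Hv' H1 H2 _)); last exact: leq_ltn_trans (leq0n k) le.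
by rewrite leq_add2l -ltnS prednK // (leq_ltn_trans (leq0n k)).
Qed.

End Comp.

(** * Fixed points of contractions for the order filtration *)

Section Fix.
Variable K : numFieldType.
Notation S := (fps (fps K)).
Variable Phi : S * S -> S * S.
Variable P : S * S -> Prop.
Hypothesis PPhi : forall x, P x -> P (Phi x).
Hypothesis Pcontr : forall N x y, P x -> P y -> ord N (x.1 - y.1) -> ord N (x.2 - y.2) ->
  ord N.+1 ((Phi x).1 - (Phi y).1) /\ ord N.+1 ((Phi x).2 - (Phi y).2).
Variable x0 : S * S.
Hypothesis P0 : P x0.
Hypothesis Pclosed : forall x, (forall N, exists y, [/\ P y, ord N (x.1 - y.1) & ord N (x.2 - y.2)]) -> P x.

Let it n := iter n Phi x0.
Let Pit n : P (it n). Proof. by elim: n => //= n; apply: PPhi. Qed.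
Let step n : ord n ((it n.+1).1 - (it n).1) /\ ord n ((it n.+1).2 - (it n).2).
Proof.
elim: n => [|n [I1 I2]]; first by split; apply: ord_0.
by apply: (Pcontr (Pit n.+1) (Pit n) I1 I2).
Qed.
Let stepk n k : ord n ((it (n + k)).1 - (it n).1) /\ ord n ((it (n + k)).2 - (it n).2).
Proof.
elim: k => [|k [I1 I2]]; first by rewrite addn0 !subrr; split; apply: ord0.
have [J1 J2] := step (n + k); rewrite addnS.
have -> : (it (n + k).+1).1 - (it n).1 = ((it (n + k).+1).1 - (it (n + k)).1) + ((it (n + k)).1 - (it n).1) by ring.
have -> : (it (n + k).+1).2 - (it n).2 = ((it (n + k).+1).2 - (it (n + k)).2) + ((it (n + k)).2 - (it n).2) by ring.
by split; apply: ordD => //; apply: ordW (leq_addr k n) _.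
Qed.

(** From the n-th on, the iterates agree below order n, so the coefficient (i, j) of the limit is
    read off the iterate i + j + 1. The predicate [P] carries the invariants of the iteration
    (support, order, norm bounds); it must be closed under approximation to every order. *)
Lemma fixpoint : exists x : S * S, [/\ P x, Phi x = x & forall n, ord n (x.1 - (iter n Phi x0).1) /\ ord n
  (x.2 - (iter n Phi x0).2)].
Proof.
pose x : S * S := (Fps (fun i => Fps (fun j => (it (i + j).+1).1 i j)), Fps (fun i => Fps (fun j =>
  (it (i + j).+1).2 i j))).
have Hx n : ord n (x.1 - (it n).1) /\ ord n (x.2 - (it n).2).
  split=> i j lt; rewrite cB /=; have [I1 I2] := stepk (i + j).+1 (n - (i + j).+1).
    by have := I1 i j (ltnSn _); rewrite cB subnKC // => /eqP; rewrite subr_eq0 => /eqP ->; rewrite subrr.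
  by have := I2 i j (ltnSn _); rewrite cB subnKC // => /eqP; rewrite subr_eq0 => /eqP ->; rewrite subrr.
have Px : P x by apply: Pclosed => N; exists (it N); have [] := Hx N; split.
exists x; split => //.
have E n : ord n ((Phi x).1 - x.1) /\ ord n ((Phi x).2 - x.2).
  have [H1 H2] := Hx n; have [J1 J2] := Hx n.+1.
  have [I1 I2] := Pcontr Px (Pit n) H1 H2.
  have -> : (Phi x).1 - x.1 = ((Phi x).1 - (it n.+1).1) - (x.1 - (it n.+1).1) by ring.
  have -> : (Phi x).2 - x.2 = ((Phi x).2 - (it n.+1).2) - (x.2 - (it n.+1).2) by ring.
  by split; apply: ordB; apply: ordW (leqnSn n) _.
by rewrite (surjective_pairing (Phi x)) (surjective_pairing x); congr (_, _); apply: ord_eq => n; have [] := E n.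
Qed.
End Fix.

(** * Eigenfunctions with prescribed cofactor, scalar linear equations, powers *)

Section Lin.
Variable K : numFieldType.
Notation S := (fps (fps K)).
Implicit Types f g h u v : S.
Notation z := (Xz K).
Notation w := (Xw K).

Definition supp (Sp : nat -> nat -> bool) f := forall i j, ~~ Sp i j -> f i j = 0.

Definition divl (lam : nat -> nat -> K) f : S := Fps (fun i => Fps (fun j => f i j / lam i j)).
Lemma cdivl lam f i j : divl lam f i j = f i j / lam i j. Proof. by []. Qed.
Lemma divlB lam f g : divl lam f - divl lam g = divl lam (f - g).
Proof. by apply: serP => i j; rewrite cB !cdivl cB mulrBl. Qed.
Lemma ord_divl lam N f : ord N f -> ord N (divl lam f).
Proof. by move=> H i j lt; rewrite cdivl H ?mul0r. Qed.

(** Fixed point of F = z^i0 w^j0 - (T F) / lam. Division by zero yields zero, so a vanishing divisor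
    silently drops its equation; the last hypothesis restores it, and also keeps the iteration
    inside the support [Sp]. *)
Lemma lin_solve (lam : nat -> nat -> K) (T : S -> S) (Sp : nat -> nat -> bool) i0 j0 :
  {morph T : f g / f - g} -> (forall N f, ord N f -> ord N.+1 (T f)) ->
  lam i0 j0 = 0 -> Sp i0 j0 ->
  (forall f, supp Sp f -> ord (i0 + j0) f ->
     forall i j, ~~ Sp i j || (lam i j == 0) -> T f i j = 0) ->
  exists F, [/\ ord (i0 + j0).+1 (F - mono 1 i0 j0), supp Sp F &
    forall i j, lam i j * F i j + T F i j = 0].
Proof.
move=> TB Tord lam0 Sp0 HT.
pose Phi (x : S * S) : S * S := (mono 1 i0 j0 - divl lam (T x.1), 0).
pose P (x : S * S) := supp Sp x.1 /\ ord (i0 + j0) x.1.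
have omono : ord (i0 + j0) (mono (1 : K) i0 j0).
  by move=> i j lt; rewrite cmono; case: ifP => // /andP[/eqP ei /eqP ej]; move: lt; rewrite ei ej ltnn.
have smono : supp Sp (mono (1 : K) i0 j0).
  by move=> i j; rewrite cmono; case: ifP => // /andP[/eqP -> /eqP ->]; rewrite Sp0.
have [||||x [[Px1 Px2] Px3 _]] := @fixpoint K Phi P _ _ (mono 1 i0 j0, 0) _ _.
- move=> [f f'] [/= H1 H2]; split=> [i j H|].
    by rewrite cB cdivl smono // (HT f) ?H // mul0r subr0.
  by apply: ordB => //; apply: ord_divl; apply: ordW (Tord _ _ H2).
- move=> N [f f'] [g g'] [/= _ _] [/= _ _] H1 _; split; last by rewrite subrr; apply: ord0.
  have -> : mono 1 i0 j0 - divl lam (T f) - (mono 1 i0 j0 - divl lam (T g)) = divl lam (T g) - divl lam (T f) by ring.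
  by rewrite divlB -TB; apply/ord_divl/Tord; rewrite -opprB; apply: ordN.
- by split.
- move=> [f f'] H; split=> [i j nS|i j lt].
    have [[g g'] [[/= Sg _] H1 _]] := H (i + j).+1.
    by have := H1 i j (ltnSn _); rewrite cB (Sg i j nS) subr0.
  have [[g g'] [[/= _ Og] H1 _]] := H (i + j).+1.
  by have := H1 i j (ltnSn _); rewrite cB (Og i j lt) subr0.
exists x.1; have E : x.1 = mono 1 i0 j0 - divl lam (T x.1) by rewrite -{1}Px3.
split => //.
  rewrite {1}E addrC addKr; apply/ordN/ord_divl; exact: Tord.
move=> i j; case: (eqVneq (lam i j) 0) => [l0|l0].
  by rewrite l0 mul0r add0r; apply: HT => //; rewrite l0 eqxx orbT.
rewrite {1}E cB cdivl cmono; case: ifP => [/andP[/eqP ei /eqP ej]|_].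
  by move: l0; rewrite ei ej lam0 eqxx.
by rewrite sub0r mulrN mulrC mulfVK // addNr.
Qed.

Lemma vf_diag a b f i j : vf (C2 a * z) (C2 b * w) f i j = (a * i%:R + b * j%:R) * f i j.
Proof.
rewrite /vf cD -!mulrA !cCM cXzM cXwM; case: i => [|i]; case: j => [|j];
  rewrite ?cd1 ?cd2 ?mulr0 ?mulr0n ?mul0r ?addr0 ?add0r ?mul0r // -!(mulr_natr (f _ _)); ring.
Qed.

Lemma vfDl p q p' q' f : vf (p + p') (q + q') f = vf p q f + vf p' q' f.
Proof. rewrite /vf; ring. Qed.

(** Existence of an eigenfunction with cofactor m + r that starts with a monomial of eigenvalue m.
    The support [Sp] is the means to verify the resonant equations: it will be a half-plane of
    weights, the series in [w] alone, or everything. *)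
Lemma lin_vf (a b m : K) (p q r : S) (Sp : nat -> nat -> bool) i0 j0 :
  ord 2 p -> ord 2 q -> ord 1 r ->
  a * i0%:R + b * j0%:R = m -> Sp i0 j0 ->
  (forall f, supp Sp f -> ord (i0 + j0) f ->
     forall i j, ~~ Sp i j || (a * i%:R + b * j%:R == m) -> (vf p q f - r * f) i j = 0) ->
  exists F, [/\ ord (i0 + j0).+1 (F - mono 1 i0 j0), supp Sp F &
    vf (C2 a * z + p) (C2 b * w + q) F = (C2 m + r) * F].
Proof.
move=> Hp Hq Hr E0 Sp0 H.
have [||||| F [H1 H2 H3]] := @lin_solve (fun i j => a * i%:R + b * j%:R - m) (fun f => vf p q f - r * f) Sp i0 j0.
- by move=> f g; rewrite (derB (vf_derivation p q)); ring.
- move=> N f Hf; apply: ordB; first exact: ord_vf2.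
  by rewrite -add1n; apply: ordM.
- by rewrite E0 subrr.
- by [].
- by move=> f Hf Of i j; rewrite subr_eq0; apply: H.
exists F; split => //; rewrite vfDl; apply: serP => i j.
rewrite [(C2 m + r) * F]mulrDl (cD (C2 m * F)) cCM (cD (vf (C2 a * z) _ F)) vf_diag; apply/eqP;
  rewrite -subr_eq0; apply/eqP.
by rewrite -(H3 i j) cB; ring.
Qed.

Lemma ord1_eq D f : ord 1 (D - 1) -> D * f = 0 -> f = 0.
Proof.
move=> HD E; apply: ord_eq => N; rewrite subr0; elim: N => // N IH.
have -> : f = D * f - (D - 1) * f by ring.
by rewrite E sub0r; apply: ordN; rewrite -add1n; apply: ordM.
Qed.
Lemma unit_cancel D f g : ord 1 (D - 1) -> D * f = D * g -> f = g.
Proof.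
move=> HD E; apply/eqP; rewrite -subr_eq0; apply/eqP/(ord1_eq HD).
by rewrite mulrBr E subrr.
Qed.
Lemma z_cancel f g : z * f = z * g -> f = g.
Proof. by move=> E; apply: serP => i j; have := cXzM f i.+1 j; rewrite E cXzM. Qed.
Lemma w_cancel f g : w * f = w * g -> f = g.
Proof. by move=> E; apply: serP => i j; have := cXwM f i j.+1; rewrite E cXwM. Qed.

(** The equation c g' = d g for series in [w] alone. Multiplied by w it becomes an eigenfunction
    problem for a field with linear part w, where only the constant term is resonant. *)
Lemma ode (c d : S) : ord 1 (c - 1) -> (forall i j, c i.+1 j = 0) -> (forall i j, d i.+1 j = 0) ->
  exists g, [/\ ord 1 (g - 1), d1 g = 0 & c * d2 g = d * g].
Proof.
move=> Hc c_w d_w; pose Sp (i j : nat) := i == 0%N.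
have [||||||F [H1 H2 H3]] := @lin_vf 0 1 0 0 (w * (c - 1)) (w * d) Sp 0 0.
- exact: ord0.
- by apply: (@ordM _ 1 1) => //; apply: ord_w.
- by apply: ordMr; apply: ord_w.
- by rewrite mul0r mul1r addr0.
- by [].
- move=> f Hf _ i j; rewrite mul0r add0r mul1r pnatr_eq0 /Sp.
  have -> : vf 0 (w * (c - 1)) f - w * d * f = w * ((c - 1) * d2 f - d * f) by rewrite /vf; ring.
  rewrite cXwM; case: j => [|j] //; rewrite orbF => i0.
  rewrite cB !cM big1 ?sub0r; last first.
    move=> a _; rewrite big1 // => b _; case: a => -[|a] la /=.
      by rewrite subn0 cd2 Hf ?mul0rn ?mulr0.
    by rewrite cB c_w c1 subr0 mul0r.
  apply/eqP; rewrite oppr_eq0; apply/eqP; rewrite big1 // => a _; rewrite big1 // => b _.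
  case: a => -[|a] la /=; last by rewrite d_w mul0r.
  by rewrite subn0 Hf ?mulr0.
exists F; rewrite addn0 /mono !expr0 rmorph1 !mulr1 in H1; split => //.
  by apply: serP => i j; rewrite cd1 H2 ?mul0rn ?c0.
apply: w_cancel; move: H3; rewrite !rmorph0 rmorph1 /vf => H3.
have -> : w * (c * d2 F) = (0 * z + 0) * d1 F + (1 * w + w * (c - 1)) * d2 F by ring.
by rewrite H3; ring.
Qed.

Lemma vf_comp_w p q g u : d1 g = 0 -> ord 1 u -> vf p q (comp g 0 u) = comp (d2 g) 0 u * vf p q u.
Proof.
move=> g1 Hu; rewrite vf_comp //; last exact: ord0.
by rewrite g1 comp0 // ?mul0r ?add0r //; exact: ord0.
Qed.

Lemma ord_comp1 g u v : ord 1 u -> ord 1 v -> ord 1 (g - 1) -> ord 1 (comp g u v - 1).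
Proof.
by move=> Hu Hv Hg; rewrite -(comp1 Hu Hv) -compB //; apply: ord_comp.
Qed.

(** [E] is the power [a] of [D], obtained as g (D - 1) with (1 + w) g' = a g. The effect on
    cofactors is the property of powers that the linearizations rely on. *)
Lemma pow_ex (D : S) (a : K) : ord 1 (D - 1) ->
  exists E, ord 1 (E - 1) /\ forall p q k, vf p q D = k * D -> vf p q E = C2 a * k * E.
Proof.
move=> HD.
have [|||g [g0 g1 g2]] := @ode (1 + w) (C2 a).
- by rewrite addrC addKr; apply: ord_w.
- by move=> i j; rewrite cD c1 cXw addr0.
- by move=> i j; rewrite cC.
have H0 : ord 1 (0 : S) by exact: ord0.
exists (comp g 0 (D - 1)); split; first exact: ord_comp1.
move=> p q k Hk; rewrite vf_comp_w // (derB (vf_derivation p q)) (der1 (vf_derivation p q)) subr0 Hk.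
have := congr1 (fun f => comp f 0 (D - 1)) g2.
rewrite !compM // compD // comp1 // compw // compC // => E.
apply: (unit_cancel HD); transitivity (k * D * ((1 + (D - 1)) * comp (d2 g) 0 (D - 1))); first by ring.
by rewrite E; ring.
Qed.
End Lin.

(** * Convergence and normal forms *)

Section Norm.
Variable K : numFieldType.
Notation S := (fps (fps K)).
Implicit Types f g h u v : S.
Notation z := (Xz K).
Notation w := (Xw K).

(** Weighted l1 norm of a square truncation; a bound uniform in [n] expresses absolute convergence
    on the polydisc of radius [r] without infinite sums. *)
Definition nrm n (r : K) f := \sum_(i < n) \sum_(j < n) `|f i j| * r ^+ (i + j).

(** The right-hand side is the value at 1 of a product of two polynomials; the left-hand side keeps
    only its coefficients of index below [n], and the others are nonnegative. *)
Lemma cauchy_le (n : nat) (F G : nat -> K) : (forall i, 0 <= F i) -> (forall i, 0 <= G i) ->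
  \sum_(i < n) \sum_(a < i.+1) F a * G (i - a)%N <= (\sum_(i < n) F i) * (\sum_(i < n) G i).
Proof.
move=> F0 G0; pose p := \poly_(i < n) F i; pose q := \poly_(i < n) G i.
have p0 i : 0 <= p`_i by rewrite coef_poly; case: ifP.
have q0 i : 0 <= q`_i by rewrite coef_poly; case: ifP.
have hE (H : nat -> K) : (\poly_(i < n) H i).[1] = \sum_(i < n) H i.
  rewrite (horner_coef_wide _ (size_poly _ _)); apply: eq_bigr => i _.
  by rewrite expr1n mulr1 coef_poly ltn_ord.
rewrite -(hE F) -(hE G) -hornerM.
rewrite -/p -/q; have sz : (size (p * q)%R <= n + n)%N.
  apply: leq_trans (size_polyMleq _ _) _; have := size_poly n F; have := size_poly n G.
  rewrite -/p -/q; lia.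
rewrite (horner_coef_wide _ sz) big_split_ord /= -[X in X <= _]addr0.
apply: lerD; last first.
  apply: sumr_ge0 => i _; rewrite expr1n mulr1 coefM; apply: sumr_ge0 => j _; exact: mulr_ge0.
apply: ler_sum => i _; rewrite expr1n mulr1 coefM le_eqVlt; apply/orP; left; apply/eqP.
apply: eq_bigr => a _; rewrite !coef_poly !ifT //.
  by apply: leq_ltn_trans (leq_subr _ _) _.
by apply: leq_ltn_trans (ltn_ord i); rewrite -ltnS.
Qed.

Section R.
Variable r : K.
Hypothesis r0 : 0 <= r.

Lemma nrm_term_ge0 f i j : 0 <= `|f i j| * r ^+ (i + j).
Proof. by apply: mulr_ge0 => //; apply: exprn_ge0. Qed.
Lemma nrm_ge0 n f : 0 <= nrm n r f.
Proof. by apply: sumr_ge0 => i _; apply: sumr_ge0 => j _; apply: nrm_term_ge0. Qed.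
Lemma nrm_le n f g : (forall i j, `|f i j| <= `|g i j|) -> nrm n r f <= nrm n r g.
Proof.
move=> H; apply: ler_sum => i _; apply: ler_sum => j _.
by apply: ler_wpM2r => //; apply: exprn_ge0.
Qed.
Lemma nrmD n f g : nrm n r (f + g) <= nrm n r f + nrm n r g.
Proof.
rewrite -big_split; apply: ler_sum => i _; rewrite -big_split; apply: ler_sum => j _ /=.
by rewrite -mulrDl cD; apply: ler_wpM2r; [apply: exprn_ge0 | apply: ler_normD].
Qed.
Lemma nrmN n f : nrm n r (- f) = nrm n r f.
Proof. by apply: eq_bigr => i _; apply: eq_bigr => j _; rewrite cN normrN. Qed.
Lemma nrm0 n : nrm n r 0 = 0.
Proof. by rewrite /nrm big1 // => i _; rewrite big1 // => j _; rewrite c0 normr0 mul0r. Qed.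
Lemma nrm_sum n I (s : seq I) (P : pred I) (F : I -> S) :
  nrm n r (\sum_(k <- s | P k) F k) <= \sum_(k <- s | P k) nrm n r (F k).
Proof.
elim/big_rec2: _ => [|i x y _ H]; first by rewrite nrm0.
by apply: le_trans (nrmD _ _ _) _; rewrite lerD2l.
Qed.
Lemma nrmCM n a f : nrm n r (C2 a * f) = `|a| * nrm n r f.
Proof.
rewrite mulr_sumr; apply: eq_bigr => i _; rewrite mulr_sumr; apply: eq_bigr => j _.
by rewrite cCM normrM mulrA.
Qed.
Lemma nrmM n f g : nrm n r (f * g) <= nrm n r f * nrm n r g.
Proof.
pose F a b := `|f a b| * r ^+ (a + b); pose G a b := `|g a b| * r ^+ (a + b).
have F0 a b : 0 <= F a b by apply: nrm_term_ge0.
have G0 a b : 0 <= G a b by apply: nrm_term_ge0.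
have H1 : nrm n r (f * g) <= \sum_(i < n) \sum_(j < n) \sum_(a < i.+1) \sum_(b < j.+1) F a b * G (i - a)%N (j - b)%N.
  apply: ler_sum => i _; apply: ler_sum => j _.
  rewrite cM; apply: le_trans (ler_wpM2r _ (ler_norm_sum _ _ _)) _; first exact: exprn_ge0.
  rewrite mulr_suml; apply: ler_sum => a _.
  apply: le_trans (ler_wpM2r _ (ler_norm_sum _ _ _)) _; first exact: exprn_ge0.
  rewrite mulr_suml; apply: ler_sum => b _; rewrite normrM /F /G.
  have -> : (i + j = (a + b) + (i - a + (j - b)))%N by have := ltn_ord a; have := ltn_ord b; lia.
  by rewrite exprD mulrACA.
apply: le_trans H1 _.
have H2 : \sum_(i < n) \sum_(j < n) \sum_(a < i.+1) \sum_(b < j.+1) F a b * G (i - a)%N (j - b)%N <=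
   \sum_(i < n) \sum_(a < i.+1) (\sum_(b < n) F a b) * (\sum_(b < n) G (i - a)%N b).
  apply: ler_sum => i _; rewrite exchange_big /=; apply: ler_sum => a _.
  exact: (@cauchy_le n (F a) (G (i - a)%N)).
apply: le_trans H2 _.
by apply: (@cauchy_le n (fun a => \sum_(b < n) F a b) (fun a => \sum_(b < n) G a b)) => i; apply: sumr_ge0.
Qed.
Lemma nrm1 n : nrm n r 1 <= 1.
Proof.
case: n => [|n]; first by rewrite /nrm big_ord0 ler01.
rewrite /nrm big_ord_recl big_ord_recl c1 /= normr1 mulr1 big1 ?addr0 => [|j _]; last first.
  by rewrite c1 normr0 mul0r.
by rewrite big1 ?addr0 // => i _; rewrite big1 // => j _; rewrite c1 normr0 mul0r.
Qed.
Lemma nrmX n f k : nrm n r (f ^+ k) <= nrm n r f ^+ k.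
Proof.
elim: k => [|k IH]; first by rewrite !expr0; apply: nrm1.
rewrite !exprS; apply: le_trans (nrmM _ _ _) _; apply: ler_wpM2l => //; exact: nrm_ge0.
Qed.
Lemma nrmz n : nrm n r z <= r.
Proof.
have H f : nrm n r (z * f) <= r * nrm n r f.
  case: n => [|n]; first by rewrite /nrm !big_ord0 mulr0.
  rewrite {1}/nrm big_ord_recl big1 ?add0r; last by move=> j _; rewrite cXzM normr0 mul0r.
  rewrite mulr_sumr [X in _ <= X]big_ord_recr /= -[X in X <= _]addr0; apply: lerD.
    apply: ler_sum => i _; rewrite mulr_sumr; apply: ler_sum => j _.
    by rewrite cXzM /= /bump /= add1n addSn exprS mulrCA.
  by apply: mulr_ge0 => //; apply: sumr_ge0 => j _; apply: nrm_term_ge0.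
have := H 1; rewrite mulr1 => /le_trans -> //.
by rewrite -[X in _ <= X]mulr1; apply: ler_wpM2l => //; apply: nrm1.
Qed.
Lemma nrmw n : nrm n r w <= r.
Proof.
have -> : nrm n r w = nrm n r z.
  rewrite /nrm exchange_big; apply: eq_bigr => i _; apply: eq_bigr => j _.
  by rewrite cXw cXz addnC andbC.
exact: nrmz.
Qed.
Lemma nrm_ord n f g : ord (n + n) (f - g) -> nrm n r f = nrm n r g.
Proof.
move=> H; apply: eq_bigr => i _; apply: eq_bigr => j _; congr (`|_| * _); apply/eqP.
rewrite -subr_eq0 -cB; apply/eqP/H; have := ltn_ord i; have := ltn_ord j; lia.
Qed.
End R.

Lemma nrm_scale n (r s : K) f k : 0 < r -> 0 <= s <= r -> ord k f -> nrm n s f <= (s / r) ^+ k * nrm n r f.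
Proof.
move=> r0 /andP[s0 sr] Hf; rewrite mulr_sumr; apply: ler_sum => i _; rewrite mulr_sumr; apply: ler_sum => j _.
case: (ltnP (i + j) k) => [/Hf ->|le]; first by rewrite normr0 !mul0r mulr0.
rewrite mulrCA; apply: ler_wpM2l => //.
have -> : s ^+ (i + j) = (s / r) ^+ (i + j) * r ^+ (i + j).
  by rewrite -exprMn divfK // gt_eqF.
apply: ler_wpM2r; first by apply: exprn_ge0; apply: ltW.
apply: ler_wiXn2l => //; first by rewrite divr_ge0 // ltW.
by rewrite ler_pdivrMr // mul1r.
Qed.

(** Coefficients with both indices below [n] have total degree below n + n, so the partial sum of
    that size already computes them exactly. *)
Lemma nrm_comp n (r s t : K) f u v k : 0 < r -> 0 <= s -> 0 <= t <= r -> ord 1 u -> ord 1 v ->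
  nrm n s u <= t -> nrm n s v <= t -> ord k f ->
  nrm n s (comp f u v) <= (t / r) ^+ k * nrm (n + n) r f.
Proof.
move=> r0 s0 tr Hu Hv nu nv Hf; have /andP[t0 _] := tr.
apply: le_trans (nrm_scale _ r0 tr Hf).
rewrite -(nrm_ord s0 (@psum_comp K u v Hu Hv (n + n) f)) /psum.
apply: le_trans (nrm_sum s0 _ _ _ _) _; apply: ler_sum => a _.
apply: le_trans (nrm_sum s0 _ _ _ _) _; apply: ler_sum => b _.
rewrite nrmCM; apply: ler_wpM2l => //; rewrite exprD.
apply: le_trans (nrmM s0 _ _ _) _.
apply: ler_pM; rewrite ?nrm_ge0 //.
  by apply: le_trans (nrmX s0 _ _ _) _; rewrite lerXn2r ?nnegrE ?nrm_ge0.
by apply: le_trans (nrmX s0 _ _ _) _; rewrite lerXn2r ?nnegrE ?nrm_ge0.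
Qed.

Definition conv f := exists r M : K, 0 < r /\ forall n, nrm n r f <= M.

(** The norm bound 2 s is one of the invariants of the formal iteration, so the solution converges
    by construction. Used with the division by the small divisors to get the normal form, and with
    the opposite to invert a map tangent to the identity. *)
Lemma contr_solve (p q : S) (A B : S -> S) (r M : K) :
  ord 2 p -> ord 2 q -> 0 < r -> (forall n, nrm n r p <= M) -> (forall n, nrm n r q <= M) ->
  {morph A : f g / f - g} -> {morph B : f g / f - g} ->
  (forall N f, ord N f -> ord N (A f)) -> (forall N f, ord N f -> ord N (B f)) ->
  (forall n (s : K) f, 0 <= s -> nrm n s (A f) <= nrm n s f) ->
  (forall n (s : K) f, 0 <= s -> nrm n s (B f) <= nrm n s f) ->
  exists (x y : S) (s : K), [/\ x = z + A (comp p x y), y = w + B (comp q x y),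
    ord 2 (x - z), ord 2 (y - w) &
    0 < s /\ forall n, nrm n s x <= s *+ 2 /\ nrm n s y <= s *+ 2].
Proof.
move=> Hp Hq r0 Mp Mq AB BB Aord Bord An Bn.
have M0 : 0 <= M by apply: le_trans (Mp 0%N); apply: nrm_ge0; apply: ltW.
(* This radius gives 2 s <= r and (2 s / r)^2 M <= s, where the exponent 2 is the order of [p] and
   [q]. Hence series of norm at most 2 s are mapped to series of norm at most s + s. *)
pose s := r ^+ 2 / (M *+ 4 + r *+ 2).
have den0 : 0 < M *+ 4 + r *+ 2.
  by apply: ltr_wpDl; [rewrite mulrn_wge0 | rewrite mulrn_wgt0].
have s0 : 0 < s by rewrite divr_gt0 // exprn_gt0.
have sr : s *+ 2 <= r.
  rewrite -mulr_natl /s mulrA ler_pdivrMr // mulrDr expr2.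
  have -> : r * (r *+ 2) = 2 * (r * r) by ring.
  by rewrite lerDr mulr_ge0 ?mulrn_wge0 // ltW.
have sM : (s *+ 2 / r) ^+ 2 * M <= s.
  have -> : (s *+ 2 / r) ^+ 2 * M = s * (s * (M *+ 4) / r ^+ 2).
    by rewrite -(mulr_natl s) -(mulr_natl M); field; rewrite gt_eqF.
  rewrite -[X in _ <= X]mulr1; apply: ler_wpM2l; first exact: ltW.
  rewrite ler_pdivrMr ?exprn_gt0 // mul1r /s mulrAC ler_pdivrMr //.
  apply: ler_wpM2l; first by apply/exprn_ge0/ltW.
  by rewrite lerDl mulrn_wge0 // ltW.
have s2 : 0 <= s *+ 2 <= r by rewrite sr andbT mulrn_wge0 // ltW.
have s0' := ltW s0.
pose Phi (x : S * S) : S * S := (z + A (comp p x.1 x.2), w + B (comp q x.1 x.2)).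
pose P (x : S * S) := [/\ ord 1 x.1, ord 1 x.2 & forall n, nrm n s x.1 <= s *+ 2 /\ nrm n s x.2 <= s *+ 2].
have bnd (f f' : S) C (c : S) n : (forall n (s : K) f, 0 <= s -> nrm n s (C f) <= nrm n s f) -> nrm n s c <= s ->
   ord 1 f -> ord 1 f' ->
   nrm n s f <= s *+ 2 -> nrm n s f' <= s *+ 2 -> forall k, ord 2 k -> (forall n, nrm n r k <= M) ->
   nrm n s (c + C (comp k f f')) <= s *+ 2.
  move=> Cn cs of1 of2 nf nf' k Hk Mk; rewrite mulr2n.
  apply: le_trans (nrmD s0' _ _ _) _; apply: lerD; first exact: cs.
  apply: le_trans (Cn _ _ _ s0') _.
  apply: le_trans (nrm_comp r0 s0' s2 of1 of2 nf nf' Hk) _.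
  by apply: le_trans sM; apply: ler_wpM2l => //; apply: exprn_ge0; rewrite divr_ge0 // ?mulrn_wge0 // ltW.
have [||||x [[P1 P2 P3] Px _]] := @fixpoint K Phi P _ _ (z, w) _ _.
- move=> [f f'] [/= H1 H2 H3]; split=> [||n] /=.
  + by apply: ordD; [apply: ord_z | apply/Aord/ord_comp/(ordW _ Hp)].
  + by apply: ordD; [apply: ord_w | apply/Bord/ord_comp/(ordW _ Hq)].
  have [n1 n2] := H3 n; split; apply: bnd => //; [exact: nrmz | exact: nrmw].
- move=> N [f f'] [g g'] [/= H1 H2 _] [/= H3 H4 _] H5 H6; split.
    have -> : z + A (comp p f f') - (z + A (comp p g g')) = A (comp p f f') - A (comp p g g') by ring.
    by rewrite -AB -addn1; apply/Aord/ord_compB.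
  have -> : w + B (comp q f f') - (w + B (comp q g g')) = B (comp q f f') - B (comp q g g') by ring.
  by rewrite -BB -addn1; apply/Bord/ord_compB.
- split=> [||n] /=; [exact: ord_z | exact: ord_w |].
  by split; [apply: le_trans (nrmz s0' n) _ | apply: le_trans (nrmw s0' n) _]; rewrite mulr2n lerDl.
- move=> [f f'] H; split=> [||n].
  + have [[g g'] [[/= Og _ _] H1 _]] := H 1%N.
    by rewrite /= -(subrK g f); apply: ordD.
  + have [[g g'] [[/= _ Og _] _ H1]] := H 1%N.
    by rewrite /= -(subrK g' f'); apply: ordD.
  have [[g g'] [[/= _ _ N1] H1 H2]] := H (n + n)%N.
  by rewrite (nrm_ord s0' H1) (nrm_ord s0' H2).
have E1 : x.1 = z + A (comp p x.1 x.2) by rewrite -{1}Px.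
have E2 : x.2 = w + B (comp q x.1 x.2) by rewrite -{1}Px.
exists x.1, x.2, s; split=> //.
  by rewrite {1}E1 addrC addKr; apply/Aord/ord_comp.
by rewrite {1}E2 addrC addKr; apply/Bord/ord_comp.
Qed.
End Norm.

(** * Normal form and convergence of a linearization *)

Section Linearizable.
Variable K : numFieldType.
Notation S := (fps (fps K)).
Implicit Types f g h u v : S.
Notation z := (Xz K).
Notation w := (Xw K).

Definition linearizes (P Q Z W : S) :=
  [/\ ord 2 (Z - z), ord 2 (W - w), vf P Q Z = Z & vf P Q W = - W].

Definition lam1 (i j : nat) : K := i%:R - j%:R - 1.
Definition lam2 (i j : nat) : K := i%:R - j%:R + 1.

Lemma natB_norm (i j : nat) : i%:R - j%:R = 0 :> K \/ 1 <= `|i%:R - j%:R : K|.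
Proof.
wlog le : i j / (i <= j)%N => [H|].
  by case: (leqP i j) => [/H //|/ltnW /H [H1|H1]]; [left; rewrite -(opprB j%:R) H1 oppr0 | right; rewrite distrC].
have -> : `|i%:R - j%:R : K| = (j - i)%:R by rewrite distrC -natrB // normr_nat.
case: (posnP (j - i)) => [E|E]; last by right; rewrite ler1n.
by left; rewrite -(opprB j%:R) -natrB // E oppr0.
Qed.
Lemma divl_norm (lam : nat -> nat -> K) f i j : (forall i j, lam i j = 0 \/ 1 <= `|lam i j|) ->
  `|divl lam f i j| <= `|f i j|.
Proof.
move=> H; rewrite cdivl normrM normfV; case: (H i j) => [->|l1]; first by rewrite normr0 invr0 mulr0.
by rewrite ler_pdivrMr ?(lt_le_trans ltr01) // -[X in X <= _]mulr1 ler_wpM2l.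
Qed.
Lemma lam1_norm i j : lam1 i j = 0 \/ 1 <= `|lam1 i j|.
Proof. by have := natB_norm i j.+1; rewrite /lam1 -[j.+1]addn1 natrD opprD addrA. Qed.
Lemma lam2_norm i j : lam2 i j = 0 \/ 1 <= `|lam2 i j|.
Proof. by have := natB_norm i.+1 j; rewrite /lam2 -[i.+1]addn1 natrD addrAC. Qed.

Lemma cvfL f i j : vf z (- w) f i j = (i%:R - j%:R) * f i j.
Proof.
have := vf_diag 1 (-1) f i j.
by rewrite rmorph1 rmorphN1 mul1r !mulN1r mul1r.
Qed.

Lemma comp_assoc f u v u' v' : ord 1 u -> ord 1 v -> ord 1 u' -> ord 1 v' ->
  comp (comp f u v) u' v' = comp f (comp u u' v') (comp v u' v').
Proof.
move=> Hu Hv Hu' Hv'.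
have Hcu : ord 1 (comp u u' v') by exact: ord_comp.
have Hcv : ord 1 (comp v u' v') by exact: ord_comp.
apply/eqP; rewrite -subr_eq0; apply/eqP; move: f.
apply: (@ser_ind K (fun f => comp (comp f u v) u' v' - comp f (comp u u' v') (comp v u' v')) 0) => [f g|N f H|a i j].
- by rewrite !compD; ring.
- by rewrite addn0 in H; apply: ordB; do ?apply: ord_comp.
by rewrite !comp_mono // !compM // compC // !compX // subrr.
Qed.

(** Each substitution of the system into itself raises the order of [E] and [G] by one. *)
Lemma ord_solve2 a b c d (E G : S) : ord 1 a -> ord 1 b -> ord 1 c -> ord 1 d ->
  E = a * E + b * G -> G = c * E + d * G -> E = 0 /\ G = 0.
Proof.
move=> Ha Hb Hc Hd HE HG.
have H N : ord N E /\ ord N G.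
  elim: N => [|N [IE IG]]; first by split; apply: ord_0.
  by split; [rewrite HE | rewrite HG]; rewrite -add1n; apply: ordD; apply: ordM.
by split; apply: ord_eq => N; rewrite subr0; have [] := H N.
Qed.

Lemma nrm_opp n (s : K) f : nrm n s (- f) <= nrm n s f.
Proof. by rewrite /nrm; apply: ler_sum => i _; apply: ler_sum => j _; rewrite cN normrN. Qed.

(** The unknown [(x, y)] expresses the original coordinates through the normalised ones. In this
    direction derivatives of the unknown occur only along the linear field, where they are
    multiplication by i - j, so the equation is solved by division. Nothing is claimed at resonant
    monomials, where the division returned zero. *)
Lemma normal_form p q : ord 2 p -> ord 2 q -> conv p -> conv q ->
  exists (x y : S) (s : K), [/\ ord 2 (x - z), ord 2 (y - w),
    0 < s /\ (forall n, nrm n s x <= s *+ 2 /\ nrm n s y <= s *+ 2),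
    forall i j, lam1 i j != 0 -> vf z (- w) x i j = (x + comp p x y) i j
    & forall i j, lam2 i j != 0 -> vf z (- w) y i j = (- y + comp q x y) i j].
Proof.
move=> Hp Hq [r1 [M1 [r10 B1]]] [r2 [M2 [r20 B2]]].
have [r [r0 [rr1 rr2]]] : exists r : K, 0 < r /\ (0 <= r <= r1) /\ (0 <= r <= r2).
  have : (r1 >=< r2)%O by apply: real_comparable; apply: gtr0_real.
  by case/orP => le; [exists r1 | exists r2]; rewrite lexx le !ltW.
have N1 n : nrm n r p <= M1 + M2.
  apply: le_trans (nrm_scale (k := 0) n r10 rr1 _) _; first exact: ord_0.
  rewrite expr0 mul1r; apply: le_trans (B1 n) _; rewrite lerDl.
  by apply: le_trans (B2 n); apply: nrm_ge0; apply: ltW.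
have N2 n : nrm n r q <= M1 + M2.
  apply: le_trans (nrm_scale (k := 0) n r20 rr2 _) _; first exact: ord_0.
  rewrite expr0 mul1r; apply: le_trans (B2 n) _; rewrite lerDr.
  by apply: le_trans (B1 n); apply: nrm_ge0; apply: ltW.
have dB (lam : nat -> nat -> K) : {morph divl lam : f g / f - g} by move=> f g; rewrite divlB.
have [||||x [y [s [Ex Ey Hx Hy Hs]]]] := @contr_solve K p q (divl lam1) (divl lam2) r (M1 + M2) Hp Hq r0 N1
  N2 (dB _) (dB _).
- by move=> N f; apply: ord_divl.
- by move=> N f; apply: ord_divl.
- by move=> n t f t0; apply: nrm_le => // i j; apply: divl_norm; apply: lam1_norm.
- by move=> n t f t0; apply: nrm_le => // i j; apply: divl_norm; apply: lam2_norm.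
exists x, y, s; split => // i j l0.
  rewrite cvfL cD; have Eij : x i j = z i j + comp p x y i j / lam1 i j by rewrite {1}Ex cD cdivl.
  have z0 : lam1 i j * z i j = 0.
    rewrite cXz; case: eqP => [->|_]; last by rewrite mulr0.
    by case: eqP => [->|_]; rewrite ?mulr0 // /lam1 subr0 subrr mul0r.
  have -> : i%:R - j%:R = lam1 i j + 1 by rewrite /lam1 subrK.
  rewrite mulrDl mul1r addrC; congr (_ + _).
  by rewrite Eij mulrDr z0 add0r mulrCA mulfV // mulr1.
rewrite cvfL cD cN; have Eij : y i j = w i j + comp q x y i j / lam2 i j by rewrite {1}Ey cD cdivl.
have z0 : lam2 i j * w i j = 0.
  rewrite cXw; case: eqP => [->|_]; last by rewrite mulr0.
  by case: eqP => [->|_]; rewrite ?mulr0 // /lam2 sub0r addNr mul0r.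
have -> : i%:R - j%:R = lam2 i j - 1 by rewrite /lam2 addrK.
rewrite mulrBl mul1r addrC; congr (_ + _).
by rewrite Eij mulrDr z0 add0r mulrCA mulfV // mulr1.
Qed.

Lemma ord1_of2 f g : ord 2 (f - g) -> ord 1 g -> ord 1 f.
Proof. by move=> H1 H2; rewrite -(subrK g f); apply: ordD => //; apply: ordW H1. Qed.

Lemma ord_sim (D r : S) N : ord 1 (D - 1) -> ord N r -> ord N.+1 (D * r - r).
Proof.
move=> HD Hr; have -> : D * r - r = (D - 1) * r by ring.
by rewrite -add1n; apply: ordM.
Qed.

Lemma d1_lin f : ord 2 (f - z) -> ord 1 (d1 f - 1) /\ ord 1 (d2 f).
Proof.
move=> H; split.
  by have := ord_d1 H; rewrite (derB (d1_derivation K)) d1z.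
by have := ord_d2 H; rewrite (derB (d2_derivation K)) d2z subr0.
Qed.
Lemma d2_lin f : ord 2 (f - w) -> ord 1 (d2 f - 1) /\ ord 1 (d1 f).
Proof.
move=> H; split.
  by have := ord_d2 H; rewrite (derB (d2_derivation K)) d2w.
by have := ord_d1 H; rewrite (derB (d1_derivation K)) d1w subr0.
Qed.

(** The defects [r1] and [r2] live on resonant monomials. If they vanish below degree N, then in
    degree N the series [r1] coincides with (L - 1) (Z (x, y)), where L is the derivative along the
    linear field; but L - 1 kills the monomials where [r1] lives. The same holds for [r2] with W and
    L + 1. *)
Lemma normal_form_lin p q x y : ord 2 (x - z) -> ord 2 (y - w) ->
  (forall i j, lam1 i j != 0 -> vf z (- w) x i j = (x + comp p x y) i j) ->
  (forall i j, lam2 i j != 0 -> vf z (- w) y i j = (- y + comp q x y) i j) ->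
  (exists Z W, linearizes (z + p) (- w + q) Z W) ->
  vf z (- w) x = x + comp p x y /\ vf z (- w) y = - y + comp q x y.
Proof.
move=> Hx Hy Ex Ey [Z [W [HZ HW EZ EW]]].
have Ox := ord1_of2 Hx (ord_z K); have Oy := ord1_of2 Hy (ord_w K).
pose r1 := vf z (- w) x - (x + comp p x y); pose r2 := vf z (- w) y - (- y + comp q x y).
have Lcomp F : vf z (- w) (comp F x y) = comp (vf (z + p) (- w + q) F) x y + comp (d1 F) x y * r1 + comp
  (d2 F) x y * r2.
  rewrite vf_comp // /r1 /r2 /vf compD // !compM // !compD // compN // compz // compw //; ring.
have [Z1 Z2] := d1_lin HZ; have [W2 W1] := d2_lin HW.
have key N : ord N r1 /\ ord N r2.
  elim: N => [|N [I1 I2]]; first by split; apply: ord_0.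
  split=> i j; rewrite ltnS leq_eqVlt => /orP[/eqP eN|lt]; try by [apply: I1 | apply: I2].
    case: (eqVneq (lam1 i j) 0) => l0; last by rewrite /r1 cB Ex // subrr.
    have H : ord N.+1 (vf z (- w) (comp Z x y) - comp Z x y - r1).
      rewrite Lcomp EZ.
      have -> : comp Z x y + comp (d1 Z) x y * r1 + comp (d2 Z) x y * r2 - comp Z x y - r1 =
        (comp (d1 Z) x y * r1 - r1) + comp (d2 Z) x y * r2 by ring.
      apply: ordD; first by apply: ord_sim => //; apply: ord_comp1.
      by rewrite -add1n; apply: ordM => //; apply: ord_comp.
    have := H i j; rewrite eN ltnSn => /(_ isT); rewrite !cB cvfL.
    have -> : (i%:R - j%:R) * comp Z x y i j - comp Z x y i j = lam1 i j * comp Z x y i j by rewrite /lam1; ring.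
    by rewrite l0 mul0r sub0r => /eqP; rewrite oppr_eq0 => /eqP.
  case: (eqVneq (lam2 i j) 0) => l0; last by rewrite /r2 cB Ey // subrr.
  have H : ord N.+1 (vf z (- w) (comp W x y) + comp W x y - r2).
    rewrite Lcomp EW compN //.
    have -> : - comp W x y + comp (d1 W) x y * r1 + comp (d2 W) x y * r2 + comp W x y - r2 =
      (comp (d2 W) x y * r2 - r2) + comp (d1 W) x y * r1 by ring.
    apply: ordD; first by apply: ord_sim => //; apply: ord_comp1.
    by rewrite -add1n; apply: ordM => //; apply: ord_comp.
  have := H i j; rewrite eN ltnSn => /(_ isT); rewrite cB cD cvfL.
  have -> : (i%:R - j%:R) * comp W x y i j + comp W x y i j = lam2 i j * comp W x y i j by rewrite /lam2; ring.
  by rewrite l0 mul0r sub0r => /eqP; rewrite oppr_eq0 => /eqP.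
have e1 : r1 = 0 by apply: ord_eq => N; rewrite subr0; have [] := key N.
have e2 : r2 = 0 by apply: ord_eq => N; rewrite subr0; have [] := key N.
by split; apply/eqP; rewrite -subr_eq0; apply/eqP.
Qed.

(** The inverse [(X, Y)] of the normalising map linearizes the field because its two defects, X' - X
    and Y' + Y along the field, solve a homogeneous linear system whose matrix has no constant
    term. *)
Theorem convergent_linearization p q : ord 2 p -> ord 2 q -> conv p -> conv q ->
  (exists Z W, linearizes (z + p) (- w + q) Z W) ->
  exists Z W, [/\ linearizes (z + p) (- w + q) Z W, conv Z & conv W].
Proof.
move=> Hp Hq Cp Cq HF.
have [x [y [s [Hx Hy [s0 Ns] Ex Ey]]]] := normal_form Hp Hq Cp Cq.
have [Lx Ly] := normal_form_lin Hx Hy Ex Ey HF.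
have Ox := ord1_of2 Hx (ord_z K); have Oy := ord1_of2 Hy (ord_w K).
have s0' := ltW s0.
have M1 n : nrm n s (x - z) <= s *+ 3.
  apply: le_trans (nrmD s0' _ _ _) _; rewrite nrmN // mulrSr; apply: lerD; first by have [] := Ns n.
  exact: nrmz.
have M2 n : nrm n s (y - w) <= s *+ 3.
  apply: le_trans (nrmD s0' _ _ _) _; rewrite nrmN // mulrSr; apply: lerD; first by have [] := Ns n.
  exact: nrmw.
have oB : {morph (@GRing.opp S) : f g / f - g} by move=> f g; rewrite opprD.
(* The inverse map as a fixed point: X = z - (x - z) (X, Y) and Y = w - (y - w) (X, Y). *)
have [||||X [Y [t [EX EY HX HY [t0 Nt]]]]] := @contr_solve K _ _ -%R -%R s (s *+ 3) Hx Hy s0 M1 M2 oB oB.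
- by move=> N f; apply: ordN.
- by move=> N f; apply: ordN.
- by move=> n t f _; apply: nrm_opp.
- by move=> n t f _; apply: nrm_opp.
have OX := ord1_of2 HX (ord_z K); have OY := ord1_of2 HY (ord_w K).
exists X, Y; split; first last.
- by exists t, (t *+ 2); split => // n; have [] := Nt n.
- by exists t, (t *+ 2); split => // n; have [] := Nt n.
have cx : comp x X Y = z.
  move: EX; rewrite compB // compz // => EX.
  have -> : comp x X Y = z - (z - (comp x X Y - X)) + X by ring.
  by rewrite -EX; ring.
have cy : comp y X Y = w.
  move: EY; rewrite compB // compw // => EY.
  have -> : comp y X Y = w - (w - (comp y X Y - Y)) + Y by ring.
  by rewrite -EY; ring.
have cp f : comp (comp f x y) X Y = f by rewrite comp_assoc // cx cy comp_id.
set P := z + p; set Q := - w + q.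
pose c1 := comp (d1 (x - z)) X Y; pose c2 := comp (d2 (x - z)) X Y.
pose e1 := comp (d1 (y - w)) X Y; pose e2 := comp (d2 (y - w)) X Y.
have HD := vf_derivation P Q.
have vX : vf P Q X = P - (c1 * vf P Q X + c2 * vf P Q Y).
  by rewrite {1}EX (derB HD) vfz vf_comp.
have vY : vf P Q Y = Q - (e1 * vf P Q X + e2 * vf P Q Y).
  by rewrite {1}EY (derB HD) vfw vf_comp.
have Lvf := vf_derivation z (- w).
have R1 : X * c1 - Y * c2 = P - X.
  have := congr1 (fun f => comp f X Y) Lx; rewrite (compD X Y x) cp cx => E.
  have : comp (vf z (- w) (x - z)) X Y = X * c1 - Y * c2.
    by rewrite /vf compD // !compM // compN // compz // compw // mulNr.
  by move=> <-; rewrite (derB Lvf) vfz compB // E compz // /P.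
have R2 : X * e1 - Y * e2 = Q + Y.
  have := congr1 (fun f => comp f X Y) Ly; rewrite (compD X Y (- y)) cp compN cy => E.
  have : comp (vf z (- w) (y - w)) X Y = X * e1 - Y * e2.
    by rewrite /vf compD // !compM // compN // compz // compw // mulNr.
  by move=> <-; rewrite (derB Lvf) vfw compB // E compN // compw // /Q opprK.
have O2 f g a : derivation a -> (forall N f, ord N.+1 f -> ord N (a f)) -> ord 2 f -> ord 1 (- comp (a f) X Y).
  by move=> _ H Hf; apply/ordN/ord_comp => //; apply: H.
have [||||||E1 E2] := @ord_solve2 (- c1) (- c2) (- e1) (- e2) (vf P Q X - X) (vf P Q Y + Y).
- by apply/ordN/ord_comp => //; apply: ord_d1.
- by apply/ordN/ord_comp => //; apply: ord_d2.
- by apply/ordN/ord_comp => //; apply: ord_d1.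
- by apply/ordN/ord_comp => //; apply: ord_d2.
- transitivity (P - X - (c1 * vf P Q X + c2 * vf P Q Y)); first by rewrite {1}vX; ring.
  by rewrite -R1; ring.
- transitivity (Q + Y - (e1 * vf P Q X + e2 * vf P Q Y)); first by rewrite {1}vY; ring.
  by rewrite -R2; ring.
split => //; first by apply/eqP; rewrite -subr_eq0; apply/eqP.
by apply/eqP; rewrite -addr_eq0; apply/eqP.
Qed.
End Linearizable.

(** * Explicit linearizations *)

Record cubic (K : Type) := Cubic { k20 : K; k11 : K; k02 : K; k30 : K; k21 : K; k12 : K; k03 : K }.

Section Cases.
Variable K : numFieldType.
Notation S := (fps (fps K)).
Implicit Types f g h u v : S.
Notation z := (Xz K).
Notation w := (Xw K).

Definition fld (a : cubic K) (u v : S) : S :=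
  C2 (k20 a) * u ^+ 2 + C2 (k11 a) * u * v + C2 (k02 a) * v ^+ 2 + C2 (k30 a) * u ^+ 3
  + C2 (k21 a) * u ^+ 2 * v + C2 (k12 a) * u * v ^+ 2 + C2 (k03 a) * v ^+ 3.

(** The polynomial of [b] is read in the variables (w, z), so that exchanging z and w exchanges the
    two arguments. *)
Definition plin (a b : cubic K) := exists Z W, linearizes (z + fld a z w) (- w - fld b w z) Z W.

Lemma ord_mul2 u v f : ord 1 u -> ord 1 v -> ord 2 (f * u * v).
Proof. by move=> Hu Hv; apply: (@ordM _ 1 1) => //; apply: ordMl. Qed.
Lemma ord_fld a u v : ord 1 u -> ord 1 v -> ord 2 (fld a u v).
Proof.
move=> Hu Hv; rewrite /fld !exprS expr0 !mulr1 !mulrA.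
by do 6?apply: ordD; apply: ord_mul2 => //; do ?apply: ordMl.
Qed.
Lemma ord_fldz a : ord 2 (fld a z w). Proof. by apply: ord_fld; [apply: ord_z | apply: ord_w]. Qed.
Lemma ord_fldw a : ord 2 (- fld a w z).
Proof. by apply/ordN/ord_fld; [apply: ord_w | apply: ord_z]. Qed.

Lemma comp_fld a f g u v : ord 1 u -> ord 1 v -> comp (fld a f g) u v = fld a (comp f u v) (comp g u v).
Proof. by move=> Hu Hv; rewrite /fld 6!compD !(compM Hu Hv) !(compC Hu Hv) ?(compX Hu Hv); ring. Qed.

Ltac csimp Hu Hv := rewrite !(comp_fld _ _ _ Hu Hv, compz Hu Hv, compw Hu Hv, compC Hu Hv, comp1 Hu Hv,
  compN, compX Hu Hv, compM Hu Hv, compD).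

Lemma lin_pull P Q a b Z W u v : ord 2 (u - z) -> ord 2 (v - w) -> linearizes a b Z W ->
  vf P Q u = comp a u v -> vf P Q v = comp b u v -> linearizes P Q (comp Z u v) (comp W u v).
Proof.
move=> Hu Hv [HZ HW EZ EW] Eu Ev.
have Ou := ord1_of2 Hu (ord_z K); have Ov := ord1_of2 Hv (ord_w K).
split.
- have -> : comp Z u v - z = comp (Z - z) u v + (u - z) by rewrite compB compz //; ring.
  by apply: ordD => //; apply: ord_comp.
- have -> : comp W u v - w = comp (W - w) u v + (v - w) by rewrite compB compw //; ring.
  by apply: ordD => //; apply: ord_comp.
- by rewrite (vf_pull _ Ou Ov Eu Ev) EZ.
- by rewrite (vf_pull _ Ou Ov Eu Ev) EW compN.
Qed.

(** Exchanging the variables also reverses time, whence the factor -1 and the exchanged roles of Z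
    and W. *)
Lemma plin_swap a b : plin a b -> plin b a.
Proof.
move=> [Z [W [HZ HW EZ EW]]]; have Oz := ord_z K; have Ow := ord_w K.
exists (comp W w z), (comp Z w z).
have pull f : vf (z + fld b z w) (- w - fld a w z) (comp f w z) =
    (-1) * comp (vf (z + fld a z w) (- w - fld b w z) f) w z.
  apply: vf_pullM => //; first by rewrite vfw; csimp Ow Oz; ring.
  by rewrite vfz; csimp Ow Oz; ring.
split.
- have -> : comp W w z - z = comp (W - w) w z by rewrite compB compw.
  exact: ord_comp.
- have -> : comp Z w z - w = comp (Z - z) w z by rewrite compB compz.
  exact: ord_comp.
- by rewrite pull EW compN; ring.
- by rewrite pull EZ; ring.
Qed.

(** Diagonal change of variables (al z, be w). The relations for the coefficients [k02] and [k03]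
    are multiplied out, as they would otherwise contain a quotient. *)
Lemma plin_scale (al be : K) a b a' b' : al != 0 -> be != 0 ->
  k20 a = k20 a' * al -> k11 a = k11 a' * be -> k02 a * al = k02 a' * be ^+ 2 ->
  k30 a = k30 a' * al ^+ 2 -> k21 a = k21 a' * al * be -> k12 a = k12 a' * be ^+ 2 -> k03 a * al = k03 a' * be ^+ 3 ->
  k20 b = k20 b' * be -> k11 b = k11 b' * al -> k02 b * be = k02 b' * al ^+ 2 ->
  k30 b = k30 b' * be ^+ 2 -> k21 b = k21 b' * be * al -> k12 b = k12 b' * al ^+ 2 -> k03 b * be = k03 b' * al ^+ 3 ->
  plin a' b' -> plin a b.
Proof.
move=> al0 be0 A1 A2 A3 A4 A5 A6 A7 B1 B2 B3 B4 B5 B6 B7 [Z [W [HZ HW EZ EW]]].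
pose u : S := C2 al * z; pose v : S := C2 be * w.
have Ou : ord 1 u by apply/ordMl/ord_z.
have Ov : ord 1 v by apply/ordMl/ord_w.
have sc (c c' : cubic K) x y (s t : S) : k20 c = k20 c' * x -> k11 c = k11 c' * y -> k02 c * x = k02 c' * y ^+ 2 ->
  k30 c = k30 c' * x ^+ 2 -> k21 c = k21 c' * x * y -> k12 c = k12 c' * y ^+ 2 -> k03 c * x = k03 c' * y ^+ 3 ->
  C2 x * fld c s t = fld c' (C2 x * s) (C2 y * t).
  move=> e1 e2 e3' e4 e5 e6 e7'.
  have e3 : C2 (k02 c) * C2 x = C2 (k02 c') * C2 y ^+ 2 by rewrite -rmorphM e3'; ring.
  have e7 : C2 (k03 c) * C2 x = C2 (k03 c') * C2 y ^+ 3 by rewrite -rmorphM e7'; ring.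
  rewrite /fld e1 e2 e4 e5 e6.
  transitivity (fld c' (C2 x * s) (C2 y * t) + (C2 (k02 c) * C2 x - C2 (k02 c') * C2 y ^+ 2) * t ^+ 2
     + (C2 (k03 c) * C2 x - C2 (k03 c') * C2 y ^+ 3) * t ^+ 3); first by rewrite /fld; ring.
  by rewrite e3 e7 !subrr !mul0r !addr0.
set P := z + fld a z w; set Q := - w - fld b w z.
have pull f : vf P Q (comp f u v) = comp (vf (z + fld a' z w) (- w - fld b' w z) f) u v.
  apply: vf_pull => //.
    rewrite (derCM (vf_derivation P Q)) vfz; csimp Ou Ov.
    by rewrite -(sc a a' al be z w A1 A2 A3 A4 A5 A6 A7) /P /u; ring.
  rewrite (derCM (vf_derivation P Q)) vfw; csimp Ou Ov.
  by rewrite -(sc b b' be al w z B1 B2 B3 B4 B5 B6 B7) /Q /v; ring.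
have inv (x : K) : x != 0 -> C2 x^-1 * C2 x = 1 by move=> x0; rewrite -rmorphM mulVf ?rmorph1.
exists (C2 al^-1 * comp Z u v), (C2 be^-1 * comp W u v); split.
- have -> : C2 al^-1 * comp Z u v - z = C2 al^-1 * comp (Z - z) u v + (C2 al^-1 * C2 al - 1) * z.
    by rewrite compB compz // /u; ring.
  by rewrite inv // subrr mul0r addr0; apply/ordMl/ord_comp.
- have -> : C2 be^-1 * comp W u v - w = C2 be^-1 * comp (W - w) u v + (C2 be^-1 * C2 be - 1) * w.
    by rewrite compB compw // /v; ring.
  by rewrite inv // subrr mul0r addr0; apply/ordMl/ord_comp.
- by rewrite (derCM (vf_derivation P Q)) pull EZ.
- by rewrite (derCM (vf_derivation P Q)) pull EW compN; ring.
Qed.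

(** The equation D F = 1 read as lam F + (D - 1) F = 0 with divisor 1 everywhere except 0 at the
    constant term, which is prescribed. *)
Lemma inv_ex (D : S) : ord 1 (D - 1) -> exists E, ord 1 (E - 1) /\ D * E = 1.
Proof.
move=> HD; pose lam (i j : nat) : K := if (i == 0%N) && (j == 0%N) then 0 else 1.
have [|||||F [H1 _ H2]] := @lin_solve K lam (fun f => (D - 1) * f) (fun _ _ => true) 0 0.
- by move=> f g; rewrite mulrBr.
- by move=> N f Hf; rewrite -add1n; apply: ordM.
- by rewrite /lam eqxx.
- by [].
- move=> f _ _ i j; rewrite /= /lam; case: ifP => [/andP[/eqP -> /eqP ->] _|_]; last by rewrite oner_eq0.
  by apply: (ordMr f HD).
exists F; rewrite addn0 /mono !expr0 rmorph1 !mulr1 in H1; split => //.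
apply: serP => i j; rewrite c1; have := H2 i j; rewrite /lam; case: ifP => [/andP[/eqP -> /eqP ->] _|_].
  have := H1 0%N 0%N isT; rewrite cB c1 /= => /eqP; rewrite subr_eq0 => /eqP E.
  have -> : D * F = (D - 1) * F + F by ring.
  by rewrite cD E (ordMr F HD) // add0r.
rewrite mul1r => E; have -> : D * F = F + (D - 1) * F by ring.
by rewrite cD E.
Qed.

Lemma C2nat n : C2 n%:R = n%:R :> S. Proof. exact: rmorph_nat. Qed.
Lemma C2natV n : (0 < n)%N -> C2 (n%:R^-1 : K) * n%:R = 1.
Proof. by move=> n0; rewrite -C2nat -rmorphM mulVf ?rmorph1 // pnatr_eq0 -lt0n. Qed.

Lemma root_ex n (D : S) : (0 < n)%N -> ord 1 (D - 1) ->
  exists E, ord 1 (E - 1) /\ forall p q k, vf p q D = n%:R * k * D -> vf p q E = k * E.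
Proof.
move=> n0 HD; have [E [H1 H2]] := pow_ex (n%:R^-1) HD; exists E; split => // p q k /H2 ->.
by rewrite !mulrA C2natV // mul1r.
Qed.
Lemma iroot_ex n (D : S) : (0 < n)%N -> ord 1 (D - 1) ->
  exists E, ord 1 (E - 1) /\ forall p q k, vf p q D = - n%:R * k * D -> vf p q E = k * E.
Proof.
move=> n0 HD; have [E [H1 H2]] := pow_ex (- n%:R^-1) HD; exists E; split => // p q k /H2 ->.
by rewrite rmorphN !mulrA mulrNN C2natV // mul1r.
Qed.

Lemma ord2_lin1 u f : ord 1 u -> ord 1 (f - 1) -> ord 2 (u * f - u).
Proof. by move=> Hu Hf; rewrite -[X in _ - X]mulr1 -mulrBr; apply: (@ordM _ 1 1). Qed.
Lemma ord2_lin u v f : ord 2 (u - v) -> ord 1 v -> ord 1 (f - 1) -> ord 2 (u * f - v).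
Proof.
move=> Huv Hv Hf; have Hu := ord1_of2 Huv Hv.
have -> : u * f - v = (u * f - u) + (u - v) by ring.
by apply: ordD => //; apply: ord2_lin1.
Qed.
Lemma ord1_mul f g : ord 1 (f - 1) -> ord 1 (g - 1) -> ord 1 (f * g - 1).
Proof.
move=> Hf Hg; have -> : f * g - 1 = f * (g - 1) + (f - 1) by ring.
by apply: ordD => //; apply: ordMl.
Qed.
Lemma ord2_add u v f : ord 2 (u - v) -> ord 2 f -> ord 2 (u + f - v).
Proof. by move=> H1 H2; rewrite addrAC; apply: ordD. Qed.

(** With k = a w + c z^2, the invariant curves z, w + b' z^2 and [D] have cofactors 1 + k, -1 + 2 k
    and 2 k. The parameter b02 is written 3 b' so that the parabola has no denominator. *)
Lemma case10 (a c b' : K) : 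
  plin (Cubic 0 a 0 c 0 0 0) (Cubic (- 2 * a) 0 (3 * b') 0 0 (- 2 * c) 0).
Proof.
rewrite /plin /fld /=; set P := z + _; set Q := - w - _.
have D1 := vf_derivation P Q; have Oz := ord_z K; have Ow := ord_w K.
pose D : S := 1 + C2 (c - 3 * a * b') * z ^+ 2 - C2 (2 * a) * w.
have HD : ord 1 (D - 1).
  have -> : D - 1 = C2 (c - 3 * a * b') * z * z - C2 (2 * a) * w by rewrite /D; ring.
  by apply: ordB; apply: ordMl.
have XD : vf P Q D = 2 * (C2 a * w + C2 c * z ^+ 2) * D.
  rewrite /D (derB D1) (derD D1) (der1 D1) !(derCM D1) (derX D1) vfz vfw /P /Q; ring.
have [E [HE XE]] := iroot_ex (n := 2) isT HD.
have [F [HF XF]] := iroot_ex (n := 1) isT HD.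
exists (z * E), ((w + C2 b' * z ^+ 2) * F); split.
- exact: ord2_lin1.
- apply: ord2_lin => //; apply: ord2_add; first by rewrite subrr; apply: ord0.
  by apply: ordMl; apply: (@ordM _ 1 1).
- rewrite (derM D1) vfz (XE _ _ (- (C2 a * w + C2 c * z ^+ 2))); last by rewrite XD; ring.
  rewrite /P; ring.
rewrite (derM D1) (derD D1) (derCM D1) (derX D1) vfz vfw (XF _ _ (- (2 * (C2 a * w + C2 c * z ^+ 2))));
  last by rewrite XD; ring.
rewrite /P /Q; ring.
Qed.

(** With k = a w, the invariant curves z, w + b' z^3 and [D] have cofactors 1 + k, -1 + 3 k and 3
    k. *)
Lemma case12 (a b' : K) : plin (Cubic 0 a 0 0 0 0 0) (Cubic (- 3 * a) 0 0 0 0 0 (4 * b')).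
Proof.
rewrite /plin /fld /=; set P := z + _; set Q := - w - _.
have D1 := vf_derivation P Q; have Oz := ord_z K; have Ow := ord_w K.
pose D : S := 1 - C2 (3 * a) * w - C2 (4 * a * b') * z ^+ 3.
have HD : ord 1 (D - 1).
  have -> : D - 1 = - (C2 (3 * a) * w) - C2 (4 * a * b') * z * z * z by rewrite /D; ring.
  by apply: ordB; [apply/ordN/ordMl | apply: ordMl].
have XD : vf P Q D = 3 * (C2 a * w) * D.
  rewrite /D (derB D1) (derB D1) (der1 D1) !(derCM D1) (derX D1) vfz vfw /P /Q; ring.
have [E [HE XE]] := iroot_ex (n := 3) isT HD.
have [F [HF XF]] := iroot_ex (n := 1) isT HD.
exists (z * E), ((w + C2 b' * z ^+ 3) * F); split.
- exact: ord2_lin1.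
- apply: ord2_lin => //; apply: ord2_add; first by rewrite subrr; apply: ord0.
  by apply: ordMl; apply: (@ordM _ 1 1) => //; apply: ordMl.
- rewrite (derM D1) vfz (XE _ _ (- (C2 a * w))); last by rewrite XD; ring.
  rewrite /P; ring.
rewrite (derM D1) (derD D1) (derCM D1) (derX D1) vfz vfw (XF _ _ (- (3 * (C2 a * w)))); last by rewrite XD; ring.
rewrite /P /Q; ring.
Qed.

(** With k = c w^2, the invariant curves z, F = w + b' z^2 and [D] have cofactors 1 + k, -1 + 2 k
    and 4 k. *)
Lemma case16 (c b' : K) : plin (Cubic 0 0 0 0 0 c 0) (Cubic 0 0 (3 * b') (- 2 * c) 0 0 0).
Proof.
rewrite /plin /fld /=; set P := z + _; set Q := - w - _.
have D1 := vf_derivation P Q; have Oz := ord_z K; have Ow := ord_w K.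
pose F : S := w + C2 b' * z ^+ 2.
have HF : ord 2 (F - w).
  by apply: ord2_add; [rewrite subrr; apply: ord0 | apply: ordMl; apply: (@ordM _ 1 1)].
have OF : ord 1 F by apply: ord1_of2 HF _.
(* A quartic invariant curve; it is 1 plus a quadratic form in F and z^2. *)
pose D : S := 1 - C2 (2 * c) * F ^+ 2 - C2 (8 * c * b') * F * z ^+ 2 + C2 (c * b' ^+ 2) * z ^+ 4.
have HD : ord 1 (D - 1).
  have -> : D - 1 = - (C2 (2 * c) * F * F) - C2 (8 * c * b') * F * z * z + C2 (c * b' ^+ 2) * z ^+ 3 * z by
    rewrite /D; ring.
  by apply: ordD; [apply: ordB; [apply/ordN/ordMl | apply: ordMl] | apply: ordMl].
have XF : vf P Q F = F * (- 1 + 2 * C2 c * w ^+ 2).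
  rewrite /F (derD D1) (derCM D1) (derX D1) vfz vfw /P /Q; ring.
have XD : vf P Q D = 4 * (C2 c * w ^+ 2) * D.
  rewrite /D (derD D1) !(derB D1) (der1 D1) -mulrA !(derCM D1) (derM D1) !(derX D1) XF vfz /F /P; ring.
have [E [HE XE]] := iroot_ex (n := 4) isT HD.
have [G [HG XG]] := iroot_ex (n := 2) isT HD.
exists (z * E), (F * G); split.
- exact: ord2_lin1.
- exact: ord2_lin.
- rewrite (derM D1) vfz (XE _ _ (- (C2 c * w ^+ 2))); last by rewrite XD; ring.
  rewrite /P; ring.
rewrite (derM D1) XF (XG _ _ (- (2 * (C2 c * w ^+ 2)))); last by rewrite XD; ring.
ring.
Qed.

(** The line D = 1 + 4 (z + w) has cofactor 4 (z - w), and the conics z + (z + w)^2 and w + (z +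
    w)^2 have cofactors 8 (z - w) + 1 and 8 (z - w) - 1; dividing the conics by D^2 linearizes. *)
Lemma case19 : plin (Cubic 7 (- 6) 3 0 0 0 0) (Cubic 7 (- 6) 3 0 0 0 0).
Proof.
rewrite /plin /fld /=; set P := z + _; set Q := - w - _.
have D1 := vf_derivation P Q; have Oz := ord_z K; have Ow := ord_w K.
pose D : S := 1 + 4 * (z + w).
have HD : ord 1 (D - 1) by rewrite /D addrC addKr; apply: ordMl; apply: ordD.
have XD : vf P Q D = - (1) * (- (4 * (z - w))) * D.
  rewrite /D (derD D1) (der1 D1) -(C2nat 4) (derCM D1) (derD D1) vfz vfw /P /Q; ring.
have [E [HE XE]] := iroot_ex (n := 1) isT HD; move/XE in XD.
have H2 : ord 2 ((z + w) ^+ 2 : S) by apply: (@ordM _ 1 1); apply: ordD.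
exists ((z + (z + w) ^+ 2) * (E * E)), ((w + (z + w) ^+ 2) * (E * E)); split.
- by apply: ord2_lin => //; [apply: ord2_add => //; rewrite subrr; apply: ord0 | apply: ord1_mul].
- by apply: ord2_lin => //; [apply: ord2_add => //; rewrite subrr; apply: ord0 | apply: ord1_mul].
- rewrite !(derM D1) (derD D1) (derX D1) (derD D1) vfz vfw XD /P /Q; ring.
rewrite !(derM D1) (derD D1) (derX D1) (derD D1) vfz vfw XD /P /Q; ring.
Qed.

Lemma case20 : plin (Cubic 5 (- 2) (- 3) 0 0 0 0) (Cubic 5 (- 2) (- 3) 0 0 0 0).
Proof.
rewrite /plin /fld /=; set P := z + _; set Q := - w - _.
have D1 := vf_derivation P Q; have Oz := ord_z K; have Ow := ord_w K.
pose D : S := 1 + 8 * (z + w).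
have HD : ord 1 (D - 1) by rewrite /D addrC addKr; apply: ordMl; apply: ordD.
have XD : vf P Q D = - 2 * (- (4 * (z - w))) * D.
  rewrite /D (derD D1) (der1 D1) -(C2nat 8) (derCM D1) (derD D1) vfz vfw /P /Q; ring.
have [E [HE XE]] := iroot_ex (n := 2) isT HD; move/XE in XD.
have H2 : ord 2 (- (z - w) ^+ 2 : S) by apply/ordN; apply: (@ordM _ 1 1); apply: ordB.
exists ((z - (z - w) ^+ 2) * E), ((w - (z - w) ^+ 2) * E); split.
- by apply: ord2_lin => //; apply: ord2_add => //; rewrite subrr; apply: ord0.
- by apply: ord2_lin => //; apply: ord2_add => //; rewrite subrr; apply: ord0.
- rewrite !(derM D1) (derB D1) (derX D1) (derB D1) vfz vfw XD /P /Q; ring.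
rewrite !(derM D1) (derB D1) (derX D1) (derB D1) vfz vfw XD /P /Q; ring.
Qed.

(** With p = z + w, the conic 1 + 3 p^2 has cofactor 6 p (z - w) and the cubics z + p^3 and w + p^3
    have cofactors 9 p (z - w) + 1 and 9 p (z - w) - 1, whence the exponent -3/2. *)
Lemma case21 : plin (Cubic 0 0 0 7 0 (- 3) 4) (Cubic 0 0 0 7 0 (- 3) 4).
Proof.
rewrite /plin /fld /=; set P := z + _; set Q := - w - _.
have D1 := vf_derivation P Q; have Oz := ord_z K; have Ow := ord_w K.
pose p : S := z + w; have Op : ord 1 p by apply: ordD.
have Xp : vf P Q p = (z - w) * (1 + 3 * p ^+ 2) by rewrite (derD D1) vfz vfw /P /Q /p; ring.
pose D : S := 1 + 3 * p ^+ 2.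
have HD : ord 1 (D - 1) by rewrite /D addrC addKr; apply/ordMl/ordMl.
have XD : vf P Q D = - 2 * (- (3 * p * (z - w))) * D.
  rewrite /D (derD D1) (der1 D1) -(C2nat 3) (derCM D1) (derX D1) Xp; ring.
have [E [HE XE]] := iroot_ex (n := 2) isT HD; move/XE in XD.
have H2 : ord 2 (p ^+ 3) by apply: (@ordM _ 1 1) => //; apply: ordMl.
exists ((z + p ^+ 3) * (E * E * E)), ((w + p ^+ 3) * (E * E * E)); split.
- by apply: ord2_lin => //; [apply: ord2_add => //; rewrite subrr; apply: ord0 | do !apply: ord1_mul].
- by apply: ord2_lin => //; [apply: ord2_add => //; rewrite subrr; apply: ord0 | do !apply: ord1_mul].
- rewrite !(derM D1) (derD D1) (derX D1) Xp vfz XD /P /p; ring.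
rewrite !(derM D1) (derD D1) (derX D1) Xp vfw XD /Q /p; ring.
Qed.
End Cases.

(** * Families with a graded, uncoupled or radial structure *)

Section Cases2.
Variable K : numFieldType.
Notation S := (fps (fps K)).
Implicit Types f g h u v : S.
Notation z := (Xz K).
Notation w := (Xw K).

Ltac csimp Hu Hv := rewrite !(comp_fld _ _ _ Hu Hv, compz Hu Hv, compw Hu Hv, compC Hu Hv, comp1 Hu Hv,
  compN, compX Hu Hv, compM Hu Hv, compD).

(* The weight i - j of a monomial z^i w^j is bounded below by an integer, given as c - d. *)
Definition wt (c d : nat) f := forall i j, (i + d < j + c)%N -> f i j = 0.
Lemma wtM c d c' d' f g : wt c d f -> wt c' d' g -> wt (c + c') (d + d') (f * g).
Proof.
move=> Hf Hg i j lt; rewrite cM big1 // => a _; rewrite big1 // => b _.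
move: (nat_of_ord a) (ltn_ord a) (nat_of_ord b) (ltn_ord b) => {}a la {}b lb.
case: (ltnP (a + d) (b + c)) => [/Hf ->|le]; first by rewrite mul0r.
rewrite Hg ?mulr0 //; lia.
Qed.
Lemma wt_d1 c d f : wt c d f -> wt c d.+1 (d1 f).
Proof. by move=> H i j lt; rewrite cd1 H ?mul0rn //; lia. Qed.
Lemma wt_d2 c d f : wt c d f -> wt c.+1 d (d2 f).
Proof. by move=> H i j lt; rewrite cd2 H ?mul0rn //; lia. Qed.
Lemma wt_le c d c' d' f : (c' + d <= c + d')%N -> wt c d f -> wt c' d' f.
Proof. by move=> le H i j lt; apply: H; lia. Qed.
Lemma wtD c d f g : wt c d f -> wt c d g -> wt c d (f + g).
Proof. by move=> Hf Hg i j lt; rewrite cD Hf ?Hg ?addr0. Qed.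
Lemma wtN c d f : wt c d f -> wt c d (- f).
Proof. by move=> Hf i j lt; rewrite cN Hf ?oppr0. Qed.
Lemma wt_mono c d (a : K) k l : (l + c <= k + d)%N -> wt c d (C2 a * (z ^+ k * w ^+ l)).
Proof.
move=> le i j lt; have := cmono a k l i j; rewrite /mono => ->.
by case: ifP => // /andP[/eqP ei /eqP ej]; move: lt; rewrite ei ej; lia.
Qed.

(** The coefficient of z in W is multiplied by 1 by the linear field and by -1 by the equation, so
    its double vanishes. This spares the computation of that coefficient in the constructions
    below. *)
Lemma linW p q W : ord 2 p -> ord 2 q -> ord 1 W -> W 0%N 1%N = 1 ->
  vf (z + p) (- w + q) W = - W -> ord 2 (W - w).
Proof.
move=> Hp Hq HW W01 E [|[|i]] [|[|j]] // lt; try by [exfalso; move: lt; lia].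
- by rewrite cB HW // cXw subr0.
- by rewrite cB W01 cXw subrr.
rewrite cB cXw subr0; have := congr1 (fun f : S => f 1%N 0%N) E.
rewrite vfDl (cD (vf z (- w) W)) cN cvfL (ord_vf2 Hp Hq HW) // addr0 subr0 mul1r => E1.
have /eqP : W 1%N 0%N *+ 2 = 0 by rewrite mulr2n {1}E1 addNr.
by rewrite mulrn_eq0 => /eqP.
Qed.

Lemma C2m1 f : C2 (-1) * f = - f.
Proof. by rewrite rmorphN1 mulN1r. Qed.

(** The perturbation strictly raises the weight i - j. The series for Z lives in weights at least 1
    and that for W in weights at least -1, while the resonant equations concern exactly the weights
    1 and -1, which the perturbation therefore does not reach. *)
Lemma lin_pos p q : ord 2 p -> ord 2 q -> wt 2 0 p -> wt 0 0 q ->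
  exists Z W, linearizes (z + p) (- w + q) Z W.
Proof.
move=> Hp Hq Wp Wq.
have lam i j : 1 * i%:R + -1 * j%:R = i%:R - j%:R :> K by ring.
have [||||||Z [Z1 _ Z2]] := @lin_vf K 1 (-1) 1 p q 0 (fun i j => (j < i)%N) 1 0 => //.
- exact: ord0.
- by rewrite lam subr0.
- move=> f Hf _ i j; rewrite mul0r subr0 lam => H.
  have Wf : wt 1 0 f by move=> k l lt; apply: Hf; rewrite -leqNgt; move: lt; lia.
  have W1 : wt 2 0 (vf p q f).
    apply: wtD; first by apply: wt_le (wtM Wp (wt_d1 Wf)).
    by apply: wt_le (wtM Wq (wt_d2 Wf)).
  apply: W1; rewrite addn0; case/orP: H => [|]; first by lia.
  by rewrite subr_eq nat1r eqr_nat => /eqP ->; lia.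
have [||||||W [W1 _ W2]] := @lin_vf K 1 (-1) (-1) p q 0 (fun i j => (j <= i.+1)%N) 0 1 => //.
- exact: ord0.
- by rewrite lam sub0r.
- move=> f Hf _ i j; rewrite mul0r subr0 lam => H.
  have Wf : wt 0 1 f by move=> k l lt; apply: Hf; rewrite -ltnNge; move: lt; lia.
  have H1 : wt 0 0 (vf p q f).
    apply: wtD; first by apply: wt_le (wtM Wp (wt_d1 Wf)).
    by apply: wt_le (wtM Wq (wt_d2 Wf)).
  apply: H1; rewrite !addn0; case/orP: H => [|]; first by lia.
  by rewrite -eqr_opp opprB opprK subr_eq nat1r eqr_nat => /eqP ->; lia.
exists Z, W; move: Z1 Z2 W1 W2; rewrite /mono !rmorph1 !mul1r !expr1 !expr0 ?mulr1 ?mul1r !addr0 mul1r C2m1.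
by move=> Z1 Z2 W1 W2; split => //; rewrite W2 C2m1.
Qed.

Lemma case02 a20 a30 b11 b02 b12 b03 :
  @plin K (Cubic a20 0 0 a30 0 0 0) (Cubic 0 b11 b02 0 0 b12 b03).
Proof.
rewrite /plin; apply: lin_pos; [exact: ord_fldz | exact: ord_fldw | |].
  have -> : fld (Cubic a20 0 0 a30 0 0 0) z w = C2 a20 * (z ^+ 2 * w ^+ 0) + C2 a30 * (z ^+ 3 * w ^+ 0) by
    rewrite /fld /=; ring.
  by apply: wtD; apply: wt_mono.
have -> : fld (Cubic 0 b11 b02 0 0 b12 b03) w z = C2 b11 * (z ^+ 1 * w ^+ 1) + C2 b02 * (z ^+ 2 * w ^+ 0)
   + C2 b12 * (z ^+ 2 * w ^+ 1) + C2 b03 * (z ^+ 3 * w ^+ 0) by rewrite /fld /=; ring.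
by apply: wtN; do !apply: wtD; apply: wt_mono.
Qed.

(** On the axis z = 0 the second equation is w' = -w - b20 w^2, linearized by u = w / (1 + b20 w).
    In the variables (z, u) the remaining terms have the weights required by [lin_pos]. *)
Lemma case03 a20 a30 b20 b02 b12 b03 :
  @plin K (Cubic a20 0 0 a30 0 0 0) (Cubic b20 0 b02 0 0 b12 b03).
Proof.
rewrite /plin /fld /=; set P := z + _; set Q := - w - _.
have D1 := vf_derivation P Q; have Oz := ord_z K; have Ow := ord_w K.
pose D : S := 1 + C2 b20 * w.
have HD : ord 1 (D - 1) by rewrite /D addrC addKr; apply: ordMl.
have [E [HE DE]] := inv_ex HD.
pose u := w * E; have Hu : ord 2 (u - w) by apply: ord2_lin1.
have Ou : ord 1 u by apply: ordMr.
have XE : D * vf P Q E = - (vf P Q D * E).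
  have := der1 D1; rewrite -DE (derM D1) => /eqP; rewrite addrC addr_eq0 => /eqP ->; ring.
have XD : vf P Q D = C2 b20 * Q by rewrite (derD D1) (der1 D1) (derCM D1) vfw; ring.
have Eu : E = 1 - C2 b20 * u by rewrite -{1}DE /u /D; ring.
pose p : S := C2 a20 * z ^+ 2 + C2 a30 * z ^+ 3.
pose q : S := - ((C2 b02 * z ^+ 2 + C2 b03 * z ^+ 3) * (1 - C2 b20 * w) ^+ 2 + C2 b12 * z ^+ 2 * w * (1 -
  C2 b20 * w)).
have [||||Z [W L]] := @lin_pos p q.
- by apply: ordD; apply: ordMl; [|apply: (ordMl z)]; apply: (@ordM _ 1 1).
- have -> : q = z * z * - ((C2 b02 + C2 b03 * z) * (1 - C2 b20 * w) ^+ 2 + C2 b12 * w * (1 - C2 b20 * w))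
  by rewrite /q; ring.
  by apply: ordMr; apply: (@ordM _ 1 1).
- have -> : p = C2 a20 * (z ^+ 2 * w ^+ 0) + C2 a30 * (z ^+ 3 * w ^+ 0) by rewrite /p; ring.
  by apply: wtD; apply: wt_mono.
- have -> : q = - (C2 b02 * (z ^+ 2 * w ^+ 0) + C2 (-2 * b02 * b20) * (z ^+ 2 * w ^+ 1) + C2 (b02 * b20 ^+
  2) * (z ^+ 2 * w ^+ 2)
     + C2 b03 * (z ^+ 3 * w ^+ 0) + C2 (-2 * b03 * b20) * (z ^+ 3 * w ^+ 1) + C2 (b03 * b20 ^+ 2) * (z ^+ 3 * w ^+ 2)
     + C2 b12 * (z ^+ 2 * w ^+ 1) + C2 (- b12 * b20) * (z ^+ 2 * w ^+ 2)) by rewrite /q; ring.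
  by apply: wtN; do !apply: wtD; apply: wt_mono.
exists (comp Z z u), (comp W z u); apply: lin_pull L _ _ => //.
- by rewrite subrr; apply: ord0.
- by rewrite vfz compD (compz Oz Ou) /p; csimp Oz Ou; rewrite /P; ring.
apply: (unit_cancel HD).
have -> : D * vf P Q u = D * E * Q + w * (D * vf P Q E) by rewrite (derM D1) vfw; ring.
rewrite XE XD DE.
have -> : comp (- w + q) z u = - u - ((C2 b02 * z ^+ 2 + C2 b03 * z ^+ 3) * E ^+ 2 + C2 b12 * z ^+ 2 * u * E).
  by rewrite Eu /q; csimp Oz Ou; ring.
transitivity ((1 - C2 b20 * u) * Q); first by rewrite /u; ring.
rewrite -Eu; transitivity (- (D * E) * w - (D * E) * ((C2 b02 * z ^+ 2 + C2 b03 * z ^+ 3) * E + C2 b12 * z ^+ 2 * u)).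
  by rewrite DE /Q; transitivity (- (D * E) * w - (C2 b02 * z ^+ 2 + C2 b03 * z ^+ 3) * E - C2 b12 * z ^+ 2
    * u); [rewrite /D /u; ring | rewrite DE; ring].
by rewrite /u; ring.
Qed.

Lemma vf_onlyw p q g : d1 g = 0 -> vf p q g = d2 g * q.
Proof. by move=> H; rewrite /vf H mulr0 add0r mulrC. Qed.

(** Here c' denotes the quotient (c - 1) / w, not a derivative; w g is the linearizing coordinate of
    the uncoupled equation with right-hand side -w c. *)
Lemma w_lin P (c c' : S) : c = 1 + w * c' -> (forall i j, c' i.+1 j = 0) ->
  exists g, [/\ ord 1 (g - 1), d1 g = 0, c * d2 g = - c' * g & vf P (- w * c) (w * g) = - (w * g)].
Proof.
move=> Ec Hc'.
have [||| g [g0 g1 g2]] := @ode K c (- c').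
- by rewrite Ec addrC addKr; apply/ordMr/ord_w.
- by move=> i j; rewrite Ec cD c1 add0r cXwM; case: j.
- by move=> i j; rewrite cN Hc' oppr0.
exists g; split => //.
rewrite (derM (vf_derivation _ _)) vfw vf_onlyw //.
transitivity (- w * (c * g) - w * w * (c * d2 g)); first by ring.
by rewrite g2 {1}Ec; ring.
Qed.

Lemma case05 a20 a30 b20 b30 : @plin K (Cubic a20 0 0 a30 0 0 0) (Cubic b20 0 0 b30 0 0 0).
Proof.
rewrite /plin /fld /=; set P := z + _; set Q := - w - _.
have D1 := vf_derivation P Q; have Oz := ord_z K; have Ow := ord_w K.
have sc x y i j : (C2 x + C2 y * w : S) i.+1 j = 0 by rewrite cD cC cCM cXw mulr0 addr0.
have [//||g [g0 g1 _ g3]] := @w_lin P (1 + w * (C2 b20 + C2 b30 * w)) (C2 b20 + C2 b30 * w); first exact: sc.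
have [//||h [h0 h1 h2 _]] := @w_lin P (1 + w * (C2 a20 + C2 a30 * w)) (C2 a20 + C2 a30 * w); first exact: sc.
have O0 : ord 1 (0 : S) by exact: ord0.
(* The series [h] involves the second variable only; substituting (0, z) transports it to the
   first. *)
exists (z * comp h 0 z), (w * g); split.
- by apply: ord2_lin1 => //; apply: ord_comp1.
- by apply: ord2_lin1.
- rewrite (derM D1) vfz vf_comp_w // vfz.
  have := congr1 (fun f => comp f 0 z) h2; csimp O0 Oz => E.
  transitivity (P * comp h 0 z + z * z * ((1 + z * (C2 a20 + C2 a30 * z)) * comp (d2 h) 0 z));
    first by rewrite /P; ring.
  by rewrite E /P; ring.
by rewrite -g3; congr (vf _ _ _); rewrite /Q; ring.
Qed.

(** The second equation is uncoupled, w' = -w p, and the first is a Bernoulli equation in z: D = 1 +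
    c z^2 / p has cofactor 2 c z^2, and a series x in w with p x' = a x compensates the term a w. *)
Lemma case08 a c b30 : @plin K (Cubic 0 a 0 c 0 0 0) (Cubic (2 * a) 0 0 b30 0 0 0).
Proof.
rewrite /plin /fld /=; set P := z + _; set Q := - w - _.
have D1 := vf_derivation P Q; have Oz := ord_z K; have Ow := ord_w K.
have sc x y i j : (C2 x + C2 y * w : S) i.+1 j = 0 by rewrite cD cC cCM cXw mulr0 addr0.
pose p : S := 1 + w * (C2 (2 * a) + C2 b30 * w).
have Hp : ord 1 (p - 1) by rewrite /p addrC addKr; apply: ordMr.
have [//||g [g0 g1 _ g3]] := @w_lin P p (C2 (2 * a) + C2 b30 * w); first exact: sc.
have [|||x [x0 x1 x2]] := @ode K p (C2 a) => //.
- by move=> i j; rewrite /p cD c1 add0r cXwM; case: j.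
- by move=> i j; rewrite cC.
have [E [HE pE]] := inv_ex Hp.
have XE : p * vf P Q E = - (vf P Q p * E).
  have := der1 D1; rewrite -pE (derM D1) => /eqP; rewrite addrC addr_eq0 => /eqP ->; ring.
have Xp : vf P Q p = - (w * (C2 (2 * a) + 2 * C2 b30 * w)) * p.
  by rewrite /p (derD D1) (der1 D1) !(derM D1) (derD D1) (derC D1) (derCM D1) vfw /Q; ring.
pose D : S := 1 + C2 c * z ^+ 2 * E.
have HD : ord 1 (D - 1) by rewrite /D addrC addKr; apply/ordMr/ordMl; apply: ordW (@ordM _ 1 1 _ _ Oz Oz).
have XE2 : vf P Q E = w * (C2 (2 * a) + 2 * C2 b30 * w) * E.
  apply: (unit_cancel Hp); rewrite XE Xp.
  by transitivity (w * (C2 (2 * a) + 2 * C2 b30 * w) * (p * E)); ring.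
have XD : vf P Q D = - 2 * (- (C2 c * z ^+ 2)) * D.
  rewrite /D (derD D1) (der1 D1) (derM D1) (derCM D1) (derX D1) vfz XE2.
  transitivity (2 * C2 c * z ^+ 2 * (p * E) + 2 * C2 c * z ^+ 2 * (C2 c * z ^+ 2 * E)); first by rewrite /p /P; ring.
  by rewrite pE; ring.
have [F [HF XF]] := iroot_ex (n := 2) isT HD; move/XF in XD.
have EQ : Q = - w * p by rewrite /Q /p; ring.
exists (z * (x * F)), (w * g); split.
- by apply: ord2_lin1 => //; apply: ord1_mul.
- by apply: ord2_lin1.
- rewrite !(derM D1) vfz XD vf_onlyw //.
  have -> : d2 x * Q = - w * (C2 a * x) by rewrite -x2 EQ; ring.
  by rewrite /P; ring.
by rewrite EQ.
Qed.

(** The field is (z (1 + f), -w (1 - f)) with f = (a z + c w) (1 + l q) and q = a z - c w, so z and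
    w need one common factor of cofactor -f. Since q has derivative (a z + c w) (1 + q + l q^2),
    that factor is a series in q alone, given by a scalar equation. *)
Lemma case18a a c l : @plin K (Cubic a c 0 (l * a ^+ 2) 0 (- (l * c ^+ 2)) 0)
   (Cubic (- c) (- a) 0 (l * c ^+ 2) 0 (- (l * a ^+ 2)) 0).
Proof.
rewrite /plin /fld /=; set P := z + _; set Q := - w - _.
have D1 := vf_derivation P Q; have Oz := ord_z K; have Ow := ord_w K.
have [|||g [g0 g1 g2]] := @ode K (1 + w * (1 + C2 l * w)) (- (1 + C2 l * w)).
- by rewrite addrC addKr; apply: ordMr.
- by move=> i j; rewrite cD c1 add0r cXwM; case: j => // j; rewrite cD c1 cCM cXw mulr0 addr0.
- by move=> i j; rewrite cN cD c1 cCM cXw mulr0 addr0 oppr0.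
pose q : S := C2 a * z - C2 c * w; have Oq : ord 1 q by apply: ordB; apply: ordMl.
have O0 : ord 1 (0 : S) by exact: ord0.
pose f := (C2 a * z + C2 c * w) * (1 + C2 l * q).
have Xq : vf P Q q = (C2 a * z + C2 c * w) * (1 + q * (1 + C2 l * q)).
  by rewrite (derB D1) !(derCM D1) vfz vfw /P /Q /q; ring.
have XG : vf P Q (comp g 0 q) = - f * comp g 0 q.
  rewrite vf_comp_w // Xq.
  have := congr1 (fun f => comp f 0 q) g2; csimp O0 Oq => E.
  transitivity ((C2 a * z + C2 c * w) * ((1 + q * (1 + C2 l * q)) * comp (d2 g) 0 q)); first by ring.
  by rewrite E /f; ring.
exists (z * comp g 0 q), (w * comp g 0 q); split.
- by apply: ord2_lin1 => //; apply: ord_comp1.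
- by apply: ord2_lin1 => //; apply: ord_comp1.
- by rewrite (derM D1) vfz XG /P /f /q; ring.
by rewrite (derM D1) vfw XG /Q /f /q; ring.
Qed.

(** The radial scheme without quadratic terms, the common factor being now a series in q = a z^2 - b
    w^2. *)
Lemma case18b a b : @plin K (Cubic 0 0 0 (2 * a) 0 (2 * b) 0) (Cubic 0 0 0 (- (2 * b)) 0 (- (2 * a)) 0).
Proof.
rewrite /plin /fld /=; set P := z + _; set Q := - w - _.
have D1 := vf_derivation P Q; have Oz := ord_z K; have Ow := ord_w K.
have [|||g [g0 g1 g2]] := @ode K (1 + w * 2) (- 1).
- by rewrite addrC addKr; apply: ordMr.
- by move=> i j; rewrite cD c1 add0r cXwM; case: j => // j; rewrite -C2nat cC.
- by move=> i j; rewrite cN c1 oppr0.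
pose q : S := C2 a * z ^+ 2 - C2 b * w ^+ 2.
have Oq : ord 1 q by apply: ordB; apply: ordMl; apply: ordMl.
have O0 : ord 1 (0 : S) by exact: ord0.
pose f := 2 * (C2 a * z ^+ 2 + C2 b * w ^+ 2).
have Xq : vf P Q q = f * (1 + q * 2).
  by rewrite (derB D1) !(derCM D1) !(derX D1) vfz vfw /P /Q /q /f; ring.
have XG : vf P Q (comp g 0 q) = - f * comp g 0 q.
  rewrite vf_comp_w // Xq.
  have := congr1 (fun f => comp f 0 q) g2.
  rewrite (compM O0 Oq) compD (compM O0 Oq) (comp1 O0 Oq) (compw O0 Oq) (comp_nat O0 Oq) (compM O0 Oq)
    compN (comp1 O0 Oq) => E.
  transitivity (f * ((1 + q * 2) * comp (d2 g) 0 q)); first by ring.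
  by rewrite E; ring.
exists (z * comp g 0 q), (w * comp g 0 q); split.
- by apply: ord2_lin1 => //; apply: ord_comp1.
- by apply: ord2_lin1 => //; apply: ord_comp1.
- by rewrite (derM D1) vfz XG /P /f /q; ring.
by rewrite (derM D1) vfw XG /Q /f /q; ring.
Qed.
End Cases2.

(** * Families reduced to simpler fields by a blow-up and a change of time *)

Section Cases3.
Variable K : numFieldType.
Notation S := (fps (fps K)).
Implicit Types f g h u v : S.
Notation z := (Xz K).
Notation w := (Xw K).

Ltac csimp Hu Hv := rewrite !(comp_fld _ _ _ Hu Hv, compz Hu Hv, compw Hu Hv, compC Hu Hv, comp1 Hu Hv,
  compN, compX Hu Hv, compM Hu Hv, compD).

Definition shz f : S := Fps (fun i => f i.+1).
Definition atz0 f : S := cst (Fps (fun j => f 0%N j.+1)).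
Lemma cshz f i j : shz f i j = f i.+1 j. Proof. by []. Qed.
Lemma catz0 f i j : atz0 f i j = if i is 0%N then f 0%N j.+1 else 0.
Proof. by rewrite /atz0 cstE; case: i => [|i] //; rewrite fps0. Qed.
Lemma shz_split f : f 0%N 0%N = 0 -> f = z * shz f + w * atz0 f.
Proof.
move=> f0; apply: serP => i j; rewrite cD cXzM cXwM.
by case: i j => [|i] [|j]; rewrite ?cshz ?catz0 ?addr0 ?add0r.
Qed.

(* A series without constant term becomes divisible by u after the substitution (z, w) := (u, u w). *)
Lemma comp_div (R u : S) : ord 1 u -> ord 2 (R - w) ->
  exists T, [/\ comp R u (u * w) = u * T, ord 1 T & T 0%N 1%N = 1 + R 2%N 0%N * u 0%N 1%N].
Proof.
move=> Hu HR; have Ow := ord_w K; have Ouw : ord 1 (u * w) by apply: ordMr.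
have Rc i j : (i + j < 2)%N -> R i j = w i j.
  by move=> lt; apply/eqP; rewrite -subr_eq0 -cB; apply/eqP/HR.
have R0 : R 0%N 0%N = 0 by rewrite Rc // cXw.
exists (comp (shz R) u (u * w) + w * comp (atz0 R) u (u * w)); split.
- rewrite {1}(shz_split R0) compD !compM // compz // compw //; ring.
- apply: ordD; last exact: ordMr.
  by apply: ord_comp => // i j lt; rewrite cshz Rc ?cXw //; lia.
have sh1 : ord 2 (shz R - C2 (R 2%N 0%N) * z - C2 (R 1%N 1%N) * w).
  move=> [|[|i]] [|[|j]] lt //; rewrite !cB !cCM cXz cXw cshz //=.
  - by rewrite Rc // cXw !mulr0 !subr0.
  - by rewrite mulr0 mulr1 subr0 subrr.
  - by rewrite mulr1 mulr0 subr0 subrr.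
rewrite cD cXwM.
have -> : comp (atz0 R) u (u * w) 0%N 0%N = 1.
  rewrite ccomp /psum big_ord_recl big_ord0 addr0 big_ord_recl big_ord0 addr0 !expr0 mulr1 catz0 /= Rc //.
  by rewrite mulr1 cC cXw.
rewrite addrC; congr (_ + _).
have -> : comp (shz R) u (u * w) = comp (shz R - C2 (R 2%N 0%N) * z - C2 (R 1%N 1%N) * w) u (u * w)
   + (C2 (R 2%N 0%N) * u + C2 (R 1%N 1%N) * (u * w)).
  rewrite !compB !compM // !compC // compz // compw //; ring.
rewrite cD (ord_comp Hu Ouw sh1) // add0r cD !cCM.
have -> : (u * w) 0%N 1%N = 0 by apply: (@ordM _ 1 1).
by rewrite mulr0 addr0.
Qed.

Lemma vf_inv (P Q D E : S) : D * E = 1 -> D * vf P Q E = - (vf P Q D * E).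
Proof.
move=> DE; have D1 := vf_derivation P Q; have := der1 D1; rewrite -DE (derM D1) => /eqP.
by rewrite addrC addr_eq0 => /eqP ->; ring.
Qed.

(** With A = z^3 / p^2 and r = A w, the field is p times a polynomial field with linear part (3 A, 2
    r). As 3 i + 2 j equals 0 only at (0, 0) and 2 only at (0, 1), it has eigenfunctions F = 1 + ...
    and R = r + ... for any cofactors of the right constant term. Pulled back, R is divisible by A,
    with quotient T tangent to w up to a multiple of z; scalar equations in w remove the remaining
    factors. *)
Lemma case14 a c b : @plin K (Cubic 0 a 0 0 0 c 0) (Cubic (3 * a) 0 0 (- 3 * c) 0 0 b).
Proof.
rewrite /plin; have Hp1 := ord_fldz (Cubic 0 a 0 0 0 c 0); have Hq1 := ord_fldw (Cubic (3 * a) 0 0 (- 3 * c) 0 0 b).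
pose P := z + fld (Cubic 0 a 0 0 0 c 0) z w; pose Q := - w - fld (Cubic (3 * a) 0 0 (- 3 * c) 0 0 b) w z.
suff [Z [W [HZ [HW1 HW2] EZ EW]]] : exists Z W, [/\ ord 2 (Z - z), ord 1 W /\ W 0%N 1%N = 1, vf P Q Z = Z &
  vf P Q W = - W].
  by exists Z, W; split => //; apply: linW EW.
have D1 := vf_derivation P Q; have Oz := ord_z K; have Ow := ord_w K.
pose sg : S := C2 (3 * a); pose pi : S := C2 (- 3 * c); pose B : S := C2 b.
have EP : P = z * (1 + C2 a * w + C2 c * w ^+ 2) by rewrite /P /fld /=; ring.
pose p : S := 1 + sg * w + pi * w ^+ 2.
have EQ : Q = - w * p - B * z ^+ 3 by rewrite /Q /fld /p /sg /pi /B /=; ring.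
have sc x y i j : (C2 x + C2 y * w : S) i.+1 j = 0 by rewrite cD cC cCM cXw mulr0 addr0.
have Hp : ord 1 (p - 1).
  have -> : p - 1 = sg * w + pi * w * w by rewrite /p; ring.
  by apply: ordD; apply: ordMl.
have pS i j : p i.+1 j = 0.
  have -> : p = 1 + w * (C2 (3 * a) + C2 (- 3 * c) * w) by rewrite /p /sg /pi; ring.
  by rewrite cD c1 add0r cXwM; case: j.
have Xp : vf P Q p = (sg + 2 * pi * w) * Q.
  by rewrite /p (derD D1) (derD D1) (der1 D1) !(derCM D1) (derX D1) vfw; ring.
have [pI [HpI ppI]] := inv_ex Hp.
pose A := z ^+ 3 * pI * pI.
have OA3 : ord 3 A by do 2!apply: ordMr; apply: (@ordM _ 1 2) => //; apply: (@ordM _ 1 1).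
have OA : ord 1 A by apply: ordW OA3.
have Az : z ^+ 3 = p * p * A.
  transitivity ((p * pI) * (p * pI) * z ^+ 3); first by rewrite ppI; ring.
  by rewrite /A; ring.
pose r := A * w; have Or : ord 1 r by apply: ordMr.
(* The components of the new field, obtained from the derivatives of A and r by writing z^3 = p^2 A
   and w A = r. *)
pose VA : S := 3 * z + 2 * B * z * (sg * z + 2 * pi * w).
pose Vr : S := 2 * w + 2 * B * w * (sg * z + 2 * pi * w) - B * (z ^+ 2 + sg * z * w + pi * w ^+ 2).
have cVA : comp VA A r = 3 * A + 2 * B * A * (sg * A + 2 * pi * r).
  rewrite /VA /B /sg /pi -!C2nat; csimp OA Or; ring.
have cVr : comp Vr A r = 2 * r + 2 * B * r * (sg * A + 2 * pi * r) - B * (A ^+ 2 + sg * A * r + pi * r ^+ 2).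
  rewrite /Vr /B /sg /pi -!C2nat; csimp OA Or; ring.
have XA : vf P Q A = p * comp VA A r.
  apply: (unit_cancel (ord1_mul Hp Hp)).
  have := congr1 (vf P Q) Az; rewrite (derX D1) vfz !(derM D1) Xp => E.
  transitivity (z ^+ 2 * P *+ 3 - 2 * p * ((sg + 2 * pi * w) * Q) * A); first by rewrite E; ring.
  rewrite EP EQ; transitivity (3 * z ^+ 3 * (1 + C2 a * w + C2 c * w ^+ 2) - 2 * p * ((sg + 2 * pi * w) *
    (- w * p - B * z ^+ 3)) * A); first by ring.
  by rewrite Az cVA /r /p /sg /pi; ring.
have Xr : vf P Q r = p * comp Vr A r.
  rewrite (derM D1) XA vfw cVA cVr EQ Az /r /p; ring.
have OVA : ord 2 (VA - C2 3 * z).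
  have -> : VA - C2 3 * z = 2 * B * (sg * z * z + 2 * pi * w * z) by rewrite /VA C2nat; ring.
  by apply: ordMl; apply: ordD; apply: ord_mul2.
have OVr : ord 2 (Vr - C2 2 * w).
  have -> : Vr - C2 2 * w = 2 * B * (sg * z * w + 2 * pi * w * w) - (B * z * z + B * sg * z * w + B * pi *
    w * w) by rewrite /Vr C2nat; ring.
  by apply: ordB; [apply: ordMl|]; do !apply: ordD; apply: ord_mul2.
have dec1 : C2 3 * z + (VA - C2 3 * z) = VA by ring.
have dec2 : C2 2 * w + (Vr - C2 2 * w) = Vr by ring.
(* The cofactors of F, and of R below, are those that cancel all terms containing [B] in the
   derivatives of the final Z and W. *)
have [|||| F [F1 _ F3]] := @lin_vf K 3 2 0 _ _ (B * (sg * z - pi * w)) (fun _ _ => true) 0 0 OVA OVr => //.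
- by apply: ordMl; apply: ordB; apply: ordMl.
- by rewrite !mulr0 addr0.
- move=> f _ _ i j; rewrite /= -!natrM -natrD pnatr_eq0 addn_eq0 !muln_eq0 /= => /andP[/eqP -> /eqP ->].
  apply: (ordB (N := 1)) => //; first by apply: ord_vf2 => //; apply: ord_0.
  by apply/ordMr/ordMl/ordB; apply: ordMl.
have [|||| R [R1 _ R3]] := @lin_vf K 3 2 2 _ _ (2 * B * (sg * z + pi * w)) (fun _ _ => true) 0 1 OVA OVr => //.
- by apply: ordMl; apply: ordD; apply: ordMl.
- by rewrite mulr0 add0r mulr1.
- move=> f _ Of i j; rewrite /= -!natrM -natrD eqr_nat => /eqP ij.
  apply: (ordB (N := 2)); last by lia.
    by apply: ord_vf2.
  by apply: (@ordM _ 1 1) => //; apply: ordMl; apply: ordD; apply: ordMl.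
rewrite dec1 dec2 in F3 R3.
rewrite addn0 /mono !expr0 rmorph1 !mulr1 in F1; rewrite /mono !rmorph1 expr0 expr1 !mul1r in R1.
pose Fc := comp F A r; have HFc : ord 1 (Fc - 1) by apply: ord_comp1.
have XFc : vf P Q Fc = p * (B * (sg * A - pi * r)) * Fc.
  rewrite (vf_pullM _ OA Or XA Xr) F3 /B /sg /pi; csimp OA Or; rewrite /Fc; ring.
have [T [RT OT T01]] := comp_div OA R1; rewrite -/r in RT.
rewrite (OA3 0%N 1%N) // mulr0 addr0 in T01.
have XRc : vf P Q (A * T) = p * (2 + 2 * B * (sg * A + pi * r)) * (A * T).
  rewrite -RT (vf_pullM _ OA Or XA Xr) R3 /B /sg /pi -!C2nat; csimp OA Or; ring.
have [|t1|t1|t [t0 t1 t2]] := @ode K p (3 * sg + 3 * pi * w) => //.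
  have -> : 3 * sg + 3 * pi * w = C2 (3 * (3 * a)) + C2 (3 * (- 3 * c)) * w by rewrite /sg /pi; ring.
  exact: sc.
have [|t1'|t1'|s [s0 s1 s2]] := @ode K p (- (sg + pi * w)) => //.
  have -> : - (sg + pi * w) = C2 (- (3 * a)) + C2 (- (- 3 * c)) * w by rewrite /sg /pi; ring.
  exact: sc.
have Xt : p * vf P Q t = (3 * sg + 3 * pi * w) * t * Q by rewrite vf_onlyw // mulrA t2.
have Xs : p * vf P Q s = - (sg + pi * w) * s * Q by rewrite vf_onlyw // mulrA s2.
have zc3 (x y : S) : z ^+ 3 * x = z ^+ 3 * y -> x = y.
  move=> E; do 3!apply: z_cancel; rewrite -[z ^+ 3]/(z * (z * z)) -!mulrA in E; exact: E.
have Acan (x y : S) : A * x = A * y -> x = y.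
  move=> E; apply: zc3; rewrite Az; transitivity (p * p * (A * x)); first by ring.
  by rewrite E; ring.
pose U := t * pI * pI * Fc.
have HU : ord 1 (U - 1) by do !apply: ord1_mul.
have XS : vf P Q (z ^+ 3 * U) = 3 * (z ^+ 3 * U).
  have -> : z ^+ 3 * U = t * A * Fc by rewrite /U /A; ring.
  rewrite (derM D1 (t * A)) (derM D1 t A) XFc XA cVA; apply: (unit_cancel Hp).
  transitivity (p * vf P Q t * A * Fc + t * (p * p * (3 * A + 2 * B * A * (sg * A + 2 * pi * r)) * Fc) + t
    * A * (p * p * (B * (sg * A - pi * r)) * Fc)); first by ring.
  by rewrite Xt EQ Az /r /p; ring.
have XU : vf P Q U = 3 * (- (C2 a * w + C2 c * w ^+ 2)) * U.
  apply: zc3; have := XS; rewrite (derM D1) (derX D1) vfz => E.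
  transitivity ((z ^+ 2 * P *+ 3 * U + z ^+ 3 * vf P Q U) - z ^+ 2 * P *+ 3 * U); first by ring.
  by rewrite E EP; ring.
(* Since z^3 U is an eigenfunction of eigenvalue 3, its cube root z U^(1/3) has eigenvalue 1. *)
have [E [HE XE]] := root_ex (n := 3) isT HU; move/XE in XU.
have [FI [HFI FFI]] := inv_ex HFc.
exists (z * E), (s * FI * T); split.
- exact: ord2_lin1.
- split; first exact: ordMl.
  have HsF : ord 1 (s * FI - 1) by apply: ord1_mul.
  have -> : s * FI * T = (s * FI - 1) * T + T by ring.
  by rewrite cD T01 ((@ordM _ 1 1 _ _ HsF OT) 0%N 1%N) // add0r.
- by rewrite (derM D1) vfz XU EP; ring.
have XT : A * vf P Q T = p * (2 + 2 * B * (sg * A + pi * r)) * (A * T) - p * comp VA A r * T.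
  by rewrite -XRc (derM D1) XA; ring.
have XFI := vf_inv P Q FFI; rewrite XFc in XFI.
apply: Acan; apply: (unit_cancel (ord1_mul Hp HFc)).
transitivity (Fc * A * (p * vf P Q s) * FI * T + p * s * A * T * (Fc * vf P Q FI) + p * s * (Fc * FI) * (A
  * vf P Q T)).
  by rewrite !(derM D1); ring.
rewrite Xs XFI XT FFI cVA EQ.
transitivity ((Fc * FI) * (A * (- (sg + pi * w) * s * (- w * p - B * z ^+ 3)) * T) - p * s * A * T * (p *
  (B * (sg * A - pi * r))) * (Fc * FI)
   + p * s * (p * (2 + 2 * B * (sg * A + pi * r)) * (A * T) - p * (3 * A + 2 * B * A * (sg * A + 2 * pi *
     r)) * T)); first by ring.
rewrite FFI Az; transitivity (p * (Fc * FI) * (- (s * T) * A)); last by ring.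
by rewrite FFI /r /p; ring.
Qed.

(** The same scheme with A = z / p. The linear part is now (A, 0), resonant for every power of r,
    but the nonlinear part of the new field and the chosen cofactors are divisible by A, so the
    resonant equations, all at i = 0, are trivial. R becomes a first integral and equals Z W. *)
Lemma case06 a c b sg0 pi0 : @plin K (Cubic a 0 0 c 0 (- pi0) 0) (Cubic sg0 0 b pi0 0 (- c) 0).
Proof.
rewrite /plin; have Hp1 := ord_fldz (Cubic a 0 0 c 0 (- pi0) 0); have Hq1 := ord_fldw (Cubic sg0 0 b pi0 0 (- c) 0).
pose P := z + fld (Cubic a 0 0 c 0 (- pi0) 0) z w; pose Q := - w - fld (Cubic sg0 0 b pi0 0 (- c) 0) w z.
suff [Z [W [HZ [HW1 HW2] EZ EW]]] : exists Z W, [/\ ord 2 (Z - z), ord 1 W /\ W 0%N 1%N = 1, vf P Q Z = Z &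
  vf P Q W = - W].
  by exists Z, W; split => //; apply: linW EW.
have D1 := vf_derivation P Q; have Oz := ord_z K; have Ow := ord_w K.
pose sg : S := C2 sg0; pose pi : S := C2 pi0; pose B : S := C2 b; pose a' : S := C2 a; pose c' : S := C2 c.
have EP : P = z * (1 + a' * z + c' * z ^+ 2 - pi * w ^+ 2) by rewrite /P /fld /a' /c' /pi /=; ring.
pose p : S := 1 + sg * w + pi * w ^+ 2.
have EQ : Q = - w * p - B * z ^+ 2 + c' * z ^+ 2 * w by rewrite /Q /fld /p /sg /pi /B /c' /=; ring.
have sc x y i j : (C2 x + C2 y * w : S) i.+1 j = 0 by rewrite cD cC cCM cXw mulr0 addr0.
have Hp : ord 1 (p - 1).
  have -> : p - 1 = sg * w + pi * w * w by rewrite /p; ring.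
  by apply: ordD; apply: ordMl.
have pS i j : p i.+1 j = 0.
  have -> : p = 1 + w * (C2 sg0 + C2 pi0 * w) by rewrite /p /sg /pi; ring.
  by rewrite cD c1 add0r cXwM; case: j.
have Xp : vf P Q p = (sg + 2 * pi * w) * Q.
  by rewrite /p (derD D1) (derD D1) (der1 D1) !(derCM D1) (derX D1) vfw; ring.
have [pI [HpI ppI]] := inv_ex Hp.
pose A := z * pI.
have OA : ord 1 A by apply: ordMr.
have HA : ord 2 (A - z) by apply: ord2_lin1.
have Az : z = p * A by transitivity ((p * pI) * z); [rewrite ppI; ring | rewrite /A; ring].
pose r := A * w; have Or : ord 1 r by apply: ordMr.
pose Y : S := a' + (c' + B * sg) * z + 2 * B * pi * w.
pose VA : S := z + (z * Y * z - c' * pi * w ^+ 2 * z).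
pose V2 : S := w * (Y + c' * sg * w + c' * z - c' * z) - B * (z ^+ 2 + sg * z * w + pi * w ^+ 2) + c' * z * w.
pose Vr : S := z * V2.
have cVA : comp VA A r = A + (A * (a' + (c' + B * sg) * A + 2 * B * pi * r) * A - c' * pi * r ^+ 2 * A).
  rewrite /VA /Y /B /sg /pi /a' /c' -!C2nat; csimp OA Or; ring.
have cVr : comp Vr A r = A * (r * (a' + (c' + B * sg) * A + 2 * B * pi * r + c' * sg * r) - B * (A ^+ 2 +
  sg * A * r + pi * r ^+ 2) + c' * A * r).
  rewrite /Vr /V2 /Y /B /sg /pi /a' /c' -!C2nat; csimp OA Or; ring.
have XA : vf P Q A = p * comp VA A r.
  apply: (unit_cancel Hp).
  have := congr1 (vf P Q) Az; rewrite vfz (derM D1 p) Xp => E.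
  transitivity ((sg + 2 * pi * w) * Q * A + p * vf P Q A - (sg + 2 * pi * w) * Q * A); first by ring.
  rewrite -E.
  have key (zz : S) : zz = p * A -> zz * (1 + a' * zz + c' * zz ^+ 2 - pi * w ^+ 2) -
     (sg + 2 * pi * w) * (- w * p - B * zz ^+ 2 + c' * zz ^+ 2 * w) * A = p * (p * comp VA A r).
    by move=> ->; rewrite cVA /r /p; ring.
  by rewrite -(key z Az) EP EQ.
have Xr : vf P Q r = p * comp Vr A r.
  rewrite (derM D1) XA vfw cVA cVr EQ.
  have key (zz : S) : zz = p * A -> p * (A + (A * (a' + (c' + B * sg) * A + 2 * B * pi * r) * A - c' * pi *
    r ^+ 2 * A)) * w +
     A * (- w * p - B * zz ^+ 2 + c' * zz ^+ 2 * w) =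
     p * (A * (r * (a' + (c' + B * sg) * A + 2 * B * pi * r + c' * sg * r) - B * (A ^+ 2 + sg * A * r + pi
       * r ^+ 2) + c' * A * r)).
    by move=> ->; rewrite /r /p; ring.
  exact: key.
have OVA : ord 2 (z * Y * z - c' * pi * w ^+ 2 * z).
  apply: ordB; first by apply: (@ordM _ 1 1) => //; apply: ordMr.
  by apply: (@ordM _ 1 1) => //; apply/ordMl/ordMl.
have OVr : ord 2 Vr.
  apply: (@ordM _ 1 1) => //; apply: ordD; last exact: ordMl.
  apply: ordB; first exact: ordMr.
  apply: ordMl; apply: ordD; last by do 2!apply: ordMl.
  by apply: ordD; apply: ordMl.
have dec1 : C2 1 * z + (z * Y * z - c' * pi * w ^+ 2 * z) = VA by rewrite rmorph1 mul1r.
have dec2 : C2 0 * w + Vr = Vr by rewrite rmorph0 mul0r add0r.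
(* Cofactor for which the nonconstant terms in the derivative of [t * A * Fc] cancel. *)
pose rho : S := - (a' + c' * z + (c' * sg + B * pi) * w).
have zdiv (f : S) r' : forall i j, ~~ true || (1 * i%:R + 0 * j%:R == 0 :> K) ->
    (vf (z * Y * z - c' * pi * w ^+ 2 * z) Vr f - z * r' * f) i j = 0.
  move=> i j; rewrite /= mul1r mul0r addr0 pnatr_eq0 => /eqP ->.
  have -> : vf (z * Y * z - c' * pi * w ^+ 2 * z) Vr f - z * r' * f = z * ((z * Y - c' * pi * w ^+ 2) * d1
    f + V2 * d2 f - r' * f).
    by rewrite /vf /Vr; ring.
  by rewrite cXzM.
have [|||| F [F1 _ F3]] := @lin_vf K 1 0 0 _ _ (z * rho) (fun _ _ => true) 0 0 OVA OVr => //.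
- exact: ordMr.
- by rewrite mulr0 mul0r addr0.
- by move=> f _ _; apply: zdiv.
have [|||| R [R1 _ R3]] := @lin_vf K 1 0 0 _ _ (z * 0) (fun _ _ => true) 0 1 OVA OVr => //.
- exact: ordMr.
- by rewrite mulr0 mul0r addr0.
- by move=> f _ _; apply: zdiv.
rewrite dec1 dec2 rmorph0 add0r in F3; rewrite dec1 dec2 rmorph0 mulr0 addr0 mul0r in R3.
rewrite addn0 /mono !expr0 rmorph1 !mulr1 in F1; rewrite /mono !rmorph1 expr0 expr1 !mul1r in R1.
pose Fc := comp F A r; have HFc : ord 1 (Fc - 1) by apply: ord_comp1.
have XFc : vf P Q Fc = p * (A * - (a' + c' * A + (c' * sg + B * pi) * r)) * Fc.
  rewrite (vf_pullM _ OA Or XA Xr) F3 /rho /B /sg /pi /a' /c'; csimp OA Or; rewrite /Fc; ring.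
have [T [RT OT T01]] := comp_div OA R1; rewrite -/r in RT.
have A01 : A 0%N 1%N = 0 by have := HA 0%N 1%N isT; rewrite cB cXz subr0.
rewrite A01 mulr0 addr0 in T01.
have XRc : vf P Q (A * T) = 0.
  by rewrite -RT (vf_pullM _ OA Or XA Xr) R3 (comp0 A r) mulr0.
have [|t1|t1|t [t0 t1 t2]] := @ode K p (sg + pi * w) => //.
  exact: sc.
have [tI [HtI ttI]] := inv_ex t0.
have Xt : p * vf P Q t = (sg + pi * w) * t * Q by rewrite vf_onlyw // mulrA t2.
have XZ : vf P Q (t * A * Fc) = t * A * Fc.
  rewrite (derM D1 (t * A)) (derM D1 t A) XFc XA cVA; apply: (unit_cancel Hp).
  set x1 := A + _; set x2 := A * - _.
  transitivity (p * vf P Q t * A * Fc + t * (p * p * x1) * Fc + t * A * (p * p * x2 * Fc)); first by ring.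
  rewrite Xt EQ.
  have key (zz : S) : zz = p * A -> (sg + pi * w) * t * (- w * p - B * zz ^+ 2 + c' * zz ^+ 2 * w) * A * Fc
     + t * (p * p * x1) * Fc + t * A * (p * p * x2 * Fc) = p * (t * A * Fc).
    by move=> ->; rewrite /x1 /x2 /r /p; ring.
  exact: key.
have [FI [HFI FFI]] := inv_ex HFc.
pose W := tI * FI * T.
have ZW : (t * A * Fc) * W = A * T.
  transitivity ((t * tI) * (Fc * FI) * (A * T)); first by rewrite /W; ring.
  by rewrite ttI FFI; ring.
exists (t * A * Fc), W; split => //.
- have -> : t * A * Fc = A * (t * Fc) by ring.
  by apply: ord2_lin => //; apply: ord1_mul.
- split; first exact: ordMl.
  have HsF : ord 1 (tI * FI - 1) by apply: ord1_mul.
  have -> : W = (tI * FI - 1) * T + T by rewrite /W; ring.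
  by rewrite cD T01 ((@ordM _ 1 1 _ _ HsF OT) 0%N 1%N) // add0r.
(* The product Z W is a first integral and Z has eigenvalue 1; cancelling Z gives W the eigenvalue
   -1. *)
have := XRc; rewrite -ZW (derM D1) XZ => E.
have Hu : ord 1 (t * Fc - 1) by apply: ord1_mul.
apply: (unit_cancel Hu); apply: z_cancel; rewrite Az.
transitivity (p * (t * A * Fc * W + t * A * Fc * vf P Q W) - p * (t * A * Fc * W)); first by ring.
by rewrite E; ring.
Qed.
End Cases3.

(** * Families that need square roots or a distinction on the parameters *)

Section Families.
Variable K : numClosedFieldType.

Lemma eq_plin (a b a' b' : cubic K) : plin a b -> a = a' -> b = b' -> plin a' b'.
Proof. by move=> H <- <-. Qed.

Lemma plin0 : plin (Cubic (0 : K) 0 0 0 0 0 0) (Cubic 0 0 0 0 0 0 0).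
Proof. exact: case05. Qed.

(** Scaling z and w by square roots of a30 / 7 and b30 / 7 leads to the field of [case21]. The two
    relations determine the product of a03 with the first root only up to sign, which is absorbed in
    the choice of the second root. *)
Lemma plin21 (a30 a03 b30 b03 : K) : a30 * b30 <> 0 -> 49 * a03 * b03 - 16 * a30 * b30 = 0 ->
  a03 * a30 ^+ 2 - b03 * b30 ^+ 2 = 0 ->
  plin (Cubic 0 0 0 a30 0 (- 3 / 7 * b30) a03) (Cubic 0 0 0 b30 0 (- 3 / 7 * a30) b03).
Proof.
move=> /eqP; rewrite mulf_eq0 negb_or => /andP[a0 b0] /eqP; rewrite subr_eq0 => /eqP E1 /eqP;
  rewrite subr_eq0 => /eqP E2.
have n7 : 7 != 0 :> K by rewrite pnatr_eq0.
pose al := sqrtC (a30 / 7); pose be0 := sqrtC (b30 / 7).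
have al2 : a30 = 7 * al ^+ 2 by rewrite sqrtCK; field.
have be2 : b30 = 7 * be0 ^+ 2 by rewrite sqrtCK; field.
have al0 : al != 0 by apply: contraNneq a0 => e; rewrite al2 e expr0n mulr0.
have be00 : be0 != 0 by apply: contraNneq b0 => e; rewrite be2 e expr0n mulr0.
have [be [Hbe be0' Ha]] : exists be : K, [/\ b30 = 7 * be ^+ 2, be != 0 & a03 * al = 4 * be ^+ 3].
  have : (a03 * al) ^+ 2 = (4 * be0 ^+ 3) ^+ 2.
    have nb : b03 != 0.
      apply: contraTneq isT => e; move/eqP: E1; rewrite e mulr0 eq_sym !mulf_eq0 !pnatr_eq0 /=.
      by rewrite (negbTE a0) (negbTE b0).
    apply: (mulIf nb); apply: (mulfI n7); apply: (mulfI n7).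
    have E1' : 49 * a03 * b03 = 16 * 49 * al ^+ 2 * be0 ^+ 2 by rewrite E1 al2 be2; ring.
    have E2' : a03 * al ^+ 4 = b03 * be0 ^+ 4.
      apply: (mulfI n7); apply: (mulfI n7).
      by transitivity (a03 * a30 ^+ 2); [rewrite al2; ring | rewrite E2 be2; ring].
    apply: (mulIf (expf_neq0 2 al0)).
    transitivity (49 * a03 * b03 * (a03 * al ^+ 4)); first by ring.
    by rewrite E1' E2'; ring.
  move/eqP; rewrite eqf_sqr => /orP[/eqP E|/eqP E].
    by exists be0.
  exists (- be0); split; [by rewrite sqrrN | by rewrite oppr_eq0 | by rewrite E; ring].
have Hb : b03 * be = 4 * al ^+ 3.
  apply: (mulIf (expf_neq0 3 be0')); apply: (mulfI n7); apply: (mulfI n7).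
  transitivity (b03 * b30 ^+ 2); first by rewrite Hbe; ring.
  by rewrite -E2 al2; transitivity (49 * (a03 * al) * al ^+ 3); [ring | rewrite Ha; ring].
apply: (plin_scale (al := al) (be := be) _ _ _ _ _ _ _ _ _ _ _ _ _ _ _ _ (case21 K)) => //=;
  rewrite ?mul0r // ?al2 ?Hbe //; by field.
Qed.

(** If a20 is nonzero the relation expresses a12 as required by [case18a]. If a20 = 0 and a11 is
    nonzero, then a30 = 0 and the system falls under [case02] after the exchange. If both vanish
    there are no quadratic terms. *)
Lemma plin18 (a20 a11 a30 a12 e : K) : e != 0 -> a30 * a11 ^+ 2 + a20 ^+ 2 * a12 = 0 ->
  plin (Cubic (e * a20) (e * a11) 0 (e * a30) 0 (e * a12) 0)
       (Cubic (- (e * a11)) (- (e * a20)) 0 (- (e * a12)) 0 (- (e * a30)) 0).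
Proof.
move=> e0 E; case: (eqVneq a20 0) => [a0|a0].
  case: (eqVneq a11 0) => [b0|b0].
    rewrite a0 b0; apply: (eq_plin (case18b (e * a30 / 2) (e * a12 / 2))); congr Cubic; by field.
  have c0 : a30 = 0.
    by move: E; rewrite a0 expr0n mul0r addr0 => /eqP; rewrite mulf_eq0 expf_eq0 (negbTE b0) orbF => /eqP.
  rewrite a0 c0; apply/plin_swap.
  apply: (eq_plin (case02 (- (e * a11)) (- (e * a12)) (e * a11) 0 (e * a12) 0)); congr Cubic; by ring.
have -> : a12 = - (a30 / a20 ^+ 2 * a11 ^+ 2).
  apply: (mulfI (expf_neq0 2 a0)); move/eqP: E; rewrite addrC addr_eq0 => /eqP ->; by field.
apply: (eq_plin (case18a (e * a20) (e * a11) (a30 / (e * a20 ^+ 2)))); congr Cubic; by field; rewrite a0 e0.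
Qed.
End Families.

(** * Sufficiency of the families *)

Section Sufficiency.
Variable K : numClosedFieldType.

Lemma sufficient (a20 a11 a02 a30 a21 a12 a03 b20 b11 b02 b30 b21 b12 b03 e : K) :
  [/\ a21 = 0, b21 = 0 &
   vanish [:: a20; a30; b11; b02; b12; b03] \/
   vanish [:: b20; b30; a11; a02; a12; a03] \/
   vanish [:: a11; a02; a12; a03; b11; b30] \/
   vanish [:: b11; b02; b12; b03; a11; a30] \/
   vanish [:: a11; a02; a12; a03; b11; b02; b12; b03] \/
   vanish [:: a11; b11; a02; a03; b03; a12 + b30; a30 + b12] \/
   vanish [:: a11; b11; b02; b03; a03; a30 + b12; a12 + b30] \/
   vanish [:: a20; a02; a12; a03; b11; b02; b12; b03;
                        2 * a11 - b20] \/
   vanish [:: b20; b02; b12; b03; a11; a02; a12; a03;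
                        2 * b11 - a20] \/
   vanish [:: a20; a02; a12; a03; b11; b30; b03;
                        2 * a11 + b20; 2 * a30 + b12] \/
   vanish [:: b20; b02; b12; b03; a11; a30; a03;
                        a20 + 2 * b11; a12 + 2 * b30] \/
   vanish [:: a20; a02; a30; a12; a03; b11; b02; b30; b12;
                        3 * a11 + b20] \/
   vanish [:: b20; b02; b30; b12; b03; a11; a02; a30; a12;
                        a20 + 3 * b11] \/
   vanish [:: a20; a02; a30; a03; b11; b02; b12;
                        3 * a11 - b20; 3 * a12 + b30] \/
   vanish [:: b20; b02; b30; b03; a11; a02; a12;
                        3 * b11 - a20; a30 + 3 * b12] \/
   vanish [:: a20; a11; a02; a30; a03; b20; b11; b12; b03;
                        2 * a12 + b30] \/
   vanish [:: b20; b11; b02; b30; b03; a20; a11; a12; a03;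
                        a30 + 2 * b12] \/
   vanish [:: a02; b02; a03; b03; a11 + b20; a20 + b11;
                        a12 + b30; a30 + b12;
                        a30 * b20 ^+ 2 - a20 ^+ 2 * b30] \/
   (a20 * b20 <> 0 /\
              vanish [:: a30; a12; a03; b30; b12; b03;
                         7 * a11 + 6 * b20; 6 * a20 + 7 * b11;
                         7 * a02 * a20 - 3 * b20 ^+ 2;
                         - (3 * a20 ^+ 2) + 7 * b02 * b20]) \/
   (a20 * b20 <> 0 /\
              vanish [:: a30; a12; a03; b30; b12; b03;
                         5 * a11 + 2 * b20; 2 * a20 + 5 * b11;
                         5 * a02 * a20 + 3 * b20 ^+ 2;
                         3 * a20 ^+ 2 + 5 * b02 * b20]) \/
   (a30 * b30 <> 0 /\
              vanish [:: a20; a11; a02; b20; b11; b02;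
                         7 * a12 + 3 * b30; 3 * a30 + 7 * b12;
                         49 * a03 * b03 - 16 * a30 * b30;
                         a03 * a30 ^+ 2 - b03 * b30 ^+ 2])] ->
  plin (Cubic (e * a20) (e * a11) (e * a02) (e * a30) (e * a21) (e * a12) (e * a03))
       (Cubic (e * b20) (e * b11) (e * b02) (e * b30) (e * b21) (e * b12) (e * b03)).
Proof.
Ltac peel := rewrite /vanish /= ?andbT; repeat (case/andP; let h := fresh "h" in move=> /eqP h); let h := fresh "h" in move/eqP => h.
Ltac fin := congr Cubic; by [ring | field].
case: (eqVneq e 0) => [->|e0]; first by rewrite !mul0r => _; apply: plin0.
case=> -> ->.
case; [peel; subst | ].
  apply: (eq_plin (plin_swap (case02 (e * b20) (e * b30) (e * a11) (e * a02) (e * a12) (e * a03)))); fin.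
case; [peel; subst | ].
  apply: (eq_plin (case02 (e * a20) (e * a30) (e * b11) (e * b02) (e * b12) (e * b03))); fin.
case; [peel; subst | ].
  apply: (eq_plin (case03 (e * a20) (e * a30) (e * b20) (e * b02) (e * b12) (e * b03))); fin.
case; [peel; subst | ].
  apply: (eq_plin (plin_swap (case03 (e * b20) (e * b30) (e * a20) (e * a02) (e * a12) (e * a03)))); fin.
case; [peel; subst | ].
  apply: (eq_plin (case05 (e * a20) (e * a30) (e * b20) (e * b30))); fin.
case; [peel | ].
  have E1 : a12 = - b30 by apply/eqP; rewrite -addr_eq0; apply/eqP.
  have E2 : a30 = - b12 by apply/eqP; rewrite -addr_eq0; apply/eqP.
  subst; apply: (eq_plin (case06 (e * a20) (- (e * b12)) (e * b02) (e * b20) (e * b30))); fin.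
case; [peel | ].
  have E1 : b12 = - a30 by apply/eqP; rewrite -addr_eq0 addrC; apply/eqP.
  have E2 : b30 = - a12 by apply/eqP; rewrite -addr_eq0 addrC; apply/eqP.
  subst; apply: (eq_plin (plin_swap (case06 (e * b20) (- (e * a12)) (e * a02) (e * a20) (e * a30)))); fin.
case; [peel | ].
  have E1 : b20 = 2 * a11 by apply/eqP; rewrite eq_sym -subr_eq0; apply/eqP.
  subst; apply: (eq_plin (case08 (e * a11) (e * a30) (e * b30))); fin.
case; [peel | ].
  have E1 : a20 = 2 * b11 by apply/eqP; rewrite eq_sym -subr_eq0; apply/eqP.
  subst; apply: (eq_plin (plin_swap (case08 (e * b11) (e * b30) (e * a30)))); fin.
case; [peel | ].
  have E1 : b20 = - (2 * a11) by apply/eqP; rewrite -addr_eq0 addrC; apply/eqP.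
  have E2 : b12 = - (2 * a30) by apply/eqP; rewrite -addr_eq0 addrC; apply/eqP.
  subst; apply: (eq_plin (case10 (e * a11) (e * a30) (e * b02 / 3))); fin.
case; [peel | ].
  have E1 : a20 = - (2 * b11) by apply/eqP; rewrite -addr_eq0; apply/eqP.
  have E2 : a12 = - (2 * b30) by apply/eqP; rewrite -addr_eq0; apply/eqP.
  subst; apply: (eq_plin (plin_swap (case10 (e * b11) (e * b30) (e * a02 / 3)))); fin.
case; [peel | ].
  have E1 : b20 = - (3 * a11) by apply/eqP; rewrite -addr_eq0 addrC; apply/eqP.
  subst; apply: (eq_plin (case12 (e * a11) (e * b03 / 4))); fin.
case; [peel | ].
  have E1 : a20 = - (3 * b11) by apply/eqP; rewrite -addr_eq0; apply/eqP.
  subst; apply: (eq_plin (plin_swap (case12 (e * b11) (e * a03 / 4)))); fin.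
case; [peel | ].
  have E1 : b20 = 3 * a11 by apply/eqP; rewrite eq_sym -subr_eq0; apply/eqP.
  have E2 : b30 = - (3 * a12) by apply/eqP; rewrite -addr_eq0 addrC; apply/eqP.
  subst; apply: (eq_plin (case14 (e * a11) (e * a12) (e * b03))); fin.
case; [peel | ].
  have E1 : a20 = 3 * b11 by apply/eqP; rewrite eq_sym -subr_eq0; apply/eqP.
  have E2 : a30 = - (3 * b12) by apply/eqP; rewrite -addr_eq0; apply/eqP.
  subst; apply: (eq_plin (plin_swap (case14 (e * b11) (e * b12) (e * a03)))); fin.
case; [peel | ].
  have E1 : b30 = - (2 * a12) by apply/eqP; rewrite -addr_eq0 addrC; apply/eqP.
  subst; apply: (eq_plin (case16 (e * a12) (e * b02 / 3))); fin.
case; [peel | ].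
  have E1 : a30 = - (2 * b12) by apply/eqP; rewrite -addr_eq0; apply/eqP.
  subst; apply: (eq_plin (plin_swap (case16 (e * b12) (e * a02 / 3)))); fin.
case; [peel | ].
  have E1 : b20 = - a11 by apply/eqP; rewrite -addr_eq0 addrC; apply/eqP.
  have E2 : b11 = - a20 by apply/eqP; rewrite -addr_eq0 addrC; apply/eqP.
  have E3 : b30 = - a12 by apply/eqP; rewrite -addr_eq0 addrC; apply/eqP.
  have E4 : b12 = - a30 by apply/eqP; rewrite -addr_eq0 addrC; apply/eqP.
  subst; apply: (eq_plin (@plin18 K a20 a11 a30 a12 e e0 _)); [|fin|fin].
  by rewrite -[RHS]h7; ring.
have n7 : 7 != 0 :> K by rewrite pnatr_eq0.
have n5 : 5 != 0 :> K by rewrite pnatr_eq0.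
case; [case=> /eqP; rewrite mulf_eq0 negb_or => /andP[na nb]; peel | ].
  have E1 : a11 = - 6 * b20 / 7 by apply: (mulfI n7); rewrite -[LHS]subr0 -h5; field.
  have E2 : b11 = - 6 * a20 / 7 by apply: (mulfI n7); rewrite -[LHS]subr0 -h6; field.
  have E3 : a02 = 3 * b20 ^+ 2 / (7 * a20).
    by apply: (mulfI n7); apply: (mulIf na); rewrite -[LHS]subr0 -h7; field; rewrite na.
  have E4 : b02 = 3 * a20 ^+ 2 / (7 * b20).
    by apply: (mulfI n7); apply: (mulIf nb); rewrite -[LHS]subr0 -h8; field; rewrite nb.
  (* The scaling that brings both squares [k20] to the coefficient 7 of the model field. *)
  subst; apply: (plin_scale (al := e * a20 / 7) (be := e * b20 / 7) _ _ _ _ _ _ _ _ _ _ _ _ _ _ _ _ (case19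
    K)) => //=;
    rewrite ?mulf_neq0 ?invr_eq0 //; by field; rewrite ?na ?nb.
case; [case=> /eqP; rewrite mulf_eq0 negb_or => /andP[na nb]; peel | ].
  have E1 : a11 = - 2 * b20 / 5 by apply: (mulfI n5); rewrite -[LHS]subr0 -h5; field.
  have E2 : b11 = - 2 * a20 / 5 by apply: (mulfI n5); rewrite -[LHS]subr0 -h6; field.
  have E3 : a02 = - 3 * b20 ^+ 2 / (5 * a20).
    by apply: (mulfI n5); apply: (mulIf na); rewrite -[LHS]subr0 -h7; field; rewrite na.
  have E4 : b02 = - 3 * a20 ^+ 2 / (5 * b20).
    by apply: (mulfI n5); apply: (mulIf nb); rewrite -[LHS]subr0 -h8; field; rewrite nb.
  subst; apply: (plin_scale (al := e * a20 / 5) (be := e * b20 / 5) _ _ _ _ _ _ _ _ _ _ _ _ _ _ _ _ (case20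
    K)) => //=;
    rewrite ?mulf_neq0 ?invr_eq0 //; by field; rewrite ?na ?nb.
case=> ne; peel.
have E1 : a12 = - 3 / 7 * b30 by apply: (mulfI n7); rewrite -[LHS]subr0 -h5; field.
have E2 : b12 = - 3 / 7 * a30 by apply: (mulfI n7); rewrite -[LHS]subr0 -h6; field.
subst; apply: (eq_plin (@plin21 K (e * a30) (e * a03) (e * b30) (e * b03) _ _ _)).
- by rewrite mulrACA => /eqP; rewrite mulf_eq0 [e * e == 0]mulf_eq0 (negbTE e0) => /eqP.
- by rewrite -[RHS](mulr0 (e ^+ 2)) -h7; ring.
- by rewrite -[RHS](mulr0 (e ^+ 3)) -h8; ring.
- fin.
- fin.
Qed.
End Sufficiency.

(** * Obstructions *)

Section Recursion.
Variable K : numFieldType.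
Notation S := (fps (fps K)).
Notation z := (Xz K).
Notation w := (Xw K).

Lemma mono_sim (F W : S) n : ord 2 (F - z) -> ord 2 (W - w) -> ord (n + n)%N.+2 (F * (F * W) ^+ n - z * (z * w) ^+ n).
Proof.
move=> HF HW; have OF := ord1_of2 HF (ord_z K); have OW := ord1_of2 HW (ord_w K).
have O2 : ord 3 (F * W - z * w).
  have -> : F * W - z * w = (F - z) * W + z * (W - w) by ring.
  by apply: ordD; [apply: (@ordM _ 2 1) | apply: (@ordM _ 1 2) => //; apply: ord_z].
have Ozw : ord 2 (z * w) by apply: (@ordM _ 1 1); [apply: ord_z | apply: ord_w].
have OFW : ord 2 (F * W) by apply: (@ordM _ 1 1).
have OX : ord (n + n)%N.+1 ((F * W) ^+ n - (z * w) ^+ n).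
  elim: n => [|n IH]; first by rewrite !expr0 subrr; apply: ord0.
  have -> : (F * W) ^+ n.+1 - (z * w) ^+ n.+1 =
    (F * W - z * w) * (F * W) ^+ n + z * w * ((F * W) ^+ n - (z * w) ^+ n) by rewrite !exprS; ring.
  apply: ordD.
    by apply: (@ordW _ _ (3 + n * 2)%N); [lia | apply: ordM => //; apply: ordX].
  by apply: (@ordW _ _ (2 + (n + n).+1)%N); [lia | apply: ordM].
have -> : F * (F * W) ^+ n - z * (z * w) ^+ n = (F - z) * (F * W) ^+ n + z * ((F * W) ^+ n - (z * w) ^+ n) by ring.
apply: ordD; first by apply: (@ordW _ _ (2 + n * 2)%N); [lia | apply: ordM => //; apply: ordX].
by apply: (@ordM _ 1 (n + n).+1%N) => //; apply: ord_z.
Qed.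

(** The series F (F W)^m is again an eigenfunction of eigenvalue 1 and starts with z (z w)^m, so a
    multiple of it removes the resonant coefficient (m + 1, m) without disturbing lower degrees. *)
Lemma normalized_z (P Q Z W : S) : linearizes P Q Z W -> forall N, exists F,
  [/\ ord 2 (F - z), vf P Q F = F & forall k, (0 < k <= N)%N -> F k.+1 k = 0].
Proof.
move=> [HZ HW EZ EW]; elim=> [|n [F [HF EF F0]]]; first by exists Z; split => // -[].
set m := n.+1; set G := F * (F * W) ^+ m; exists (F - C2 (F m.+1 m) * G).
have D := vf_derivation P Q.
have EFW : vf P Q (F * W) = 0 by rewrite (derM D F W) EF EW mulrN subrr.
have EG : vf P Q G = G by rewrite (derM D F) (derX D) EFW EF mulr0 mul0rn mulr0 addr0.
have OG : ord (m + m)%N.+2 (G - z * (z * w) ^+ m) by apply: mono_sim.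
have cG i j : (i + j < (m + m).+2)%N -> G i j = ((i == m.+1) && (j == m))%:R.
  move/OG; rewrite cB => /eqP; rewrite subr_eq0 => /eqP ->.
  have -> : z * (z * w) ^+ m = mono 1 m.+1 m by rewrite /mono rmorph1 mul1r exprMn exprS mulrA.
  by rewrite cmono; case: (_ && _).
split.
- have -> : F - C2 (F m.+1 m) * G - z = (F - z) - C2 (F m.+1 m) * G by ring.
  apply: ordB => //; apply: ordMl => i j lt; rewrite cG; last by rewrite /m; lia.
  by rewrite /m; case: andP => // -[/eqP E1 /eqP E2]; lia.
- by rewrite (derB D) (derCM D) EF EG.
move=> k /andP[k0]; rewrite leq_eqVlt => /orP[/eqP->|lt].
  by rewrite cB cCM cG ?eqxx ?mulr1 ?subrr // /m; lia.
rewrite cB cCM cG; last by rewrite /m; lia.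
by rewrite eqSS (ltn_eqF lt) mulr0 subr0 F0 // k0.
Qed.

Definition la (a : cubic K) : seq (nat * nat * K) :=
  [:: (2, 0, k20 a); (1, 1, k11 a); (0, 2, k02 a); (3, 0, k30 a); (2, 1, k21 a); (1, 2, k12 a); (0, 3, k03 a)]%N.
Definition lb (b : cubic K) : seq (nat * nat * K) :=
  [:: (0, 2, k20 b); (1, 1, k11 b); (2, 0, k02 b); (0, 3, k30 b); (1, 2, k21 b); (2, 1, k12 b); (3, 0, k03 b)]%N.
Definition fsum (l : seq (nat * nat * K)) : S := \sum_(t <- l) C2 t.2 * (z ^+ t.1.1 * w ^+ t.1.2).

Lemma fld_la a : fld a z w = fsum (la a).
Proof. by rewrite /fsum /la !big_cons big_nil /= !expr0 !expr1 /fld; ring. Qed.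
Lemma fld_lb b : fld b w z = fsum (lb b).
Proof. by rewrite /fsum /lb !big_cons big_nil /= !expr0 !expr1 /fld; ring. Qed.

Lemma czX n f i j : (z ^+ n * f) i j = if (n <= i)%N then f (i - n)%N j else 0.
Proof.
elim: n i => [|n IH] i; first by rewrite expr0 mul1r subn0.
by rewrite exprS -mulrA cXzM; case: i => [|i] //; rewrite IH.
Qed.
Lemma cwX n f i j : (w ^+ n * f) i j = if (n <= j)%N then f i (j - n)%N else 0.
Proof.
elim: n j => [|n IH] j; first by rewrite expr0 mul1r subn0.
by rewrite exprS -mulrA cXwM; case: j => [|j] //; rewrite IH.
Qed.

Definition tA (F : S) i j (t : nat * nat * K) : K :=
  if (t.1.1 <= i)%N && (t.1.2 <= j)%N then (i - t.1.1).+1%:R * (t.2 * F (i - t.1.1).+1 (j - t.1.2)%N) else 0.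
Definition tB (F : S) i j (t : nat * nat * K) : K :=
  if (t.1.1 <= i)%N && (t.1.2 <= j)%N then (j - t.1.2).+1%:R * (t.2 * F (i - t.1.1)%N (j - t.1.2).+1) else 0.

(** For i = j + 1 the first summand disappears and a condition on lower coefficients remains: the
    obstruction. *)
Lemma fld_rec (a b : cubic K) F : vf (z + fld a z w) (- w - fld b w z) F = F -> forall i j,
  (i%:R - j%:R - 1) * F i j + (\sum_(t <- la a) tA F i j t - \sum_(t <- lb b) tB F i j t) = 0.
Proof.
move=> E i j; set A := fld a z w; set B := fld b w z.
have : (z * d1 F + A * d1 F - (w * d2 F + B * d2 F)) i j = F i j.
  by rewrite -[in RHS]E /vf -/A -/B; congr (cf (cf _ i) j); ring.
rewrite (cB (z * d1 F + A * d1 F)) (cD (z * d1 F)) (cD (w * d2 F)).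
have -> : (z * d1 F) i j = i%:R * F i j.
  by rewrite cXzM; case: i => [|i]; rewrite ?mul0r // cd1 mulr_natl.
have -> : (w * d2 F) i j = j%:R * F i j.
  by rewrite cXwM; case: j => [|j]; rewrite ?mul0r // cd2 mulr_natl.
have -> : (A * d1 F) i j = \sum_(t <- la a) tA F i j t.
  rewrite /A fld_la /fsum mulr_suml csum; apply: eq_bigr => -[[k l] c] _ /=.
  rewrite -!mulrA cCM czX cwX /tA /=; case: leqP => //= _; last by rewrite mulr0.
  by case: leqP => //= _; rewrite ?mulr0 // cd1 -mulr_natl; ring.
have -> : (B * d2 F) i j = \sum_(t <- lb b) tB F i j t.
  rewrite /B fld_lb /fsum mulr_suml csum; apply: eq_bigr => -[[k l] c] _ /=.
  rewrite -!mulrA cCM czX cwX /tB /=; case: leqP => //= _; last by rewrite mulr0.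
  by case: leqP => //= _; rewrite ?mulr0 // cd2 -mulr_natl; ring.
move/eqP; rewrite -subr_eq0 => /eqP H; rewrite -[RHS]H; ring.
Qed.
End Recursion.

(** * Computation of the obstructions with sparse integer polynomials *)

Local Open Scope nat_scope.
Local Delimit Scope Z_scope with ZZ.

Definition mnm := seq nat.
Definition spoly := seq (mnm * Z).

Fixpoint mmul (a b : mnm) : mnm :=
  match a, b with
  | [::], _ => b
  | _, [::] => a
  | x :: a', y :: b' => (x + y) :: mmul a' b'
  end.
Fixpoint mcmp (a b : mnm) : comparison :=
  match a, b with
  | [::], [::] => Eq
  | [::], _ => Lt
  | _, [::] => Gt
  | x :: a', y :: b' => match Nat.compare x y with Eq => mcmp a' b' | c => c end
  end.
(** Merge of term lists in decreasing order of [mcmp]; the inner fixpoint allows either argument to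
    decrease. *)
Fixpoint padd (p : spoly) : spoly -> spoly :=
  fix aux q :=
  match p, q with
  | [::], _ => q
  | _, [::] => p
  | (m, c) :: p', (n, d) :: q' =>
    match mcmp m n with
    | Eq => let e := (c + d)%ZZ in if Z.eqb e 0 then padd p' q' else (m, e) :: padd p' q'
    | Gt => (m, c) :: padd p' q
    | Lt => (n, d) :: aux q'
    end
  end.
Definition pscale (c : Z) (p : spoly) : spoly := [seq (t.1, (c * t.2)%ZZ) | t <- p].
Definition pmulterm (t : mnm * Z) (p : spoly) : spoly := [seq (mmul t.1 u.1, (t.2 * u.2)%ZZ) | u <- p].
Definition pmul (p q : spoly) : spoly := foldr (fun t acc => padd (pmulterm t q) acc) [::] p.

(* A substitution: the i-th parameter is c times the v-th variable when the i-th entry is (c, v). *)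
Definition subst := seq (Z * nat).
Definition mvar (v : nat) : mnm := rcons (nseq v 0) 1.
Definition pvar (s : subst) (i : nat) : spoly :=
  let: (c, v) := nth (0%ZZ, 0) s i in if Z.eqb c 0 then [::] else [:: (mvar v, c)].

Definition sla (s : subst) : seq (nat * nat * spoly) :=
  [:: (2, 0, pvar s 0); (1, 1, pvar s 1); (0, 2, pvar s 2); (3, 0, pvar s 3); (2, 1, pvar s 4);
      (1, 2, pvar s 5); (0, 3, pvar s 6)].
Definition slb (s : subst) : seq (nat * nat * spoly) :=
  [:: (0, 2, pvar s 7); (1, 1, pvar s 8); (2, 0, pvar s 9); (0, 3, pvar s 10); (1, 2, pvar s 11);
      (2, 1, pvar s 12); (3, 0, pvar s 13)].

Definition den (n i : nat) : Z := (Z.of_nat i - Z.of_nat (n - i) - 1)%ZZ.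
Definition lc (n : nat) : Z :=
  foldr Z.lcm 1%ZZ [seq e <- [seq den n i | i <- iota 0 n.+1] | ~~ Z.eqb e 0].

(** A quadratic term of the field acts on the coefficients of degree n - 1, in [L1], and a cubic one
    on those of degree n - 2, in [L2]. The latter have been multiplied by one [lc] less, hence the
    factor [ln]. *)
Definition pick (ln : Z) (L1 L2 : seq spoly) (d i : nat) : spoly :=
  if d == 2 then nth [::] L1 i else pscale ln (nth [::] L2 i).
Definition sA n ln L1 L2 i (t : nat * nat * spoly) : spoly :=
  if (t.1.1 <= i) && (t.1.2 <= n - i) then
    pscale (Z.of_nat (i - t.1.1).+1) (pmul t.2 (pick ln L1 L2 (t.1.1 + t.1.2) (i - t.1.1).+1)) else [::].
Definition sB n ln L1 L2 i (t : nat * nat * spoly) : spoly :=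
  if (t.1.1 <= i) && (t.1.2 <= n - i) then
    pscale (Z.of_nat (n - i - t.1.2).+1) (pmul t.2 (pick ln L1 L2 (t.1.1 + t.1.2) (i - t.1.1))) else [::].
Definition sum_poly (l : seq spoly) : spoly := foldr padd [::] l.
Definition raw s n ln L1 L2 i : spoly :=
  padd (sum_poly [seq sA n ln L1 L2 i t | t <- sla s]) (pscale (-1) (sum_poly [seq sB n ln L1 L2 i t | t <- slb s])).
(** The resonant coefficient is set to zero, in agreement with [normalized_z]. *)
Definition step s n L1 L2 : seq spoly :=
  [seq (let e := den n i in if Z.eqb e 0 then [::] else pscale (- (lc n / e)) (raw s n (lc n.-1) L1 L2 i))
     | i <- iota 0 n.+1].
(** Resonances occur in odd degree n, at the exponent (n + 1) / 2 of z; even degrees record the zero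
    polynomial. *)
Fixpoint loop s cnt n L1 L2 : seq spoly :=
  if cnt is c.+1 then
    (if odd n then raw s n (lc n.-1) L1 L2 n.+1./2 else [::]) :: loop s c n.+1 (step s n L1 L2) L1
  else [::].
(* Denominators are cleared with lc; entry 2k-1 is a multiple of the k-th obstruction. *)
Definition obst s N : seq spoly := loop s N.*2 2 [:: [::]; [:: ([::], lc 1)]] [:: [::]].

Local Open Scope ring_scope.

(** * Evaluation of integer polynomials at parameter values *)

Section Eval.
Variable K : numFieldType.
Implicit Types (p q : spoly) (rho : nat -> K).

Definition zK (c : Z) : K := (int_of_Z c)%:~R.
Lemma zKD a b : zK (a + b)%ZZ = zK a + zK b. Proof. by rewrite /zK -intrD; congr (_%:~R);
  exact: (rmorphD int_of_Z). Qed.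
Lemma zKM a b : zK (a * b)%ZZ = zK a * zK b. Proof. by rewrite /zK -intrM; congr (_%:~R);
  exact: (rmorphM int_of_Z). Qed.
Lemma zKN a : zK (- a)%ZZ = - zK a. Proof. by rewrite /zK -mulrNz; congr (_%:~R); exact: (rmorphN int_of_Z). Qed.
Lemma zK0 : zK 0 = 0. Proof. by []. Qed.
Lemma zK1 : zK 1 = 1. Proof. by []. Qed.
Lemma zK_nat n : zK (Z.of_nat n) = n%:R. Proof. by rewrite /zK (_ : int_of_Z _ = n%:Z) //; lia. Qed.
Lemma zK_eq0 a : (zK a == 0) = Z.eqb a 0.
Proof. by rewrite /zK intr_eq0; apply/idP/idP; lia. Qed.

Fixpoint meval rho k (m : mnm) : K := if m is e :: m' then rho k ^+ e * meval rho k.+1 m' else 1.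
Definition peval rho p : K := \sum_(t <- p) zK t.2 * meval rho 0 t.1.

Lemma mmulE rho k a b : meval rho k (mmul a b) = meval rho k a * meval rho k b.
Proof.
elim: a k b => [|x a IH] k [|y b] /=; rewrite ?mul1r ?mulr1 // IH exprD; ring.
Qed.
Lemma mcmpE a b : mcmp a b = Eq -> a = b.
Proof.
elim: a b => [|x a IH] [|y b] //=; case E: (Nat.compare x y) => // /IH ->.
by move/Nat.compare_eq_iff: E => ->.
Qed.
Lemma peval0 rho : peval rho [::] = 0. Proof. exact: big_nil. Qed.
Lemma peval_cons rho m c p : peval rho ((m, c) :: p) = zK c * meval rho 0 m + peval rho p.
Proof. exact: big_cons. Qed.
Lemma paddE rho p q : peval rho (padd p q) = peval rho p + peval rho q.
Proof.
elim: p q => [|[m c] p IH]; first by case=> [|? ?] /=; rewrite peval0 add0r.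
elim=> [|[n d] q IHq]; first by rewrite /= peval0 addr0.
move: IHq; rewrite [padd _ (_ :: q)]/=; set aux := (fix aux q := _) => IHq.
case E: (mcmp m n).
- move/mcmpE: E => <-; rewrite !peval_cons; case: (Z.eqb_spec (c + d) 0) => E.
    by rewrite IH addrACA -mulrDl -zKD E zK0 mul0r add0r.
  by rewrite peval_cons IH zKD; ring.
- by rewrite (peval_cons _ n d (aux q)) IHq !peval_cons; ring.
- by rewrite (peval_cons _ m c (padd _ _)) IH !peval_cons; ring.
Qed.
Lemma pscaleE rho c p : peval rho (pscale c p) = zK c * peval rho p.
Proof.
by rewrite /peval big_map mulr_sumr; apply: eq_bigr => t _ /=; rewrite zKM mulrA.
Qed.
Lemma pmultermE rho t p : peval rho (pmulterm t p) = zK t.2 * meval rho 0 t.1 * peval rho p.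
Proof.
by rewrite /peval big_map mulr_sumr; apply: eq_bigr => u _ /=; rewrite zKM mmulE; ring.
Qed.
Lemma pmulE rho p q : peval rho (pmul p q) = peval rho p * peval rho q.
Proof.
elim: p => [|[m c] p IH] /=; first by rewrite peval0 mul0r.
by rewrite paddE IH pmultermE peval_cons mulrDl.
Qed.
Lemma sum_polyE rho (T : Type) (f : T -> spoly) l : peval rho (sum_poly [seq f t | t <- l]) = \sum_(t <- l)
  peval rho (f t).
Proof. by elim: l => [|t l IH] /=; rewrite ?peval0 ?big_nil // paddE big_cons IH. Qed.
Lemma meval_mvar rho v : meval rho 0 (mvar v) = rho v.
Proof.
suff H k : meval rho k (mvar v) = rho (k + v)%N by rewrite H.
elim: v k => [|v IH] k; rewrite /mvar /= ?expr1 ?mulr1 ?addn0 // expr0 mul1r.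
by rewrite -/(mvar v) IH addnS.
Qed.

Definition sval (s : subst) rho i : K := let: (c, v) := nth (0%ZZ, 0%N) s i in zK c * rho v.
Lemma pvarE s rho i : peval rho (pvar s i) = sval s rho i.
Proof.
rewrite /pvar /sval; case: (nth _ s i) => c v; case: Z.eqb_spec => [->|_]; first by rewrite peval0 zK0 mul0r.
by rewrite peval_cons peval0 addr0 meval_mvar.
Qed.
Definition cubA (th : nat -> K) := Cubic (th 0) (th 1) (th 2) (th 3) (th 4) (th 5) (th 6).
Definition cubB (th : nat -> K) := Cubic (th 7) (th 8) (th 9) (th 10) (th 11) (th 12) (th 13).
Definition pev rho (t : nat * nat * spoly) : nat * nat * K := (t.1.1, t.1.2, peval rho t.2).
Lemma la_sla s rho : la (cubA (sval s rho)) = [seq pev rho t | t <- sla s].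
Proof. by rewrite /la /sla /pev /= !pvarE. Qed.
Lemma lb_slb s rho : lb (cubB (sval s rho)) = [seq pev rho t | t <- slb s].
Proof. by rewrite /lb /slb /pev /= !pvarE. Qed.

Lemma lc_dvd n i : (i <= n)%N -> den n i != 0%ZZ -> (lc n / den n i * den n i)%ZZ = lc n.
Proof.
move=> le ne; have H : Z.divide (den n i) (lc n).
  have: den n i \in [seq e <- [seq den n i | i <- iota 0 n.+1] | ~~ Z.eqb e 0].
    rewrite mem_filter; apply/andP; split; first by apply/negP => /Z.eqb_eq /eqP; apply/negP.
    by apply/mapP; exists i => //; rewrite mem_iota.
  rewrite /lc; elim: [seq e <- _ | _] => [|e l IH] //=; rewrite inE => /orP[/eqP->|/IH].
    exact: Z.divide_lcm_l.
  by move=> H; apply: Z.divide_trans H (Z.divide_lcm_r _ _).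
by case: H => k ->; rewrite Z.div_mul //; apply/eqP.
Qed.

Lemma denE n i : (i <= n)%N -> zK (den n i) = i%:R - (n - i)%:R - 1 :> K.
Proof. by move=> le; rewrite /den -!Z.add_opp_r !zKD !zKN !zK_nat. Qed.
End Eval.

Local Arguments Z.of_nat : simpl never.

(** * Correctness of the computed obstructions *)

Section Loop.
Variable K : numFieldType.
Notation S := (fps (fps K)).
Variables (s : subst) (rho : nat -> K) (F : S) (N : nat).
Notation a := (cubA (sval s rho)).
Notation b := (cubB (sval s rho)).
Hypothesis HE : vf (Xz K + fld a (Xz K) (Xw K)) (- Xw K - fld b (Xw K) (Xz K)) F = F.
Hypothesis HN : forall k, (0 < k <= N)%N -> F k.+1 k = 0.

Definition scaled (L : seq spoly) (D : Z) n := forall i, (i <= n)%N -> peval rho (nth [::] L i) = zK K D *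
  F i (n - i)%N.

Lemma pickE n L1 L2 D d i : (2 <= n)%N -> scaled L1 (lc n.-1 * D)%ZZ n.-1 -> scaled L2 D n.-2 ->
  d \in [:: 2; 3]%N -> (i <= n.+1 - d)%N ->
  peval rho (pick (lc n.-1) L1 L2 d i) = zK K (lc n.-1 * D)%ZZ * F i (n.+1 - d - i)%N.
Proof.
move=> n2 H1 H2; rewrite !inE /pick => /orP[/eqP->|/eqP->] le.
  by rewrite H1; [congr (_ * F _ _); lia | lia].
by rewrite pscaleE H2 ?zKM; [rewrite mulrA; congr (_ * F _ _); lia | lia].
Qed.

Lemma sla_deg t : t \in sla s -> (t.1.1 + t.1.2)%N \in [:: 2; 3]%N.
Proof. by move: t; apply/allP; rewrite /sla /=. Qed.
Lemma slb_deg t : t \in slb s -> (t.1.1 + t.1.2)%N \in [:: 2; 3]%N.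
Proof. by move: t; apply/allP; rewrite /slb /=. Qed.

Lemma rawE n L1 L2 D i : (2 <= n)%N -> (i <= n)%N -> scaled L1 (lc n.-1 * D)%ZZ n.-1 -> scaled L2 D n.-2 ->
  peval rho (raw s n (lc n.-1) L1 L2 i) = - (zK K (lc n.-1 * D)%ZZ * ((i%:R - (n - i)%:R - 1) * F i (n - i)%N)).
Proof.
move=> n2 le H1 H2; have := fld_rec HE i (n - i)%N; rewrite la_sla lb_slb !big_map => /eqP.
rewrite addrC addr_eq0 -mulrN => /eqP E; rewrite -mulrN -mulrN -E.
rewrite paddE pscaleE !sum_polyE (zKN K 1) mulN1r mulrBr !mulr_sumr.
congr (_ - _).
- apply: eq_big_seq => -[[k l] p] /sla_deg /= Hd; rewrite /sA /tA /=.
  case: ifP => // [/andP[Hk Hl]|_]; last by rewrite peval0 mulr0.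
  have d2 : (2 <= k + l)%N by move: Hd; rewrite !inE => /orP[/eqP->|/eqP->].
  rewrite pscaleE pmulE (pickE n2 H1 H2) //; last by lia.
  rewrite zK_nat (_ : n.+1 - (k + l) - (i - k).+1 = n - i - l)%N; first by ring.
  by lia.
- apply: eq_big_seq => -[[k l] p] /slb_deg /= Hd; rewrite /sB /tB /=.
  case: ifP => // [/andP[Hk Hl]|_]; last by rewrite peval0 mulr0.
  have d2 : (2 <= k + l)%N by move: Hd; rewrite !inE => /orP[/eqP->|/eqP->].
  rewrite pscaleE pmulE (pickE n2 H1 H2) //; last by lia.
  rewrite zK_nat (_ : n.+1 - (k + l) - (i - k) = (n - i - l).+1)%N; first by ring.
  by lia.
Qed.

(** Denominators accumulate: in degree n the lists hold the coefficients times the product of all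
    [lc] up to n. *)
Lemma stepE n L1 L2 D : (2 <= n)%N -> (n <= N.*2.+1)%N -> scaled L1 (lc n.-1 * D)%ZZ n.-1 -> scaled L2 D n.-2 ->
  scaled (step s n L1 L2) (lc n * (lc n.-1 * D))%ZZ n.
Proof.
move=> n2 nN H1 H2 i le; rewrite /step (nth_map 0%N) ?size_iota // nth_iota // add0n.
case: Z.eqb_spec => [e0|/eqP e0].
  have -> : F i (n - i)%N = 0.
    have E : i = (n - i).+1 by move: e0; rewrite /den; lia.
    by rewrite [X in F X _]E HN //; lia.
  by rewrite peval0 mulr0.
rewrite pscaleE (rawE n2 le H1 H2) -denE // zKN -[in RHS](lc_dvd le e0) !zKM; ring.
Qed.

Lemma loopE cnt n L1 L2 D : (2 <= n)%N -> (n + cnt <= N.*2.+2)%N ->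
  scaled L1 (lc n.-1 * D)%ZZ n.-1 -> scaled L2 D n.-2 ->
  forall p, p \in loop s cnt n L1 L2 -> peval rho p = 0.
Proof.
elim: cnt n L1 L2 D => [|c IH] n L1 L2 D n2 le H1 H2 p //=; rewrite inE => /orP[/eqP->|].
  case: ifP => on; last exact: peval0.
  rewrite (rawE n2 _ H1 H2); last by lia.
  rewrite (_ : n.+1./2%:R - _ - 1 = 0) ?mul0r ?mulr0 ?oppr0 //.
  by rewrite {1}(_ : n.+1./2 = (n - n.+1./2).+1) -1?natr1; [ring | lia].
apply: (IH n.+1 _ _ (lc n.-1 * D)%ZZ) => //; [by lia | by lia |].
by apply: stepE => //; lia.
Qed.

Lemma obstE p : ord 2 (F - Xz K) -> p \in obst s N -> peval rho p = 0.
Proof.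
move=> HF; have co i j : (i + j < 2)%N -> F i j = Xz K i j.
  by move/HF; rewrite cB => /eqP; rewrite subr_eq0 => /eqP.
apply: (@loopE N.*2 2 _ _ 1%ZZ) => //.
  move=> [|[|i]] // _; rewrite co // cXz /= ?peval0 ?mulr0 //.
  by rewrite peval_cons peval0 addr0.
by move=> [|i] // _; rewrite co // cXz peval0 /= mulr0.
Qed.
End Loop.

(** * Certificates for the case distinction and their checker *)

Local Open Scope nat_scope.

Definition part (d : nat) (p : spoly) : spoly := [seq t <- p | sumn t.1 == d].
(** The shift by 7 exchanges the coefficients of the two equations, so the obstructions to W are
    those to Z for the exchanged system. *)
Definition swp (s : subst) : subst := [seq nth (0%ZZ, 0) s ((i + 7) %% 14) | i <- iota 0 14].

(* Fraction-free Gaussian elimination.  Soundness only needs that the rows vanish at the given point,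
   not that the polynomials are sorted. *)
Fixpoint coef (m : mnm) (p : spoly) : Z :=
  if p is (n, c) :: p' then
    match mcmp m n with Eq => c | Gt => 0%ZZ | Lt => coef m p' end
  else 0%ZZ.
Definition red (p : spoly) (q : mnm * Z * spoly) : spoly :=
  let: (m, l, r) := q in
  let c := coef m p in
  if Z.eqb c 0 then p else
  let g := Z.gcd c l in
  if Z.eqb (l / g) 0 then p else padd (pscale (l / g) p) (pscale (- (c / g)) r).
(** Division by the content, accepted only after multiplying back; it limits the growth of
    coefficients in the elimination. *)
Definition prim (p : spoly) : spoly :=
  let g := foldr (fun t => Z.gcd t.2) 0%ZZ p in
  let p' := [seq (t.1, (t.2 / g)%ZZ) | t <- p] in
  if ~~ Z.eqb g 0 && (pscale g p' == p) then p' else p.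
Definition echelon (rows : seq spoly) : seq (mnm * Z * spoly) :=
  foldl (fun E r => let r' := prim (foldl red r E) in
                    if r' is (m, c) :: _ then rcons E (m, c, r') else E) [::] rows.
Definition in_span (p : spoly) (rows : seq spoly) : bool := nilp (foldl red p (echelon rows)).

Definition wordm (u : seq nat) : mnm := foldr (fun v => mmul (mvar v)) [::] u.
(* Side of the field, index of the obstruction, degree of the homogeneous part, monomial multiplier. *)
Definition row := (nat * nat * nat * seq nat)%type.
Definition rows_at (s : subst) (rs : seq row) : seq spoly :=
  let N := foldr (fun r => maxn r.1.1.2) 0 rs in
  let t0 := if has (fun r => r.1.1.1 == 0) rs then obst s N else [::] in
  let t1 := if has (fun r => r.1.1.1 != 0) rs then obst (swp s) N else [::] in
  [seq pmulterm (wordm r.2, 1%ZZ) (part r.1.2 (nth [::] (if r.1.1.1 == 0 then t0 else t1) (r.1.1.2.*2.-1)))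
    | r <- rs].

Definition zroot := (nat * nat * Z * Z)%type.
Definition rpoly (r : zroot) : spoly :=
  let: (x, y, p, q) := r in padd [:: (mvar x, q)] [:: (mvar y, (- p)%ZZ)].
Definition target (b : seq nat) (rs : seq zroot) : spoly :=
  foldr (fun r => pmul (rpoly r)) [:: (wordm b, 1%ZZ)] rs.

(* [SplitV v] distinguishes whether the variable v vanishes; [SplitR x y p q] whether q x = p y, in which
   case x and y are replaced by p y and q y; [Absurd b rs rows] derives from the rows that the product of
   the variables b and of the linear forms rs, all nonzero on this branch, vanishes; [Leaf c] reaches the
   c-th family. *)
Inductive tree :=
  | Leaf of nat & seq (seq nat * seq row)
  | SplitV of nat & tree & tree
  | SplitR of nat & nat & Z & Z & tree & tree
  | Absurd of seq nat & seq zroot & seq row.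

Definition kill (s : subst) v : subst := [seq if t.2 == v then (0%ZZ, t.2) else t | t <- s].
Definition merge (s : subst) x y p q : subst :=
  [seq (if t.2 == x then ((t.1 * p)%ZZ, y) else if t.2 == y then ((t.1 * q)%ZZ, y) else t) | t <- s].

Definition pone : spoly := [:: ([::], 1%ZZ)].
Fixpoint psubm (s : subst) k (m : mnm) : spoly :=
  if m is e :: m' then pmul (iter e (pmul (pvar s k)) pone) (psubm s k.+1 m') else pone.
Definition psub s (p : spoly) : spoly := foldr (fun t => padd (pscale t.2 (psubm s 0 t.1))) [::] p.

Definition cond := (seq spoly * seq nat)%type.

Section Check.
Variable conds : seq cond.
(** Conditions that the substitution turns into the empty polynomial hold identically. Each other
    one comes with a product of nonvanishing variables whose product with the condition is in the
    span of the cited rows. *)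
Definition check_leaf s (nz : seq nat) c certs : bool :=
  let: (ps, ns) := nth ([::], [::]) conds c in
  let ps' := [seq p <- [seq psub s p | p <- ps] | p != [::]] in
  [&& c < size conds, all (fun i => let: (c, v) := nth (0%ZZ, 0) s i in ~~ Z.eqb c 0 && (v \in nz)) ns,
      size certs == size ps' &
      all (fun t => all (fun v => v \in nz) t.2.1 &&
                    in_span (pmulterm (wordm t.2.1, 1%ZZ) t.1) (rows_at s t.2.2)) (zip ps' certs)].
(** In a branch that performs a substitution the recorded linear forms [nr] are dropped, whereas
    nonvanishing variables are kept, [x] being renamed into [y] when the two are merged. *)
Fixpoint check s nz nr t : bool :=
  match t with
  | Leaf c certs => check_leaf s nz c certs
  | SplitV v t0 t1 => check (kill s v) nz [::] t0 && check s (v :: nz) nr t1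
  | SplitR x y p q t0 t1 =>
      [&& x != y, ~~ Z.eqb q 0, check (merge s x y p q) [seq (if v == x then y else v) | v <- nz] [::] t0 &
          check s nz ((x, y, p, q) :: nr) t1]
  | Absurd b rs rows =>
      [&& all (fun v => v \in nz) b, all (fun r => r \in nr) rs & in_span (target b rs) (rows_at s rows)]
  end.
End Check.

Local Open Scope ring_scope.

(** * Soundness of the checker *)

Section Sound.
Variable K : numFieldType.
Implicit Types rho : nat -> K.

Lemma meval_scale e rho k m : meval (fun i => e * rho i) k m = e ^+ sumn m * meval rho k m.
Proof.
elim: m k => [|x m IH] k /=; first by rewrite mulr1.
by rewrite IH exprMn exprD; ring.
Qed.

Lemma poly_nat0 (p : {poly K}) : (forall n : nat, p.[n%:R] = 0) -> p = 0.
Proof.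
move=> H; apply/eqP/negPn/negP => p0.
have := max_poly_roots (rs := [seq n%:R | n <- iota 0 (size p)]) p0; rewrite size_map size_iota ltnn.
have -> : all (root p) [seq n%:R | n <- iota 0 (size p)] by apply/allP => a /mapP [n _ ->]; apply/rootP/H.
suff -> : uniq [seq (n%:R : K) | n <- iota 0 (size p)] by move=> /(_ isT isT).
by rewrite map_inj_uniq ?iota_uniq // => m n /eqP; rewrite eqr_nat => /eqP.
Qed.

(** Along the line through [rho] the polynomial becomes a polynomial in e whose coefficients are its
    homogeneous parts; it has all natural numbers as roots. *)
Lemma part_eq0 rho d p : (forall e : nat, peval (fun i => e%:R * rho i) p = 0) -> peval rho (part d p) = 0.
Proof.
move=> H; pose P : {poly K} := \sum_(t <- p) (zK K t.2 * meval rho 0 t.1) *: 'X^(sumn t.1).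
have P0 : P = 0.
  apply: poly_nat0 => n; rewrite -[RHS](H n) /P horner_sum; apply: eq_bigr => t _.
  by rewrite hornerZ hornerXn meval_scale; ring.
have := congr1 (fun P : {poly K} => P`_d) P0; rewrite coef0 coef_sum => <-.
rewrite /peval /part big_filter big_mkcond; apply: eq_bigr => t _.
by rewrite coefZ coefXn eq_sym; case: eqP => _; rewrite ?mulr1 ?mulr0.
Qed.

(** A reduction step multiplies [p] by a nonzero integer and subtracts a multiple of a vanishing
    row, so it preserves vanishing in both directions. One direction serves to build the echelon
    rows, the other to conclude from a reduction to zero. *)
Lemma redE rho p m l r : peval rho r = 0 -> (peval rho (red p (m, l, r)) = 0 <-> peval rho p = 0).
Proof.
move=> Hr; rewrite /red; case: ifP => // _; case: ifP => // /negbT a0.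
rewrite paddE !pscaleE Hr mulr0 addr0; split=> [/eqP|->]; last by rewrite mulr0.
by rewrite mulf_eq0 zK_eq0 (negbTE a0) => /eqP.
Qed.
Lemma red_foldE rho p E : (forall q, q \in E -> peval rho q.2 = 0) ->
  (peval rho (foldl red p E) = 0 <-> peval rho p = 0).
Proof.
elim: E p => [|[[m l] r] E IH] p H //=.
rewrite IH => [|q qE]; last by apply: H; rewrite inE qE orbT.
by apply: redE; apply: (H (m, l, r)); rewrite mem_head.
Qed.
Lemma primE rho p : peval rho p = 0 -> peval rho (prim p) = 0.
Proof.
rewrite /prim; set g := foldr _ _ _; case: ifP => // /andP[g0 /eqP {1}<-].
by rewrite pscaleE => /eqP; rewrite mulf_eq0 zK_eq0 (negbTE g0) => /eqP.
Qed.
Lemma echelonE rho rows : (forall p, p \in rows -> peval rho p = 0) ->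
  forall q, q \in echelon rows -> peval rho q.2 = 0.
Proof.
rewrite /echelon; have : forall q, q \in ([::] : seq (mnm * Z * spoly)) -> peval rho q.2 = 0 by [].
elim: rows [::] => [|r rows IH] E HE H //=.
apply: IH => [|p pr]; last by apply: H; rewrite inE pr orbT.
have : peval rho (prim (foldl red r E)) = 0.
  by apply/primE/red_foldE => //; apply: H; rewrite mem_head.
case: (prim _) => [|[m c] r'] H' //.
by move=> q; rewrite mem_rcons inE => /orP[/eqP->|/HE].
Qed.
Lemma in_spanE rho p rows : (forall q, q \in rows -> peval rho q = 0) -> in_span p rows -> peval rho p = 0.
Proof.
move=> H /nilP E; apply/(red_foldE p (echelonE H)); by rewrite E peval0.
Qed.

Lemma wordE rho u : meval rho 0 (wordm u) = \prod_(v <- u) rho v.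
Proof. by elim: u => [|v u IH] /=; rewrite ?big_nil // mmulE meval_mvar IH big_cons. Qed.
Lemma rpolyE rho x y p q : peval rho (rpoly (x, y, p, q)) = zK K q * rho x - zK K p * rho y.
Proof. by rewrite /rpoly paddE !peval_cons !peval0 !addr0 !meval_mvar zKN mulNr. Qed.
Lemma targetE rho b rs : peval rho (target b rs) = (\prod_(r <- rs) peval rho (rpoly r)) * \prod_(v <- b) rho v.
Proof.
elim: rs => [|r rs IH] /=; first by rewrite big_nil mul1r peval_cons peval0 addr0 zK1 mul1r wordE.
by rewrite pmulE IH big_cons mulrA.
Qed.
Lemma psubmE s rho k m : peval rho (psubm s k m) = meval (sval s rho) k m.
Proof.
have one : peval rho pone = 1 by rewrite peval_cons peval0 addr0 zK1 mul1r.
elim: m k => [|e m IH] k //=; rewrite pmulE IH; congr (_ * _).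
by elim: e => [|e IHe] /=; rewrite ?expr0 // pmulE IHe exprS pvarE.
Qed.
Lemma psubE s rho p : peval rho (psub s p) = peval (sval s rho) p.
Proof.
elim: p => [|[m c] p IH] /=; first by rewrite !peval0.
by rewrite paddE pscaleE psubmE IH peval_cons.
Qed.

Definition good (th : nat -> K) := forall e : nat, plin (cubA (fun i => e%:R * th i)) (cubB (fun i => e%:R * th i)).

Lemma sval_scale s e rho i : sval s (fun j => e * rho j) i = e * sval s rho i.
Proof. by rewrite /sval; case: (nth _ _ _) => c v; ring. Qed.

Lemma plin_obst s rho N p : plin (cubA (sval s rho)) (cubB (sval s rho)) -> p \in obst s N -> peval rho p = 0.
Proof.
move=> [Z [W H]]; have [F [HF EF F0]] := normalized_z H N.
exact: (obstE EF F0 HF).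
Qed.

Lemma good_obst s rho N d p : good (sval s rho) -> p \in obst s N ++ obst (swp s) N -> peval rho (part d p) = 0.
Proof.
move=> G Hp; apply: part_eq0 => e; move: Hp; rewrite mem_cat => /orP[] H.
  apply: plin_obst H; have := G e.
  by rewrite (_ : sval s (fun i => e%:R * rho i) = fun i => e%:R * sval s rho i) //; apply/funext => i;
    rewrite sval_scale.
apply: plin_obst H; apply: plin_swap; have := G e.
by rewrite /cubA /cubB !sval_scale /swp /sval /=.
Qed.

Lemma rows_atE s rho rs : good (sval s rho) -> forall p, p \in rows_at s rs -> peval rho p = 0.
Proof.
move=> G p /mapP [r _ ->]; set N := foldr _ _ _.
rewrite pmultermE; set q := nth _ _ _.
suff -> : peval rho (part r.1.2 q) = 0 by rewrite mulr0.
have : q = [::] \/ q \in obst s N ++ obst (swp s) N.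
  rewrite /q; set i := _.-1; set l := if _ then _ else _.
  have : l = [::] \/ l = obst s N \/ l = obst (swp s) N.
    by rewrite /l; do 2 case: ifP => _; auto.
  case: (ltnP i (size l)) => Hi; last by left; rewrite nth_default.
  case=> [E|[E|E]]; first by rewrite E in Hi.
    by right; rewrite mem_cat -E mem_nth.
  by right; rewrite mem_cat -E mem_nth ?orbT.
by case=> [->|]; [rewrite /part /= peval0 | apply: good_obst].
Qed.

Definition sat (th : nat -> K) (c : cond) :=
  (forall p, p \in c.1 -> peval th p = 0) /\ (forall i, i \in c.2 -> th i != 0).

Lemma check_sound conds th : good th -> forall t s nz nr rho,
  th =1 sval s rho -> (forall v, v \in nz -> rho v != 0) ->
  (forall x y p q, (x, y, p, q) \in nr -> zK K q * rho x - zK K p * rho y != 0) ->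
  check conds s nz nr t -> exists2 c, (c < size conds)%N & sat th (nth ([::], [::]) conds c).
Proof.
move=> G; elim=> [c certs|v t0 IH0 t1 IH1|x y p q t0 IH0 t1 IH1|b rs rows] s nz nr rho E Hnz Hnr /=.
- rewrite /check_leaf; case Ec: (nth _ _ _) => [ps ns] /and4P[cs /allP H1 /eqP sz /allP H2].
  have Eth : th = sval s rho by apply/funext.
  exists c; rewrite // Ec; split=> [p pp|i /H1] /=; last first.
    rewrite E /sval; case: (nth _ s i) => a v /andP[a0 /Hnz v0].
    by rewrite mulf_neq0 // zK_eq0.
  rewrite Eth -psubE; case: (eqVneq (psub s p) [::]) => [->|pn0]; first exact: peval0.
  set ps' := [seq p <- _ | _] in sz H2.
  have pp' : psub s p \in ps' by rewrite mem_filter pn0 map_f.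
  have /H2 /andP[/allP /= Hw Hs] : (psub s p, nth ([::], [::]) certs (index (psub s p) ps')) \in zip ps' certs.
    rewrite -[X in (X, _)](nth_index [::] pp') -nth_zip //; apply: mem_nth.
    by rewrite size_zip sz minnn index_mem.
  have := in_spanE (rows_atE _ (rho := rho)) Hs; rewrite -Eth => /(_ G) /eqP.
  rewrite pmultermE /= zK1 mul1r wordE mulf_eq0 => /orP[|/eqP //].
  rewrite prodf_seq_eq0 => /hasP [v /Hw /Hnz v0 /=]; by rewrite (negbTE v0).
- case/andP=> C0 C1; case: (eqVneq (rho v) 0) => v0.
    apply: (IH0 _ _ _ rho _ Hnz _ C0) => // i; rewrite E /sval /kill.
    case: (ltnP i (size s)) => Hi; last by rewrite !nth_default ?size_map.
    rewrite (nth_map (0%ZZ, 0%N)) //; case: (nth _ s i) => a u /=.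
    by case: eqP => [->|] //; rewrite v0 !mulr0.
  apply: (IH1 _ _ _ rho E _ Hnr C1) => u; rewrite inE => /orP[/eqP->|/Hnz] //.
- case/and4P=> xy q0 C0 C1; case: (eqVneq (zK K q * rho x - zK K p * rho y) 0) => H0; last first.
    apply: (IH1 _ _ _ rho E Hnz _ C1) => x' y' p' q'; rewrite inE => /orP[/eqP [-> -> -> ->]|/Hnr] //.
  have q0' : zK K q != 0 by rewrite zK_eq0.
  have ex : rho x = zK K p * (rho y / zK K q).
    by apply: (mulfI q0'); move/eqP: H0; rewrite subr_eq0 => /eqP ->; field.
  have ey : rho y = zK K q * (rho y / zK K q) by field.
  (* The merged variable takes the value rho y / q; then x is p times and y is q times this
     value. *)
  apply: (IH0 _ _ _ (fun v => if v == y then rho y / zK K q else rho v)) C0 => [i|v|] //.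
    rewrite E /sval /merge.
    case: (ltnP i (size s)) => Hi; last first.
      by rewrite !nth_default ?size_map // !zK0 !mul0r.
    rewrite (nth_map (0%ZZ, 0%N)) //; case: (nth _ s i) => a u /=.
    case: eqP => [->|_]; first by rewrite eqxx zKM {1}ex mulrA.
    case: eqP => [->|/eqP/negbTE ne]; first by rewrite eqxx zKM {1}ey mulrA.
    by rewrite ne.
  case/mapP=> u /Hnz u0 ->; case: (eqVneq u x) u0 => [->|_] u0.
    rewrite eqxx; apply: contraNneq u0 => e0; by rewrite ex e0 mulr0.
  by case: (eqVneq u y) => // uy; rewrite -uy mulf_neq0 ?invr_eq0.
- case/and3P=> /allP Hb /allP Hr Hs; exfalso.
  have Eth : th = sval s rho by apply/funext.
  have := in_spanE (rows_atE _ (rho := rho)) Hs; rewrite -Eth => /(_ G) /eqP.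
  rewrite targetE mulf_eq0 => /orP[|]; rewrite prodf_seq_eq0 => /hasP[].
    by move=> [[[x y] p] q] /Hr /Hnr /= /negbTE ne; rewrite rpolyE ne.
  by move=> v /Hb /Hnz /= /negbTE ->.
Qed.
End Sound.

(** * The families as polynomial conditions, and the case distinction *)

Local Open Scope nat_scope.

Definition zeros (l : seq nat) : seq spoly := [seq [:: (mvar i, 1%ZZ)] | i <- l].
Definition rel2 (c : Z) i j (d : Z) k l : spoly := [:: (wordm [:: i; j], c); (wordm [:: k; l], d)].
Arguments rel2 c%_ZZ i j d%_ZZ k l.
Definition lin2 (c : Z) i (d : Z) j : spoly := [:: (mvar i, c); (mvar j, d)].
Arguments lin2 c%_ZZ i d%_ZZ j.

(* Parameters are numbered in the order a20 a11 a02 a30 a21 a12 a03 b20 b11 b02 b30 b21 b12 b03. *)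
Definition cases : seq cond := [seq (zeros [:: 4; 11] ++ c.1, c.2) | c <-
  [:: (zeros [:: 0; 3; 8; 9; 12; 13], [::]);
      (zeros [:: 7; 10; 1; 2; 5; 6], [::]);
      (zeros [:: 1; 2; 5; 6; 8; 10], [::]);
      (zeros [:: 8; 9; 12; 13; 1; 3], [::]);
      (zeros [:: 1; 2; 5; 6; 8; 9; 12; 13], [::]);
      (zeros [:: 1; 8; 2; 6; 13] ++ [:: lin2 1 5 1 10; lin2 1 3 1 12], [::]);
      (zeros [:: 1; 8; 9; 13; 6] ++ [:: lin2 1 3 1 12; lin2 1 5 1 10], [::]);
      (zeros [:: 0; 2; 5; 6; 8; 9; 12; 13] ++ [:: lin2 2 1 (-1) 7], [::]);
      (zeros [:: 7; 9; 12; 13; 1; 2; 5; 6] ++ [:: lin2 2 8 (-1) 0], [::]);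
      (zeros [:: 0; 2; 5; 6; 8; 10; 13] ++ [:: lin2 2 1 1 7; lin2 2 3 1 12], [::]);
      (zeros [:: 7; 9; 12; 13; 1; 3; 6] ++ [:: lin2 1 0 2 8; lin2 1 5 2 10], [::]);
      (zeros [:: 0; 2; 3; 5; 6; 8; 9; 10; 12] ++ [:: lin2 3 1 1 7], [::]);
      (zeros [:: 7; 9; 10; 12; 13; 1; 2; 3; 5] ++ [:: lin2 1 0 3 8], [::]);
      (zeros [:: 0; 2; 3; 6; 8; 9; 12] ++ [:: lin2 3 1 (-1) 7; lin2 3 5 1 10], [::]);
      (zeros [:: 7; 9; 10; 13; 1; 2; 5] ++ [:: lin2 3 8 (-1) 0; lin2 1 3 3 12], [::]);
      (zeros [:: 0; 1; 2; 3; 6; 7; 8; 12; 13] ++ [:: lin2 2 5 1 10], [::]);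
      (zeros [:: 7; 8; 9; 10; 13; 0; 1; 5; 6] ++ [:: lin2 1 3 2 12], [::]);
      (zeros [:: 2; 9; 6; 13] ++ [:: lin2 1 1 1 7; lin2 1 0 1 8; lin2 1 5 1 10; lin2 1 3 1 12;
         [:: (wordm [:: 3; 7; 7], 1%ZZ); (wordm [:: 0; 0; 10], (-1)%ZZ)]], [::]);
      (zeros [:: 3; 5; 6; 10; 12; 13] ++ [:: lin2 7 1 6 7; lin2 6 0 7 8; rel2 7 2 0 (-3) 7 7;
         rel2 (-3) 0 0 7 9 7], [:: 0; 7]);
      (zeros [:: 3; 5; 6; 10; 12; 13] ++ [:: lin2 5 1 2 7; lin2 2 0 5 8; rel2 5 2 0 3 7 7;
         rel2 3 0 0 5 9 7], [:: 0; 7]);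
      (zeros [:: 0; 1; 2; 7; 8; 9] ++ [:: lin2 7 5 3 10; lin2 3 3 7 12; rel2 49 6 13 (-16) 3 10;
         [:: (wordm [:: 6; 3; 3], 1%ZZ); (wordm [:: 13; 10; 10], (-1)%ZZ)]], [:: 3; 10])]].

Definition rt x y (p q : Z) : zroot := (x, y, p, q).
Arguments rt x y p%_ZZ q%_ZZ.
Arguments SplitR _ _ p%_ZZ q%_ZZ _ _.

(** Numbering starts at 0, so [Leaf 18] is (I19). Ratios tested by [SplitR] include those of the
    families, such as 6 a20 = -7 b11 in (I19), 2 a20 = -5 b11 in (I20) and 3 a30 = -7 b12 in (I21);
    others, such as a20 = -4 b11, lead only to contradictions. The two outermost splits use the
    linear parts of the first obstructions, which are multiples of a21 and b21. *)
Definition case_tree : tree :=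
SplitV 4 (SplitV 11 (SplitV 5 (SplitV 10 (SplitV 6 (SplitV 2 (SplitV 1 (SplitV 7 (Leaf 1 [::])
(SplitV 8 (Leaf 2 [::])
(Absurd [::7;8] [::] [::(1,1,2,[::])])))
(SplitR 0 8 (-1) 1 (SplitV 8 (SplitV 12 (SplitV 3 (SplitV 9 (SplitV 13 (Leaf 0 [::])
(SplitR 1 7 (-1) 3 (Leaf 11 [::])
(SplitR 1 7 1 3 (Leaf 13 [::])
(Absurd [::1;1;13] [::rt 1 7 (-1) 3;rt 1 7 1 3] [::(0,3,5,[::])]))))
(SplitR 1 7 (-1) 2 (SplitV 13 (Leaf 9 [::])
(Absurd [::7;7;7;7;13] [::] [::(0,3,5,[::])]))
(Absurd [::1;1;9] [::rt 1 7 (-1) 2] [::(0,2,4,[::])])))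
(SplitR 1 7 1 2 (SplitV 9 (SplitV 13 (Leaf 7 [::])
(Absurd [::7;7;7;7;13] [::] [::(0,3,5,[::])]))
(Absurd [::7;7;7;9] [::] [::(0,2,4,[::])]))
(Absurd [::1;3] [::rt 1 7 1 2] [::(0,2,3,[::])])))
(SplitR 1 7 (-1) 2 (SplitR 3 12 (-1) 2 (SplitV 13 (Leaf 9 [::])
(Absurd [::7;7;7;7;13] [::] [::(0,3,5,[::])]))
(Absurd [::7;7] [::rt 3 12 (-1) 2] [::(0,2,3,[::])]))
(Absurd [::1;12] [::rt 1 7 (-1) 2] [::(1,2,3,[::])])))
(SplitR 1 7 (-1) 1 (SplitV 9 (SplitV 12 (SplitV 3 (SplitV 13 (Leaf 17 [::])
(Absurd [::7;7;7;7;13] [::] [::(0,3,5,[::])]))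
(Absurd [::3;7;7] [::] [::(0,2,3,[::])]))
(Absurd [::7;7;12] [::] [::(1,2,3,[::])]))
(Absurd [::7;7;7;9] [::] [::(0,2,4,[::])]))
(Absurd [::8] [::rt 1 7 (-1) 1] [::(1,1,2,[::])])))
(Absurd [::1] [::rt 0 8 (-1) 1] [::(0,1,2,[::])])))
(SplitV 12 (SplitV 3 (SplitV 7 (SplitV 9 (SplitV 8 (SplitV 0 (SplitV 1 (SplitV 13 (Leaf 0 [::]) (Absurd [::2;
2;2;2;13;13;13] [::] [::(0,5,7,[::])]))
(SplitV 13 (Leaf 0 [::])
(Absurd [::1;2;13] [::] [::(0,2,3,[::])])))
(SplitV 1 (SplitV 13 (Leaf 3 [::])
(Absurd [::0;0;2;2;13] [::] [::(0,3,5,[::])]))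
(Absurd [::0;1] [::] [::(0,1,2,[::])])))
(SplitR 0 8 (-2) 1 (SplitV 1 (SplitV 13 (Leaf 10 [::])
(Absurd [::2;2;8;8;13] [::] [::(0,3,5,[::])]))
(Absurd [::1;8] [::] [::(0,1,2,[::])]))
(Absurd [::2;8;8] [::rt 0 8 (-2) 1] [::(1,1,2,[::1;8]);(1,1,2,[::0;1]);(1,2,4,[::])])))
(Absurd [::2;2;2;9;9;9] [::] [::(1,1,2,[::2;8;8;8]);(1,1,2,[::2;2;9;9]);(1,1,2,[::1;2;8;9]);(1,1,2,[::1;1;8;
8]);(1,1,2,[::1;1;1;9]);(1,1,2,[::0;2;8;8]);(1,1,2,[::0;1;2;9]);(1,1,2,[::0;1;1;8]);(1,1,2,[::0;0;2;8]);
(1,1,2,[::0;0;1;1]);(1,1,2,[::0;0;0;2]);(0,1,2,[::2;8;8;8]);(0,1,2,[::2;2;9;9]);(0,1,2,[::1;1;1;9]);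
(0,1,2,[::0;2;8;8]);(0,1,2,[::0;1;2;9]);(0,1,2,[::0;0;2;8]);(1,2,4,[::2;9]);(0,2,4,[::2;9]);(1,3,6,[::])]))
(SplitV 13 (SplitV 9 (SplitV 8 (SplitV 0 (Leaf 0 [::])
(SplitV 1 (Leaf 3 [::])
(Absurd [::0;1] [::] [::(0,1,2,[::])])))
(Absurd [::2;7;8;8;8;8] [::] [::(0,1,2,[::7;7;8;8]);(0,1,2,[::2;8;8;8]);(0,1,2,[::1;7;8;8]);(1,1,2,[::7;7;8;
8]);(1,1,2,[::2;8;8;8]);(1,1,2,[::1;7;8;8]);(1,1,2,[::0;7;7;8]);(1,1,2,[::0;2;8;8]);(1,2,4,[::7;8])]))
(SplitR 0 8 (-7) 6 (SplitR 1 7 (-6) 7 (SplitV 8 (Absurd [::2;9] [::] [::(0,1,2,[::])]) (Leaf 18 [::([::7;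
9],[::(0,1,2,[::7;8]);(0,2,4,[::]);(1,2,4,[::])]);([::2;8],[::(0,1,2,[::7;8]);(0,2,4,[::]);(1,2,4,[::])])]))
(Absurd [::2;9] [::rt 1 7 (-6) 7] [::(0,1,2,[::7]);(0,1,2,[::1]);(1,1,2,[::1])]))
(SplitR 0 8 (-5) 2 (SplitR 1 7 (-2) 5 (SplitV 8 (Absurd [::2;9] [::] [::(0,1,2,[::])]) (Leaf 19 [::([::2;7;9;
9],[::(0,1,2,[::7;7;8;8]);(0,1,2,[::7;7;7;9]);(0,1,2,[::2;8;8;8]);(0,1,2,[::2;7;8;9]);(0,2,4,[::7;8]);
(0,3,6,[::])]);([::2;2;8;9],[::(0,1,2,[::7;7;8;8]);(0,1,2,[::7;7;7;9]);(0,1,2,[::2;8;8;8]);(0,1,2,[::2;7;8;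
9]);(0,2,4,[::7;8]);(0,3,6,[::])])]))
(Absurd [::2;9] [::rt 1 7 (-2) 5] [::(0,1,2,[::7]);(0,1,2,[::1]);(1,1,2,[::1])]))
(Absurd [::2;2;7;7;9;9] [::rt 0 8 (-7) 6;rt 0 8 (-5) 2] [::(0,1,2,[::7;7;7;8;8;8]);(0,1,2,[::7;7;7;7;8;9]);
(0,1,2,[::2;7;8;8;8;8]);(0,1,2,[::2;7;7;8;8;9]);(0,1,2,[::2;7;7;7;9;9]);(0,1,2,[::2;2;8;8;8;9]);(0,1,2,[::2;2;
7;8;9;9]);(0,1,2,[::2;2;2;9;9;9]);(0,1,2,[::1;7;7;8;8;8]);(0,1,2,[::1;7;7;7;8;9]);(0,1,2,[::1;2;8;8;8;8]);
(0,1,2,[::1;2;7;8;8;9]);(0,1,2,[::1;2;7;7;9;9]);(0,1,2,[::1;2;2;8;9;9]);(0,1,2,[::1;1;7;8;8;8]);(0,1,2,[::1;1;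
7;7;8;9]);(0,1,2,[::1;1;2;8;8;9]);(0,1,2,[::1;1;2;7;9;9]);(0,1,2,[::1;1;1;8;8;8]);(0,1,2,[::1;1;1;7;8;9]);
(0,1,2,[::1;1;1;2;9;9]);(0,1,2,[::1;1;1;1;8;9]);(0,1,2,[::0;7;7;7;8;8]);(0,1,2,[::0;7;7;7;7;9]);(0,1,2,[::0;2;
7;8;8;8]);(0,1,2,[::0;2;7;7;8;9]);(0,1,2,[::0;2;2;8;8;9]);(0,1,2,[::0;2;2;7;9;9]);(0,1,2,[::0;1;7;7;8;8]);
(0,1,2,[::0;1;7;7;7;9]);(0,1,2,[::0;1;2;8;8;8]);(0,1,2,[::0;1;2;7;8;9]);(0,1,2,[::0;1;2;2;9;9]);(0,1,2,[::0;1;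
1;7;8;8]);(0,1,2,[::0;1;1;7;7;9]);(0,1,2,[::0;1;1;2;8;9]);(0,1,2,[::0;1;1;1;8;8]);(0,1,2,[::0;1;1;1;7;9]);
(0,1,2,[::0;1;1;1;1;9]);(0,1,2,[::0;0;7;7;7;8]);(0,1,2,[::0;0;2;7;8;8]);(0,1,2,[::0;0;2;7;7;9]);(0,1,2,[::0;0;
2;2;8;9]);(0,1,2,[::0;0;1;7;7;8]);(0,1,2,[::0;0;1;2;8;8]);(0,1,2,[::0;0;1;2;7;9]);(0,1,2,[::0;0;1;1;7;8]);
(0,1,2,[::0;0;1;1;2;9]);(0,1,2,[::0;0;1;1;1;8]);(0,1,2,[::0;0;0;7;7;7]);(0,1,2,[::0;0;0;2;7;8]);(0,1,2,[::0;0;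
0;2;2;9]);(0,1,2,[::0;0;0;1;7;7]);(0,1,2,[::0;0;0;1;2;8]);(0,1,2,[::0;0;0;1;1;7]);(0,1,2,[::0;0;0;1;1;1]);
(0,1,2,[::0;0;0;0;2;7]);(0,1,2,[::0;0;0;0;1;2]);(1,1,2,[::7;7;7;8;8;8]);(1,1,2,[::2;7;8;8;8;8]);(1,1,2,[::2;7;
7;8;8;9]);(1,1,2,[::2;7;7;7;9;9]);(1,1,2,[::2;2;8;8;8;9]);(1,1,2,[::2;2;7;8;9;9]);(1,1,2,[::2;2;2;9;9;9]);
(1,1,2,[::1;7;7;8;8;8]);(1,1,2,[::1;7;7;7;8;9]);(1,1,2,[::1;2;8;8;8;8]);(1,1,2,[::1;2;7;8;8;9]);(1,1,2,[::1;2;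
7;7;9;9]);(1,1,2,[::1;2;2;8;9;9]);(1,1,2,[::1;1;7;8;8;8]);(1,1,2,[::1;1;7;7;8;9]);(1,1,2,[::1;1;2;8;8;9]);
(1,1,2,[::1;1;2;7;9;9]);(1,1,2,[::1;1;1;8;8;8]);(1,1,2,[::1;1;1;7;8;9]);(1,1,2,[::1;1;1;2;9;9]);(1,1,2,[::1;1;
1;1;8;9]);(1,1,2,[::0;7;7;7;8;8]);(1,1,2,[::0;2;7;8;8;8]);(1,1,2,[::0;2;7;7;8;9]);(1,1,2,[::0;2;2;8;8;9]);
(1,1,2,[::0;2;2;7;9;9]);(1,1,2,[::0;0;7;7;7;8]);(1,1,2,[::0;0;2;7;8;8]);(1,1,2,[::0;0;2;7;7;9]);(1,1,2,[::0;0;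
2;2;8;9]);(1,1,2,[::0;0;0;7;7;7]);(1,1,2,[::0;0;0;2;7;8]);(1,1,2,[::0;0;0;2;2;9]);(1,1,2,[::0;0;0;0;2;7]);
(0,2,4,[::7;7;8;8]);(0,2,4,[::7;7;7;9]);(0,2,4,[::2;8;8;8]);(0,2,4,[::2;7;8;9]);(0,2,4,[::2;2;9;9]);
(0,2,4,[::1;7;7;9]);(0,2,4,[::1;1;7;9]);(0,2,4,[::1;1;1;9]);(0,2,4,[::0;7;7;8]);(0,2,4,[::0;2;8;8]);
(0,2,4,[::0;0;7;7]);(0,2,4,[::0;0;2;8]);(0,2,4,[::0;0;0;2]);(1,2,4,[::7;7;8;8]);(1,2,4,[::2;8;8;8]);
(1,2,4,[::2;7;8;9]);(1,2,4,[::2;2;9;9]);(1,2,4,[::1;7;7;9]);(1,2,4,[::1;1;7;9]);(1,2,4,[::1;1;1;9]);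
(1,2,4,[::0;7;7;8]);(1,2,4,[::0;2;8;8]);(1,2,4,[::0;0;7;7]);(0,3,6,[::7;8]);(0,3,6,[::2;9]);(0,3,6,[::0;7]);
(0,4,8,[::])]))))
(Absurd [::2;7;13] [::] [::(0,2,3,[::]);(1,2,3,[::])])))
(Absurd [::2;2;3;3;3] [::] [::(0,4,5,[::])]))
(SplitR 3 12 (-2) 1 (SplitV 7 (SplitV 9 (SplitV 13 (SplitR 0 8 (-7) 2 (SplitV 8 (SplitV 1 (Leaf 16 [::])
(Absurd [::1;1;12] [::] [::(0,2,3,[::])]))
(Absurd [::2;8;8;8] [::] [::(0,1,2,[::1;8]);(0,2,4,[::])]))
(Absurd [::2;12] [::rt 0 8 (-7) 2] [::(1,2,3,[::]);(0,2,3,[::])]))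
(Absurd [::2;2;12;13] [::] [::(0,3,4,[::]);(1,3,4,[::])]))
(Absurd [::2;2;2;9;9;9] [::] [::(1,1,2,[::2;8;8;8]);(1,1,2,[::2;2;9;9]);(1,1,2,[::1;2;8;9]);(1,1,2,[::1;1;8;
8]);(1,1,2,[::1;1;1;9]);(1,1,2,[::0;2;8;8]);(1,1,2,[::0;1;2;9]);(1,1,2,[::0;1;1;8]);(1,1,2,[::0;0;2;8]);
(1,1,2,[::0;0;1;1]);(1,1,2,[::0;0;0;2]);(0,1,2,[::2;8;8;8]);(0,1,2,[::2;2;9;9]);(0,1,2,[::1;1;1;9]);
(0,1,2,[::0;2;8;8]);(0,1,2,[::0;1;2;9]);(0,1,2,[::0;0;2;8]);(1,2,4,[::2;9]);(0,2,4,[::2;9]);(1,3,6,[::])]))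
(Absurd [::2;7;7;7;12;12] [::] [::(0,1,2,[::2;2;12;12]);(1,1,2,[::2;2;12;12]);(1,2,3,[::2;7;12]);(1,2,3,[::1;
2;12]);(0,2,3,[::1;2;12]);(0,3,4,[::7;7]);(0,3,4,[::2;8]);(0,3,4,[::1;7]);(0,3,4,[::1;1]);(1,3,4,[::7;7]);
(1,3,4,[::2;8]);(1,3,4,[::1;7])]))
(SplitR 3 12 (-1) 1 (SplitV 13 (SplitV 1 (SplitV 9 (SplitV 8 (Leaf 6 [::])
(Absurd [::2;8;12] [::] [::(0,2,3,[::])]))
(Absurd [::2;9] [::] [::(0,1,2,[::])]))
(Absurd [::1;2;12;12] [::] [::(1,3,4,[::])]))
(Absurd [::2;2;12;13] [::] [::(0,3,4,[::])]))
(Absurd [::2;2;12] [::rt 3 12 (-2) 1;rt 3 12 (-1) 1] [::(1,4,5,[::])])))))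
(SplitV 13 (SplitV 12 (SplitV 3 (SplitV 8 (SplitV 2 (SplitV 0 (SplitV 7 (SplitV 1 (SplitV 9 (Leaf 0 [::])
(Absurd [::6;6;6;9;9;9;9] [::] [::(0,5,7,[::])]))
(SplitV 9 (Leaf 0 [::])
(Absurd [::1;1;1;9] [::] [::(0,2,4,[::])])))
(SplitV 9 (Leaf 0 [::])
(Absurd [::6;6;7;9;9;9] [::] [::(0,4,6,[::]);(1,4,6,[::])])))
(SplitV 1 (SplitV 9 (Leaf 3 [::])
(Absurd [::0;6;9] [::] [::(0,2,3,[::])]))
(Absurd [::0;1] [::] [::(0,1,2,[::])])))
(SplitV 9 (SplitV 0 (Leaf 0 [::])
(SplitV 1 (Leaf 3 [::])
(Absurd [::0;1] [::] [::(0,1,2,[::])])))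
(Absurd [::2;9] [::] [::(1,1,2,[::])])))
(SplitV 9 (SplitR 1 7 (-1) 1 (SplitV 7 (SplitR 0 8 (-3) 1 (SplitV 2 (Leaf 12 [::])
(Absurd [::2;8;8;8] [::] [::(0,2,4,[::])]))
(SplitR 0 8 3 1 (SplitV 2 (Leaf 14 [::])
(Absurd [::2;8;8;8] [::] [::(0,2,4,[::])]))
(Absurd [::6;8;8] [::rt 0 8 (-3) 1;rt 0 8 3 1] [::(1,3,5,[::])])))
(Absurd [::6;7;8;8;8;8;8] [::] [::(0,1,2,[::6;8;8;8;8]);(0,1,2,[::0;6;8;8;8]);(1,3,5,[::7;8])]))
(Absurd [::8] [::rt 1 7 (-1) 1] [::(1,1,2,[::])]))
(Absurd [::6;8;9] [::] [::(0,2,3,[::]);(1,2,3,[::])])))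
(Absurd [::3;3;6] [::] [::(0,3,3,[::])]))
(SplitR 3 12 (-3) 1 (SplitV 7 (SplitV 1 (SplitV 9 (SplitV 2 (SplitV 8 (SplitV 0 (Leaf 14 [::])
(Absurd [::0;0;6;12] [::] [::(0,3,4,[::])]))
(SplitR 0 8 3 1 (Leaf 14 [::])
(Absurd [::6;8;12] [::rt 0 8 3 1] [::(1,3,4,[::])])))
(Absurd [::2;2;12;12;12] [::] [::(0,4,5,[::])]))
(Absurd [::6;6;9;9;12] [::] [::(0,1,2,[::6;12;12]);(0,4,5,[::]);(1,4,5,[::])]))
(Absurd [::1;1;1;1;12;12] [::] [::(1,1,2,[::6;8;8;12]);(1,1,2,[::1;6;9;12]);(1,1,2,[::1;2;12;12]);(1,1,2,[::0;
6;8;12]);(0,1,2,[::6;8;8;12]);(0,1,2,[::1;6;9;12]);(0,1,2,[::1;2;12;12]);(1,2,3,[::2;8;12]);(1,2,3,[::1;1;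
12]);(0,2,3,[::1;1;12]);(1,3,4,[::2;9])]))
(SplitV 8 (SplitV 9 (SplitV 1 (SplitV 2 (SplitV 0 (Absurd [::6;7;7;12;12;12] [::] [::(0,5,6,[::])])
(Absurd [::0;0;6;12] [::] [::(0,3,4,[::])]))
(Absurd [::2;7;12;12] [::] [::(1,3,4,[::])]))
(Absurd [::1;7;7;7;12;12] [::] [::(0,1,2,[::2;7;12;12]);(1,2,3,[::7;7;12]);(1,2,3,[::1;7;12]);(0,2,3,[::1;7;
12])]))
(Absurd [::6;6;7;9;9;9] [::] [::(1,1,2,[::6;7;9;12]);(1,1,2,[::2;7;12;12]);(1,1,2,[::1;6;9;12]);(1,1,2,[::1;2;
12;12]);(1,1,2,[::0;0;6;12]);(0,1,2,[::6;7;9;12]);(0,1,2,[::2;7;12;12]);(0,1,2,[::1;6;9;12]);(0,1,2,[::1;2;12;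
12]);(0,1,2,[::0;0;6;12]);(1,2,3,[::7;7;12]);(1,2,3,[::1;7;12]);(1,2,3,[::1;1;12]);(1,2,3,[::0;6;9]);
(0,2,3,[::7;7;12]);(0,2,3,[::1;7;12]);(0,2,3,[::0;2;12]);(1,3,4,[::0;7]);(0,3,4,[::0;7]);(1,4,6,[::]);
(0,4,6,[::])]))
(Absurd [::6;7;7;8;8;12] [::] [::(0,1,2,[::6;7;8;12]);(0,1,2,[::6;6;9;9]);(0,1,2,[::2;6;9;12]);(0,1,2,[::2;2;
12;12]);(0,1,2,[::1;6;8;12]);(0,1,2,[::0;6;7;12]);(0,1,2,[::0;1;6;12]);(1,1,2,[::6;7;8;12]);(1,1,2,[::6;6;9;
9]);(1,1,2,[::2;6;9;12]);(1,1,2,[::2;2;12;12]);(1,1,2,[::1;6;8;12]);(1,1,2,[::0;6;7;12]);(1,2,3,[::6;8;8]);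
(1,2,3,[::6;7;9]);(1,2,3,[::2;7;12]);(1,2,3,[::1;6;9]);(1,2,3,[::1;2;12]);(1,2,3,[::0;6;8]);(1,2,3,[::0;0;6]);
(0,2,3,[::6;8;8]);(0,2,3,[::6;7;9]);(0,2,3,[::2;7;12]);(0,2,3,[::1;6;9]);(0,2,3,[::1;2;12]);(0,2,3,[::0;6;8]);
(0,2,3,[::0;0;6]);(0,2,4,[::6;12]);(1,2,4,[::6;12]);(1,3,4,[::2;8]);(1,3,4,[::1;7]);(1,3,4,[::1;1]);
(1,3,4,[::0;2]);(0,3,4,[::2;8]);(0,3,4,[::1;7]);(0,3,4,[::1;1]);(0,3,4,[::0;2])])))
(Absurd [::6;12] [::rt 3 12 (-3) 1] [::(1,3,3,[::])])))
(Absurd [::6;13] [::] [::(0,2,2,[::])])))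
(SplitV 12 (SplitV 13 (SplitV 3 (SplitV 9 (SplitV 1 (SplitV 8 (Leaf 3 [::])
(SplitR 0 8 2 1 (SplitV 7 (SplitV 2 (SplitV 6 (Leaf 8 [::])
(Absurd [::6;8;8;8;8] [::] [::(0,3,5,[::])]))
(Absurd [::2;8;8;8] [::] [::(0,2,4,[::])]))
(Absurd [::7;8] [::] [::(1,1,2,[::])]))
(Absurd [::8;10] [::rt 0 8 2 1] [::(1,2,3,[::])])))
(SplitR 0 8 (-1) 1 (SplitV 8 (Leaf 0 [::])
(Absurd [::8;8;10] [::] [::(1,2,3,[::])]))
(Absurd [::1] [::rt 0 8 (-1) 1] [::(0,1,2,[::])])))
(Absurd [::9;9;10;10;10] [::] [::(1,4,5,[::])]))
(SplitV 6 (SplitV 7 (SplitV 1 (SplitV 2 (SplitV 9 (SplitV 8 (Leaf 4 [::])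
(SplitR 0 8 2 1 (Leaf 8 [::])
(Absurd [::8;10] [::rt 0 8 2 1] [::(1,2,3,[::])])))
(Absurd [::9;9;10;10;10] [::] [::(1,2,3,[::3;10]);(1,4,5,[::])]))
(SplitR 0 8 (-4) 1 (SplitV 9 (SplitV 8 (Absurd [::2;2;3;3;3] [::] [::(0,4,5,[::])])
(Absurd [::2;8;8;8] [::] [::(0,2,4,[::])]))
(Absurd [::2;9] [::] [::(0,1,2,[::])]))
(Absurd [::2;3] [::rt 0 8 (-4) 1] [::(0,2,3,[::])])))
(Absurd [::1;1;1;1;3;3] [::] [::(1,1,2,[::8;9;10;10]);(1,1,2,[::2;3;9;10]);(1,1,2,[::1;3;8;10]);(1,1,2,[::1;2;
3;3]);(1,1,2,[::0;1;3;10]);(0,1,2,[::8;9;10;10]);(0,1,2,[::2;3;9;10]);(0,1,2,[::1;2;3;3]);(0,1,2,[::0;1;3;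
10]);(0,2,3,[::8;8;10]);(0,2,3,[::1;9;10]);(0,2,3,[::1;1;3]);(0,2,3,[::0;8;10]);(1,2,3,[::1;9;10]);
(1,2,3,[::1;1;3]);(1,2,4,[::3;10]);(0,2,4,[::3;10]);(0,3,4,[::2;9])]))
(SplitV 8 (SplitV 9 (SplitV 2 (SplitV 1 (Leaf 4 [::])
(SplitR 1 7 1 2 (SplitV 0 (Leaf 7 [::])
(Absurd [::0;7] [::] [::(0,1,2,[::])]))
(Absurd [::1;3] [::rt 1 7 1 2] [::(0,2,3,[::])])))
(SplitR 1 7 2 7 (SplitV 0 (Absurd [::3;7;7] [::] [::(0,2,3,[::])])
(Absurd [::0;7] [::] [::(0,1,2,[::])]))
(Absurd [::2;3;3] [::rt 1 7 2 7] [::(0,1,2,[::3;10]);(0,3,4,[::])])))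
(Absurd [::7;7;7;7;9;9;10] [::] [::(1,1,2,[::0;7;7;9;10]);(1,1,2,[::0;1;7;9;10]);(1,2,3,[::7;7;7;9]);
(1,2,3,[::1;7;7;9]);(1,2,3,[::1;1;7;9]);(1,2,4,[::7;9;10])]))
(Absurd [::7;8;8;8;8;8;10] [::] [::(0,1,2,[::8;8;8;8;10]);(0,1,2,[::7;8;8;9;10]);(0,1,2,[::7;7;9;9;10]);
(0,1,2,[::3;7;7;8;8]);(0,1,2,[::3;7;7;7;9]);(0,1,2,[::2;8;9;9;10]);(0,1,2,[::2;3;8;8;8]);(0,1,2,[::2;3;7;8;
9]);(0,1,2,[::2;2;3;9;9]);(0,1,2,[::1;8;8;9;10]);(0,1,2,[::1;7;9;9;10]);(0,1,2,[::1;3;7;8;8]);(0,1,2,[::1;3;7;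
7;9]);(0,1,2,[::1;2;3;8;9]);(0,1,2,[::1;1;9;9;10]);(0,1,2,[::1;1;3;8;8]);(0,1,2,[::1;1;3;7;9]);(0,1,2,[::1;1;
1;3;9]);(0,1,2,[::0;8;8;8;10]);(0,1,2,[::0;7;8;9;10]);(0,1,2,[::0;3;7;7;8]);(0,1,2,[::0;2;9;9;10]);
(0,1,2,[::0;2;3;8;8]);(0,1,2,[::0;2;3;7;9]);(0,1,2,[::0;1;8;9;10]);(0,1,2,[::0;1;3;7;8]);(0,1,2,[::0;1;2;3;
9]);(0,1,2,[::0;1;1;3;8]);(0,1,2,[::0;0;8;8;10]);(0,1,2,[::0;0;7;9;10]);(0,1,2,[::0;0;3;7;7]);(0,1,2,[::0;0;2;
3;8]);(0,1,2,[::0;0;1;9;10]);(0,1,2,[::0;0;1;3;7]);(0,1,2,[::0;0;0;8;10]);(1,1,2,[::8;8;8;8;10]);(1,1,2,[::7;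
8;8;9;10]);(1,1,2,[::7;7;9;9;10]);(1,1,2,[::3;7;7;8;8]);(1,1,2,[::2;8;9;9;10]);(1,1,2,[::2;3;8;8;8]);
(1,1,2,[::2;3;7;8;9]);(1,1,2,[::2;2;3;9;9]);(1,1,2,[::1;8;8;9;10]);(1,1,2,[::1;7;9;9;10]);(1,1,2,[::1;3;7;8;
8]);(1,1,2,[::1;3;7;7;9]);(1,1,2,[::1;2;3;8;9]);(1,1,2,[::1;1;9;9;10]);(1,1,2,[::1;1;3;8;8]);(1,1,2,[::1;1;3;
7;9]);(1,1,2,[::1;1;1;3;9]);(1,1,2,[::0;8;8;8;10]);(1,1,2,[::0;7;8;9;10]);(1,1,2,[::0;3;7;7;8]);(1,1,2,[::0;2;
9;9;10]);(1,1,2,[::0;2;3;8;8]);(1,1,2,[::0;2;3;7;9]);(1,1,2,[::0;0;8;8;10]);(1,1,2,[::0;0;7;9;10]);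
(1,1,2,[::0;0;3;7;7]);(1,1,2,[::0;0;2;3;8]);(1,1,2,[::0;0;0;8;10]);(0,2,3,[::7;8;8;8]);(0,2,3,[::7;7;8;9]);
(0,2,3,[::2;8;8;9]);(0,2,3,[::2;7;9;9]);(0,2,3,[::1;2;9;9]);(0,2,3,[::0;7;8;8]);(0,2,3,[::0;7;7;9]);
(0,2,3,[::0;0;7;8]);(1,2,3,[::7;8;8;8]);(1,2,3,[::7;7;8;9]);(1,2,3,[::2;8;8;9]);(1,2,3,[::2;7;9;9]);
(1,2,3,[::1;2;9;9]);(1,2,3,[::0;7;8;8]);(1,2,3,[::0;0;7;8]);(0,2,4,[::8;9;10]);(0,2,4,[::3;7;8]);(0,2,4,[::2;
3;9]);(0,2,4,[::0;9;10]);(0,2,4,[::0;3;7]);(1,2,4,[::8;9;10]);(1,2,4,[::3;7;8]);(1,2,4,[::2;3;9]);(1,2,4,[::0;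
9;10]);(1,2,4,[::0;3;7]);(0,3,5,[::8;8]);(0,3,5,[::7;9]);(0,3,5,[::1;9]);(0,3,5,[::0;8]);(1,3,5,[::8;8])])))
(Absurd [::3;3;6] [::] [::(0,3,3,[::])])))
(Absurd [::10;10;13] [::] [::(1,3,3,[::])]))
(Absurd [::10;12] [::] [::(0,2,2,[::]);(1,2,2,[::])])))
(SplitR 3 12 (-7) 3 (SplitV 12 (SplitV 13 (SplitV 9 (SplitV 1 (SplitV 8 (Leaf 3 [::])
(SplitR 0 8 (-2) 1 (SplitV 7 (SplitR 5 10 (-2) 1 (SplitV 6 (Leaf 10 [::])
(Absurd [::6;8;8;8;8] [::] [::(0,3,5,[::])]))
(Absurd [::8;8] [::rt 5 10 (-2) 1] [::(1,2,3,[::])]))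
(Absurd [::7;8] [::] [::(1,1,2,[::])]))
(Absurd [::5;8] [::rt 0 8 (-2) 1] [::(0,2,3,[::])])))
(SplitR 0 8 (-1) 1 (SplitV 8 (Leaf 0 [::])
(Absurd [::5;8;8] [::] [::(0,2,3,[::])]))
(Absurd [::1] [::rt 0 8 (-1) 1] [::(0,1,2,[::])])))
(SplitR 5 10 (-1) 1 (SplitV 8 (SplitV 2 (SplitV 6 (SplitV 1 (Leaf 5 [::])
(Absurd [::1;9;10] [::] [::(0,2,3,[::])]))
(Absurd [::6;9;9;10] [::] [::(0,3,4,[::])]))
(Absurd [::2;9] [::] [::(1,1,2,[::])]))
(Absurd [::8;9;10;10] [::] [::(1,3,4,[::]);(0,3,4,[::])]))
(SplitR 5 10 (-1) 2 (SplitV 7 (SplitV 2 (SplitV 1 (SplitV 8 (SplitV 6 (SplitV 0 (Leaf 15 [::])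
(Absurd [::0;9;10;10] [::] [::(0,3,4,[::])]))
(Absurd [::6;9;9;10] [::] [::(0,3,4,[::]);(1,3,4,[::])]))
(Absurd [::8;8;8;8;10;10] [::] [::(0,2,3,[::8;8;10]);(0,2,3,[::6;8;9]);(0,2,3,[::0;8;10]);(0,2,3,[::0;6;9]);
(0,2,3,[::0;0;10]);(1,2,3,[::8;8;10]);(1,2,3,[::6;8;9]);(1,2,3,[::0;8;10]);(1,2,3,[::0;0;10]);(0,4,6,[::]);
(1,4,6,[::])]))
(Absurd [::1;1;1;9] [::] [::(1,1,2,[::1;8]);(1,1,2,[::0;1]);(1,2,4,[::])]))
(Absurd [::2;2;2;9;9;9] [::] [::(1,1,2,[::2;8;8;8]);(1,1,2,[::2;2;9;9]);(1,1,2,[::1;2;8;9]);(1,1,2,[::1;1;8;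
8]);(1,1,2,[::1;1;1;9]);(1,1,2,[::0;2;8;8]);(1,1,2,[::0;1;2;9]);(1,1,2,[::0;1;1;8]);(1,1,2,[::0;0;2;8]);
(1,1,2,[::0;0;1;1]);(1,1,2,[::0;0;0;2]);(0,1,2,[::2;8;8;8]);(0,1,2,[::2;2;9;9]);(0,1,2,[::1;1;1;9]);
(0,1,2,[::0;2;8;8]);(0,1,2,[::0;1;2;9]);(0,1,2,[::0;0;2;8]);(1,2,4,[::2;9]);(0,2,4,[::2;9]);(1,3,6,[::])]))
(Absurd [::7;7;9;9;10;10] [::] [::(0,1,2,[::8;9;10;10]);(0,1,2,[::6;9;9;10]);(1,1,2,[::8;9;10;10]);
(1,1,2,[::6;9;9;10]);(1,1,2,[::0;9;10;10]);(0,2,3,[::7;9;10]);(0,2,3,[::1;9;10]);(1,2,3,[::7;9;10]);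
(1,2,3,[::1;9;10]);(0,3,4,[::7;8]);(0,3,4,[::2;9]);(0,3,4,[::0;7]);(1,3,4,[::7;8]);(1,3,4,[::2;9]);
(1,3,4,[::0;7])]))
(Absurd [::5;9;9] [::rt 5 10 (-1) 1;rt 5 10 (-1) 2] [::(0,4,5,[::])]))))
(SplitR 5 10 (-1) 3 (SplitV 6 (SplitV 8 (SplitV 2 (SplitV 9 (SplitV 7 (SplitV 1 (SplitV 0 (Leaf 13 [::])
(Absurd [::0;0;10;10;10;13] [::] [::(0,5,6,[::])]))
(Absurd [::1;1;1;1;13] [::] [::(1,3,5,[::])]))
(SplitR 1 7 1 3 (SplitV 0 (Leaf 13 [::])
(Absurd [::0;7] [::] [::(0,1,2,[::])]))
(Absurd [::7;10;13] [::rt 1 7 1 3] [::(0,3,4,[::]);(1,3,4,[::])])))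
(Absurd [::9;9;10;10;10] [::] [::(0,1,2,[::10;10;13]);(0,4,5,[::]);(1,4,5,[::])]))
(SplitV 9 (SplitV 7 (SplitV 1 (SplitV 0 (Absurd [::2;2;10;13;13] [::] [::(0,4,5,[::])])
(Absurd [::0;0;2;2;13] [::] [::(0,3,5,[::])]))
(Absurd [::1;2;13] [::] [::(0,2,3,[::])]))
(Absurd [::2;7;13] [::] [::(0,2,3,[::]);(1,2,3,[::])]))
(Absurd [::2;9] [::] [::(1,1,2,[::])])))
(SplitV 9 (SplitR 1 7 (-1) 1 (SplitV 7 (Absurd [::8;8;10] [::] [::(0,2,3,[::]);(1,2,3,[::])])
(Absurd [::7;8;8;8;10] [::] [::(0,1,2,[::8;8;10]);(0,2,3,[::7;8]);(1,2,3,[::7;8])]))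
(Absurd [::8] [::rt 1 7 (-1) 1] [::(1,1,2,[::])]))
(Absurd [::8;8;8;9;10;10] [::] [::(0,1,2,[::9;9;10;10]);(0,1,2,[::7;8;10;13]);(0,1,2,[::2;9;10;13]);
(0,1,2,[::2;2;13;13]);(0,1,2,[::1;8;10;13]);(0,1,2,[::0;7;10;13]);(0,1,2,[::0;1;10;13]);(1,1,2,[::9;9;10;10]);
(1,1,2,[::7;8;10;13]);(1,1,2,[::2;9;10;13]);(1,1,2,[::2;2;13;13]);(1,1,2,[::1;8;10;13]);(1,1,2,[::0;7;10;13]);
(0,2,3,[::8;9;10]);(0,2,3,[::7;7;13]);(0,2,3,[::2;8;13]);(0,2,3,[::1;7;13]);(0,2,3,[::1;1;13]);(0,2,3,[::0;9;
10]);(0,2,3,[::0;2;13]);(1,2,3,[::8;9;10]);(1,2,3,[::7;7;13]);(1,2,3,[::2;8;13]);(1,2,3,[::1;7;13]);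
(1,2,3,[::1;1;13]);(1,2,3,[::0;9;10]);(1,2,3,[::0;2;13]);(0,2,4,[::10;13]);(1,2,4,[::10;13]);(0,3,4,[::8;8]);
(0,3,4,[::7;9]);(0,3,4,[::1;9]);(0,3,4,[::0;8]);(1,3,4,[::8;8]);(1,3,4,[::7;9]);(1,3,4,[::1;9]);(1,3,4,[::0;
8])])))
(Absurd [::6;13] [::] [::(0,2,2,[::])]))
(Absurd [::5;13] [::rt 5 10 (-1) 3] [::(0,3,3,[::])])))
(SplitR 5 10 (-3) 7 (SplitV 1 (SplitV 7 (SplitV 2 (SplitV 8 (SplitV 0 (SplitV 9 (Leaf 20
[::([::],[::(0,2,2,[::])]);([::],[::(0,3,3,[::])])])
(Absurd [::9;9;10;10;10] [::] [::(0,4,5,[::]);(1,4,5,[::])]))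
(SplitV 9 (SplitV 6 (Absurd [::10;12] [::] [::(0,2,2,[::])])
(Absurd [::0;0;6;12] [::] [::(0,3,4,[::])]))
(Absurd [::0;9;10;12] [::] [::(0,2,3,[::13]);(0,2,2,[::0;9])])))
(Absurd [::8;8;8;8;10;10] [::] [::(0,2,3,[::8;8;10]);(0,2,3,[::6;8;9]);(0,2,3,[::0;8;10]);(0,2,3,[::0;6;9]);
(0,2,3,[::0;0;10]);(1,2,3,[::8;8;10]);(1,2,3,[::6;8;9]);(1,2,3,[::0;8;10]);(1,2,3,[::0;0;10]);(0,4,6,[::]);
(1,4,6,[::])]))
(SplitV 9 (SplitV 8 (SplitV 0 (SplitV 13 (Absurd [::10;12] [::] [::(0,2,2,[::])])
(Absurd [::2;2;12;13] [::] [::(0,3,4,[::])]))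
(Absurd [::0;2;12] [::] [::(0,2,3,[::])]))
(Absurd [::2;8;8;8;8;8;10] [::] [::(1,2,4,[::8;8;10]);(1,2,4,[::2;8;12]);(1,2,3,[::2;8;8;8]);(0,2,3,[::2;8;8;
8])]))
(Absurd [::2;9] [::] [::(0,1,2,[::])])))
(SplitV 8 (SplitV 9 (SplitV 0 (SplitV 2 (SplitV 13 (Absurd [::10;12] [::] [::(0,2,2,[::])])
(Absurd [::7;7;10;13] [::] [::(1,3,4,[::])]))
(SplitV 13 (Absurd [::10;12] [::] [::(0,2,2,[::])])
(Absurd [::2;7;13] [::] [::(0,2,3,[::])])))
(Absurd [::0;0;7;7;10;12] [::] [::(1,2,3,[::7;7;12]);(1,2,3,[::2;7;13]);(1,2,3,[::0;2;12]);(1,2,3,[::0;0;10]);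
(0,2,3,[::7;7;12]);(0,2,3,[::0;2;12]);(0,2,3,[::0;0;10]);(0,2,2,[::0;0;7;7]);(0,2,2,[::0;0;0;2]);(0,3,4,[::0;
7]);(1,3,4,[::0;7]);(1,4,6,[::]);(0,4,6,[::])]))
(Absurd [::7;7;7;7;9;9;10] [::] [::(0,1,2,[::7;7;7;7;13]);(0,1,2,[::0;7;7;7;12]);(0,2,3,[::7;7;7;9]);
(1,2,3,[::7;7;7;9])]))
(Absurd [::7;8] [::] [::(0,1,2,[::]);(1,1,2,[::])])))
(SplitR 0 8 (-7) 6 (SplitV 8 (SplitV 9 (Absurd [::1;1;1;1;12;12] [::] [::(0,2,3,[::7;7;12]);(0,2,3,[::2;7;
13]);(0,2,3,[::1;7;12]);(0,2,3,[::1;2;13]);(0,2,3,[::1;1;12]);(1,2,3,[::7;7;12]);(1,2,3,[::2;7;13]);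
(1,2,3,[::1;7;12]);(1,2,3,[::1;2;13]);(0,4,6,[::]);(1,4,6,[::])])
(Absurd [::1;1;1;1;9;9;10] [::] [::(0,1,2,[::1;7;7;7;13]);(0,1,2,[::1;1;7;7;13]);(0,2,4,[::7;9;10]);
(0,2,4,[::7;7;12]);(0,2,4,[::1;9;10]);(1,2,4,[::7;9;10]);(1,2,3,[::1;7;7;9])]))
(SplitR 1 7 (-6) 7 (Absurd [::7;7;8;8;8;8;10] [::] [::(0,1,2,[::7;8;8;8;10]);(0,1,2,[::7;7;8;9;10]);
(0,1,2,[::7;7;7;8;12]);(0,1,2,[::7;7;7;7;13]);(0,1,2,[::6;8;8;8;8]);(0,1,2,[::6;7;8;8;9]);(0,1,2,[::2;7;8;8;
12]);(0,1,2,[::2;7;7;8;13]);(0,2,4,[::8;8;10]);(0,2,4,[::7;7;12]);(0,2,4,[::6;8;9]);(0,2,4,[::2;7;13]);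
(1,2,4,[::8;8;10]);(1,2,4,[::7;7;12]);(1,2,4,[::6;8;9]);(1,2,4,[::2;7;13]);(0,2,3,[::7;7;8;8]);(1,2,3,[::7;7;
8;8]);(0,3,5,[::7;8]);(1,3,5,[::7;8])])
(Absurd [::8] [::rt 1 7 (-6) 7] [::(0,1,2,[::]);(1,1,2,[::])])))
(SplitR 0 8 (-5) 2 (SplitV 8 (SplitV 9 (Absurd [::1;1;1;1;12;12] [::] [::(0,2,3,[::7;7;12]);(0,2,3,[::2;7;
13]);(0,2,3,[::1;7;12]);(0,2,3,[::1;2;13]);(0,2,3,[::1;1;12]);(1,2,3,[::7;7;12]);(1,2,3,[::2;7;13]);
(1,2,3,[::1;7;12]);(1,2,3,[::1;2;13]);(0,4,6,[::]);(1,4,6,[::])])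
(Absurd [::1;1;1;1;9;9;10] [::] [::(0,1,2,[::1;7;7;7;13]);(0,1,2,[::1;1;7;7;13]);(0,2,4,[::7;9;10]);
(0,2,4,[::7;7;12]);(0,2,4,[::1;9;10]);(1,2,4,[::7;9;10]);(1,2,3,[::1;7;7;9])]))
(SplitR 1 7 (-2) 5 (Absurd [::7;7;8;8;8;8;10] [::] [::(0,1,2,[::7;8;8;8;10]);(0,1,2,[::7;7;8;9;10]);
(0,1,2,[::7;7;7;8;12]);(0,1,2,[::7;7;7;7;13]);(0,1,2,[::6;8;8;8;8]);(0,1,2,[::6;7;8;8;9]);(0,1,2,[::6;7;7;9;
9]);(0,1,2,[::2;8;8;9;10]);(0,1,2,[::2;7;9;9;10]);(0,1,2,[::2;7;8;8;12]);(0,1,2,[::2;7;7;9;12]);(0,1,2,[::2;7;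
7;8;13]);(0,1,2,[::2;6;8;9;9]);(0,1,2,[::2;2;8;9;12]);(0,1,2,[::2;2;8;8;13]);(0,1,2,[::2;2;7;9;13]);
(0,2,4,[::8;8;10]);(0,2,4,[::7;9;10]);(0,2,4,[::7;7;12]);(0,2,4,[::6;8;9]);(0,2,4,[::2;8;12]);(0,2,4,[::2;7;
13]);(0,2,3,[::7;7;8;8]);(0,2,3,[::7;7;7;9]);(1,2,3,[::7;7;8;8]);(1,2,3,[::7;7;7;9]);(0,3,5,[::7;8]);
(1,3,5,[::7;8]);(0,4,7,[::]);(1,4,7,[::])])
(Absurd [::8] [::rt 1 7 (-2) 5] [::(0,1,2,[::]);(1,1,2,[::])])))
(SplitR 0 8 (-1) 1 (SplitV 8 (SplitV 9 (Absurd [::1;1;1;1;12;12] [::] [::(0,2,3,[::7;7;12]);(0,2,3,[::2;7;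
13]);(0,2,3,[::1;7;12]);(0,2,3,[::1;2;13]);(0,2,3,[::1;1;12]);(1,2,3,[::7;7;12]);(1,2,3,[::2;7;13]);
(1,2,3,[::1;7;12]);(1,2,3,[::1;2;13]);(0,4,6,[::]);(1,4,6,[::])])
(Absurd [::1;1;1;1;9;9;10] [::] [::(0,1,2,[::1;7;7;7;13]);(0,1,2,[::1;1;7;7;13]);(0,2,4,[::7;9;10]);
(0,2,4,[::7;7;12]);(0,2,4,[::1;9;10]);(1,2,4,[::7;9;10]);(1,2,3,[::1;7;7;9])]))
(SplitR 1 7 (-1) 1 (SplitV 9 (SplitV 2 (Absurd [::8;8;10] [::] [::(0,2,3,[::]);(1,2,3,[::])])
(Absurd [::2;8;8;8] [::] [::(1,2,4,[::])]))
(Absurd [::7;7;7;9] [::] [::(0,1,2,[::7;8]);(0,2,4,[::])]))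
(Absurd [::8] [::rt 1 7 (-1) 1] [::(0,1,2,[::]);(1,1,2,[::])])))
(Absurd [::1;1;1;1;1] [::rt 0 8 (-7) 6;rt 0 8 (-5) 2;rt 0 8 (-1) 1] [::(0,1,2,[::7;7;7;7;8;8]);(0,1,2,[::7;7;
7;7;7;9]);(0,1,2,[::2;7;7;8;8;8]);(0,1,2,[::2;7;7;7;8;9]);(0,1,2,[::2;2;8;8;8;8]);(0,1,2,[::2;2;7;8;8;9]);
(0,1,2,[::2;2;7;7;9;9]);(0,1,2,[::2;2;2;8;9;9]);(0,1,2,[::1;7;7;7;8;8]);(0,1,2,[::1;7;7;7;7;9]);(0,1,2,[::1;2;
7;8;8;8]);(0,1,2,[::1;2;7;7;8;9]);(0,1,2,[::1;2;2;8;8;9]);(0,1,2,[::1;2;2;7;9;9]);(0,1,2,[::1;1;7;7;8;8]);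
(0,1,2,[::1;1;7;7;7;9]);(0,1,2,[::1;1;2;8;8;8]);(0,1,2,[::1;1;2;7;8;9]);(0,1,2,[::1;1;2;2;9;9]);(0,1,2,[::1;1;
1;7;8;8]);(0,1,2,[::1;1;1;7;7;9]);(0,1,2,[::1;1;1;2;8;9]);(0,1,2,[::1;1;1;1;8;8]);(0,1,2,[::1;1;1;1;7;9]);
(0,1,2,[::1;1;1;1;1;9]);(0,1,2,[::0;7;7;7;7;8]);(0,1,2,[::0;2;7;7;8;8]);(0,1,2,[::0;2;7;7;7;9]);(0,1,2,[::0;2;
2;8;8;8]);(0,1,2,[::0;2;2;7;8;9]);(0,1,2,[::0;2;2;2;9;9]);(0,1,2,[::0;1;7;7;7;8]);(0,1,2,[::0;1;2;7;8;8]);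
(0,1,2,[::0;1;2;7;7;9]);(0,1,2,[::0;1;2;2;8;9]);(0,1,2,[::0;1;1;7;7;8]);(0,1,2,[::0;1;1;2;8;8]);(0,1,2,[::0;1;
1;2;7;9]);(0,1,2,[::0;1;1;1;7;8]);(0,1,2,[::0;1;1;1;2;9]);(0,1,2,[::0;1;1;1;1;8]);(0,1,2,[::0;0;7;7;7;7]);
(0,1,2,[::0;0;2;7;7;8]);(0,1,2,[::0;0;2;2;8;8]);(0,1,2,[::0;0;2;2;7;9]);(0,1,2,[::0;0;1;7;7;7]);(0,1,2,[::0;0;
1;2;7;8]);(0,1,2,[::0;0;1;2;2;9]);(0,1,2,[::0;0;1;1;7;7]);(0,1,2,[::0;0;1;1;2;8]);(0,1,2,[::0;0;1;1;1;7]);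
(0,1,2,[::0;0;1;1;1;1]);(0,1,2,[::0;0;0;2;7;7]);(0,1,2,[::0;0;0;2;2;8]);(0,1,2,[::0;0;0;1;2;7]);(0,1,2,[::0;0;
0;1;1;2]);(0,1,2,[::0;0;0;0;2;2]);(1,1,2,[::7;7;7;7;8;8]);(1,1,2,[::7;7;7;7;7;9]);(1,1,2,[::2;7;7;8;8;8]);
(1,1,2,[::2;7;7;7;8;9]);(1,1,2,[::2;2;8;8;8;8]);(1,1,2,[::2;2;7;8;8;9]);(1,1,2,[::2;2;7;7;9;9]);(1,1,2,[::2;2;
2;8;9;9]);(1,1,2,[::1;7;7;7;8;8]);(1,1,2,[::1;7;7;7;7;9]);(1,1,2,[::1;2;7;8;8;8]);(1,1,2,[::1;2;7;7;8;9]);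
(1,1,2,[::1;2;2;8;8;9]);(1,1,2,[::1;2;2;7;9;9]);(1,1,2,[::1;1;7;7;8;8]);(1,1,2,[::1;1;7;7;7;9]);(1,1,2,[::1;1;
2;8;8;8]);(1,1,2,[::1;1;2;7;8;9]);(1,1,2,[::1;1;2;2;9;9]);(1,1,2,[::1;1;1;7;8;8]);(1,1,2,[::1;1;1;7;7;9]);
(1,1,2,[::1;1;1;2;8;9]);(1,1,2,[::1;1;1;1;8;8]);(1,1,2,[::1;1;1;1;7;9]);(1,1,2,[::1;1;1;1;1;9]);(1,1,2,[::0;7;
7;7;7;8]);(1,1,2,[::0;2;7;7;8;8]);(1,1,2,[::0;2;7;7;7;9]);(1,1,2,[::0;2;2;8;8;8]);(1,1,2,[::0;2;2;7;8;9]);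
(1,1,2,[::0;2;2;2;9;9]);(1,1,2,[::0;0;7;7;7;7]);(1,1,2,[::0;0;2;7;7;8]);(1,1,2,[::0;0;2;2;8;8]);(1,1,2,[::0;0;
2;2;7;9]);(1,1,2,[::0;0;0;2;7;7]);(1,1,2,[::0;0;0;2;2;8]);(1,1,2,[::0;0;0;0;2;2]);(0,2,4,[::7;7;7;8]);
(0,2,4,[::2;7;8;8]);(0,2,4,[::2;7;7;9]);(0,2,4,[::2;2;8;9]);(0,2,4,[::1;2;7;9]);(0,2,4,[::1;1;2;9]);
(0,2,4,[::0;7;7;7]);(0,2,4,[::0;2;7;8]);(0,2,4,[::0;0;2;7]);(1,2,4,[::7;7;7;8]);(1,2,4,[::2;7;8;8]);
(1,2,4,[::2;7;7;9]);(1,2,4,[::2;2;8;9]);(1,2,4,[::1;2;7;9]);(1,2,4,[::1;1;2;9]);(1,2,4,[::0;7;7;7]);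
(1,2,4,[::0;2;7;8]);(1,2,4,[::0;0;2;7]);(0,3,6,[::7;7]);(0,3,6,[::2;8]);(0,3,6,[::1;7]);(0,3,6,[::1;1]);
(0,3,6,[::0;2]);(1,3,6,[::7;7]);(1,3,6,[::2;8])])))))
(Absurd [::12] [::rt 5 10 (-3) 7] [::(0,2,2,[::]);(1,2,2,[::])])))
(SplitR 3 12 (-1) 1 (SplitV 12 (SplitV 13 (SplitV 9 (SplitV 1 (SplitV 8 (Leaf 3 [::])
(SplitR 0 8 (-2) 1 (SplitV 7 (SplitR 5 10 (-2) 1 (SplitV 6 (Leaf 10 [::])
(Absurd [::6;8;8;8;8] [::] [::(0,3,5,[::])]))
(Absurd [::8;8] [::rt 5 10 (-2) 1] [::(1,2,3,[::])]))
(Absurd [::7;8] [::] [::(1,1,2,[::])]))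
(Absurd [::5;8] [::rt 0 8 (-2) 1] [::(0,2,3,[::])])))
(SplitR 0 8 (-1) 1 (SplitV 8 (Leaf 0 [::])
(Absurd [::5;8;8] [::] [::(0,2,3,[::])]))
(Absurd [::1] [::rt 0 8 (-1) 1] [::(0,1,2,[::])])))
(SplitR 5 10 (-1) 1 (SplitV 8 (SplitV 2 (SplitV 6 (SplitV 1 (Leaf 5 [::])
(Absurd [::1;9;10] [::] [::(0,2,3,[::])]))
(Absurd [::6;9;9;10] [::] [::(0,3,4,[::])]))
(Absurd [::2;9] [::] [::(1,1,2,[::])]))
(Absurd [::8;9;10;10] [::] [::(1,3,4,[::]);(0,3,4,[::])]))
(SplitR 5 10 (-1) 2 (SplitV 7 (SplitV 2 (SplitV 1 (SplitV 8 (SplitV 6 (SplitV 0 (Leaf 15 [::])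
(Absurd [::0;9;10;10] [::] [::(0,3,4,[::])]))
(Absurd [::6;9;9;10] [::] [::(0,3,4,[::]);(1,3,4,[::])]))
(Absurd [::8;8;8;8;10;10] [::] [::(0,2,3,[::8;8;10]);(0,2,3,[::6;8;9]);(0,2,3,[::0;8;10]);(0,2,3,[::0;6;9]);
(0,2,3,[::0;0;10]);(1,2,3,[::8;8;10]);(1,2,3,[::6;8;9]);(1,2,3,[::0;8;10]);(1,2,3,[::0;0;10]);(0,4,6,[::]);
(1,4,6,[::])]))
(Absurd [::1;1;1;9] [::] [::(1,1,2,[::1;8]);(1,1,2,[::0;1]);(1,2,4,[::])]))
(Absurd [::2;2;2;9;9;9] [::] [::(1,1,2,[::2;8;8;8]);(1,1,2,[::2;2;9;9]);(1,1,2,[::1;2;8;9]);(1,1,2,[::1;1;8;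
8]);(1,1,2,[::1;1;1;9]);(1,1,2,[::0;2;8;8]);(1,1,2,[::0;1;2;9]);(1,1,2,[::0;1;1;8]);(1,1,2,[::0;0;2;8]);
(1,1,2,[::0;0;1;1]);(1,1,2,[::0;0;0;2]);(0,1,2,[::2;8;8;8]);(0,1,2,[::2;2;9;9]);(0,1,2,[::1;1;1;9]);
(0,1,2,[::0;2;8;8]);(0,1,2,[::0;1;2;9]);(0,1,2,[::0;0;2;8]);(1,2,4,[::2;9]);(0,2,4,[::2;9]);(1,3,6,[::])]))
(Absurd [::7;7;9;9;10;10] [::] [::(0,1,2,[::8;9;10;10]);(0,1,2,[::6;9;9;10]);(1,1,2,[::8;9;10;10]);
(1,1,2,[::6;9;9;10]);(1,1,2,[::0;9;10;10]);(0,2,3,[::7;9;10]);(0,2,3,[::1;9;10]);(1,2,3,[::7;9;10]);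
(1,2,3,[::1;9;10]);(0,3,4,[::7;8]);(0,3,4,[::2;9]);(0,3,4,[::0;7]);(1,3,4,[::7;8]);(1,3,4,[::2;9]);
(1,3,4,[::0;7])]))
(Absurd [::5;9;9] [::rt 5 10 (-1) 1;rt 5 10 (-1) 2] [::(0,4,5,[::])]))))
(SplitR 5 10 (-1) 3 (SplitV 6 (SplitV 8 (SplitV 2 (SplitV 9 (SplitV 7 (SplitV 1 (SplitV 0 (Leaf 13 [::])
(Absurd [::0;0;10;10;10;13] [::] [::(0,5,6,[::])]))
(Absurd [::1;1;1;1;13] [::] [::(1,3,5,[::])]))
(SplitR 1 7 1 3 (SplitV 0 (Leaf 13 [::])
(Absurd [::0;7] [::] [::(0,1,2,[::])]))
(Absurd [::7;10;13] [::rt 1 7 1 3] [::(0,3,4,[::]);(1,3,4,[::])])))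
(Absurd [::9;9;10;10;10] [::] [::(0,1,2,[::10;10;13]);(0,4,5,[::]);(1,4,5,[::])]))
(SplitV 9 (SplitV 7 (SplitV 1 (SplitV 0 (Absurd [::2;2;10;13;13] [::] [::(0,4,5,[::])])
(Absurd [::0;0;2;2;13] [::] [::(0,3,5,[::])]))
(Absurd [::1;2;13] [::] [::(0,2,3,[::])]))
(Absurd [::2;7;13] [::] [::(0,2,3,[::]);(1,2,3,[::])]))
(Absurd [::2;9] [::] [::(1,1,2,[::])])))
(SplitV 9 (SplitR 1 7 (-1) 1 (SplitV 7 (Absurd [::8;8;10] [::] [::(0,2,3,[::]);(1,2,3,[::])])
(Absurd [::7;8;8;8;10] [::] [::(0,1,2,[::8;8;10]);(0,2,3,[::7;8]);(1,2,3,[::7;8])]))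
(Absurd [::8] [::rt 1 7 (-1) 1] [::(1,1,2,[::])]))
(Absurd [::8;8;8;9;10;10] [::] [::(0,1,2,[::9;9;10;10]);(0,1,2,[::7;8;10;13]);(0,1,2,[::2;9;10;13]);
(0,1,2,[::2;2;13;13]);(0,1,2,[::1;8;10;13]);(0,1,2,[::0;7;10;13]);(0,1,2,[::0;1;10;13]);(1,1,2,[::9;9;10;10]);
(1,1,2,[::7;8;10;13]);(1,1,2,[::2;9;10;13]);(1,1,2,[::2;2;13;13]);(1,1,2,[::1;8;10;13]);(1,1,2,[::0;7;10;13]);
(0,2,3,[::8;9;10]);(0,2,3,[::7;7;13]);(0,2,3,[::2;8;13]);(0,2,3,[::1;7;13]);(0,2,3,[::1;1;13]);(0,2,3,[::0;9;
10]);(0,2,3,[::0;2;13]);(1,2,3,[::8;9;10]);(1,2,3,[::7;7;13]);(1,2,3,[::2;8;13]);(1,2,3,[::1;7;13]);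
(1,2,3,[::1;1;13]);(1,2,3,[::0;9;10]);(1,2,3,[::0;2;13]);(0,2,4,[::10;13]);(1,2,4,[::10;13]);(0,3,4,[::8;8]);
(0,3,4,[::7;9]);(0,3,4,[::1;9]);(0,3,4,[::0;8]);(1,3,4,[::8;8]);(1,3,4,[::7;9]);(1,3,4,[::1;9]);(1,3,4,[::0;
8])])))
(Absurd [::6;13] [::] [::(0,2,2,[::])]))
(Absurd [::5;13] [::rt 5 10 (-1) 3] [::(0,3,3,[::])])))
(SplitR 5 10 (-1) 1 (SplitV 13 (SplitV 6 (SplitV 8 (SplitV 1 (SplitV 2 (Leaf 5 [::])
(SplitV 9 (Leaf 6 [::])
(Absurd [::2;9] [::] [::(0,1,2,[::])])))
(Absurd [::1;1;1;1;12;12] [::] [::(1,1,2,[::0;7;10;12]);(1,1,2,[::0;1;10;12]);(0,2,3,[::7;9;10]);(0,2,3,[::1;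
9;10]);(0,2,3,[::1;1;12]);(1,2,3,[::7;9;10]);(1,2,3,[::1;9;10]);(1,2,3,[::1;1;12]);(1,2,4,[::10;12])]))
(SplitR 0 8 (-1) 1 (SplitR 1 7 (-1) 1 (SplitV 2 (SplitV 9 (Leaf 17 [::([::],[::(0,2,3,[::])])])
(Absurd [::8;9;10;10] [::] [::(0,3,4,[::])]))
(Absurd [::2;8;8;8] [::] [::(0,1,2,[::7;8]);(1,2,4,[::])]))
(Absurd [::8] [::rt 1 7 (-1) 1] [::(0,1,2,[::]);(1,1,2,[::])]))
(Absurd [::8;8;8;10;10] [::rt 0 8 (-1) 1] [::(0,1,2,[::8;9;10;10]);(0,1,2,[::7;8;10;12]);(0,1,2,[::2;9;10;
12]);(0,1,2,[::2;7;12;12]);(0,1,2,[::1;8;10;12]);(0,1,2,[::1;2;12;12]);(0,1,2,[::0;9;10;10]);(0,1,2,[::0;7;10;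
12]);(0,1,2,[::0;1;10;12]);(1,1,2,[::8;9;10;10]);(1,1,2,[::7;8;10;12]);(1,1,2,[::2;9;10;12]);(1,1,2,[::2;7;12;
12]);(1,1,2,[::1;8;10;12]);(1,1,2,[::1;2;12;12]);(1,1,2,[::0;9;10;10]);(1,1,2,[::0;7;10;12]);(0,2,3,[::8;8;
10]);(0,2,3,[::7;9;10]);(0,2,3,[::7;7;12]);(0,2,3,[::2;8;12]);(0,2,3,[::1;9;10]);(0,2,3,[::1;7;12]);
(0,2,3,[::1;1;12]);(0,2,3,[::0;8;10]);(0,2,3,[::0;2;12]);(0,2,3,[::0;0;10]);(1,2,3,[::8;8;10]);(1,2,3,[::7;9;
10]);(1,2,3,[::7;7;12]);(1,2,3,[::2;8;12]);(1,2,3,[::1;9;10]);(1,2,3,[::1;7;12]);(1,2,3,[::1;1;12]);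
(1,2,3,[::0;2;12]);(0,2,4,[::10;12]);(1,2,4,[::10;12]);(0,3,4,[::7;8]);(0,3,4,[::2;9]);(0,3,4,[::0;7]);
(1,3,4,[::7;8]);(1,3,4,[::2;9]);(1,3,4,[::0;7]);(0,4,6,[::])])))
(Absurd [::6;12;12] [::] [::(1,3,3,[::])]))
(Absurd [::10;10;13] [::] [::(0,3,3,[::])]))
(Absurd [::12] [::rt 5 10 (-1) 1] [::(0,2,2,[::]);(1,2,2,[::])])))
(Absurd [::5;5;5] [::rt 3 12 (-7) 3;rt 3 12 (-1) 1] [::(0,2,2,[::10;10;12]);(0,2,2,[::6;10;13]);(0,2,2,[::5;
10;12]);(0,2,2,[::5;6;13]);(0,2,2,[::5;5;12]);(0,2,2,[::3;10;10]);(0,2,2,[::3;5;10]);(0,2,2,[::3;5;5]);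
(1,2,2,[::6;10;13]);(1,2,2,[::5;10;12]);(1,2,2,[::5;6;13]);(1,2,2,[::5;5;12]);(0,3,3,[::6;12]);(1,3,3,[::6;
12]);(1,3,3,[::3;6]);(0,4,4,[::10]);(0,4,4,[::5])])))) (Absurd [::11] [::] [::(1,1,1,[::])])) (Absurd [::4]
[::] [::(0,1,1,[::])]).

Definition all_params : subst := [seq (1%ZZ, i) | i <- iota 0 14].
Lemma case_tree_ok : check cases all_params [::] [::] case_tree.
Proof. by vm_compute. Qed.

Local Open Scope ring_scope.

Local Arguments wordm : simpl never.
Local Arguments mvar : simpl never.

(** * Necessity of the families *)

Section Necessity.
Variable K : numFieldType.

Lemma vanish_map (th : nat -> K) ps s : (forall p, p \in ps -> peval th p = 0) -> s = [seq peval th p | p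
  <- ps] -> vanish s.
Proof. by move=> H ->; apply/allP => _ /mapP [p /H -> ->]. Qed.

Lemma necessary (a20 a11 a02 a30 a21 a12 a03 b20 b11 b02 b30 b21 b12 b03 : K) :
  (forall e : nat, plin (Cubic (e%:R * a20) (e%:R * a11) (e%:R * a02) (e%:R * a30) (e%:R * a21) (e%:R *
    a12) (e%:R * a03))
       (Cubic (e%:R * b20) (e%:R * b11) (e%:R * b02) (e%:R * b30) (e%:R * b21) (e%:R * b12) (e%:R * b03))) ->
  [/\ a21 = 0, b21 = 0 &
   vanish [:: a20; a30; b11; b02; b12; b03] \/
   vanish [:: b20; b30; a11; a02; a12; a03] \/
   vanish [:: a11; a02; a12; a03; b11; b30] \/
   vanish [:: b11; b02; b12; b03; a11; a30] \/
   vanish [:: a11; a02; a12; a03; b11; b02; b12; b03] \/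
   vanish [:: a11; b11; a02; a03; b03; a12 + b30; a30 + b12] \/
   vanish [:: a11; b11; b02; b03; a03; a30 + b12; a12 + b30] \/
   vanish [:: a20; a02; a12; a03; b11; b02; b12; b03;
                        2 * a11 - b20] \/
   vanish [:: b20; b02; b12; b03; a11; a02; a12; a03;
                        2 * b11 - a20] \/
   vanish [:: a20; a02; a12; a03; b11; b30; b03;
                        2 * a11 + b20; 2 * a30 + b12] \/
   vanish [:: b20; b02; b12; b03; a11; a30; a03;
                        a20 + 2 * b11; a12 + 2 * b30] \/
   vanish [:: a20; a02; a30; a12; a03; b11; b02; b30; b12;
                        3 * a11 + b20] \/
   vanish [:: b20; b02; b30; b12; b03; a11; a02; a30; a12;
                        a20 + 3 * b11] \/
   vanish [:: a20; a02; a30; a03; b11; b02; b12;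
                        3 * a11 - b20; 3 * a12 + b30] \/
   vanish [:: b20; b02; b30; b03; a11; a02; a12;
                        3 * b11 - a20; a30 + 3 * b12] \/
   vanish [:: a20; a11; a02; a30; a03; b20; b11; b12; b03;
                        2 * a12 + b30] \/
   vanish [:: b20; b11; b02; b30; b03; a20; a11; a12; a03;
                        a30 + 2 * b12] \/
   vanish [:: a02; b02; a03; b03; a11 + b20; a20 + b11;
                        a12 + b30; a30 + b12;
                        a30 * b20 ^+ 2 - a20 ^+ 2 * b30] \/
   (a20 * b20 <> 0 /\
              vanish [:: a30; a12; a03; b30; b12; b03;
                         7 * a11 + 6 * b20; 6 * a20 + 7 * b11;
                         7 * a02 * a20 - 3 * b20 ^+ 2;
                         - (3 * a20 ^+ 2) + 7 * b02 * b20]) \/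
   (a20 * b20 <> 0 /\
              vanish [:: a30; a12; a03; b30; b12; b03;
                         5 * a11 + 2 * b20; 2 * a20 + 5 * b11;
                         5 * a02 * a20 + 3 * b20 ^+ 2;
                         3 * a20 ^+ 2 + 5 * b02 * b20]) \/
   (a30 * b30 <> 0 /\
              vanish [:: a20; a11; a02; b20; b11; b02;
                         7 * a12 + 3 * b30; 3 * a30 + 7 * b12;
                         49 * a03 * b03 - 16 * a30 * b30;
                         a03 * a30 ^+ 2 - b03 * b30 ^+ 2])].
Proof.
move=> H; pose th := nth 0 [:: a20; a11; a02; a30; a21; a12; a03; b20; b11; b02; b30; b21; b12; b03].
have E : th =1 sval all_params th.
  move=> i; case: (ltnP i 14) => Hi; last by rewrite /sval [nth _ all_params i]nth_default // /th
    nth_default // zK0 mul0r.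
  by rewrite /sval /all_params (nth_map 0%N) ?size_iota // nth_iota // mul1r.
have [||k kl [H1 H2]] := @check_sound K cases th H case_tree _ _ _ _ E _ _ case_tree_ok; [by [] | by [] |].
have eV i : peval th [:: (mvar i, 1%ZZ)] = th i by rewrite peval_cons peval0 meval_mvar mul1r addr0.
have z0 i : i \in [:: 4; 11]%N -> th i = 0.
  move=> Hi; rewrite -eV; apply: H1; rewrite /cases (nth_map ([::], [::])) ?mem_cat; last first.
    by move: kl; rewrite /cases size_map.
  by apply/orP; left; rewrite /zeros; apply: map_f.
split; [exact: (z0 4%N) | exact: (z0 11%N) | clear z0].
(* The first two conditions of every family, on a21 and b21, have just been used. *)
have {}H1 : exists2 c, c = nth ([::], [::]) cases k & forall p, p \in behead (behead c.1) -> peval th p = 0.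
  by exists (nth ([::], [::]) cases k) => // p Hp; apply: H1; apply/mem_behead/mem_behead.
have eL c1 i c2 j : peval th (lin2 c1 i c2 j) = zK K c1 * th i + zK K c2 * th j.
  by rewrite /lin2 !peval_cons peval0 !meval_mvar addr0.
have eR c1 i j c2 k' l : peval th (rel2 c1 i j c2 k' l) = zK K c1 * (th i * th j) + zK K c2 * (th k' * th l).
  by rewrite /rel2 !peval_cons peval0 !wordE !big_cons !big_nil addr0 !mulr1.
have e3 u u' c1 c2 : peval th [:: (wordm u, c1);
  (wordm u', c2)] = zK K c1 * \prod_(v <- u) th v + zK K c2 * \prod_(v <- u') th v.
  by rewrite !peval_cons peval0 !wordE addr0.
case: H1 H2 => c -> H1 H2.
have zE : (zK K 1 = 1) * (zK K 2 = 2) * (zK K 3 = 3) * (zK K 5 = 5) * (zK K 6 = 6) * (zK K 7 = 7) * (zK K 49 = 49)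
  * (zK K (-1) = - 1) * (zK K (-3) = - 3) * (zK K (-16) = - 16).
  by rewrite (zKN K 1) (zKN K 3) (zKN K 16).
have tE : (th 0%N = a20) * (th 1%N = a11) * (th 2%N = a02) * (th 3%N = a30) * (th 5%N = a12) * (th 6%N =
  a03) * (th 7%N = b20)
  * (th 8%N = b11) * (th 9%N = b02) * (th 10%N = b30) * (th 12%N = b12) * (th 13%N = b03) by [].
Ltac solve_case H1 eV eL eR e3 zE tE := apply: (vanish_map H1); rewrite [RHS]/= ?eV ?eL ?eR ?e3;
  repeat (congr cons); rewrite ?big_cons ?big_nil ?zE ?tE; ring.
do 18![case: k kl H1 H2 => [|k] kl H1 H2; [left; solve_case H1 eV eL eR e3 zE tE | right]].
case: k kl H1 H2 => [|k] kl H1 H2; [left; split; last by solve_case H1 eV eL eR e3 zE tE | right].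
  by apply/eqP; rewrite mulf_neq0 // -tE; apply: H2; rewrite !inE.
case: k kl H1 H2 => [|k] kl H1 H2; [left; split; last by solve_case H1 eV eL eR e3 zE tE | right].
  by apply/eqP; rewrite mulf_neq0 // -tE; apply: H2; rewrite !inE.
case: k kl H1 H2 => [|k] kl H1 H2; [split; last by solve_case H1 eV eL eR e3 zE tE | by []].
  by apply/eqP; rewrite mulf_neq0 // -tE; apply: H2; rewrite !inE.
Qed.
End Necessity.

(** * Sums of double power series *)

Section Sums.
Variable K : numFieldType.
Notation S := (fps (fps K)).
Notation z := (Xz K).
Notation w := (Xw K).

(** Convergence spelled out for a field with a partially ordered norm; [tendsP] links it to
    filters. *)
Definition tends (u : nat -> K) (l : K) := forall e : K, 0 < e -> exists N, forall n, (N <= n)%N -> `|l - u n| < e.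

Lemma tends_ext u v l : u =1 v -> tends u l -> tends v l.
Proof. by move=> E H e /H [N HN]; exists N => n /HN; rewrite E. Qed.
Lemma tendsD u v l m : tends u l -> tends v m -> tends (fun n => u n + v n) (l + m).
Proof.
move=> Hu Hv e e0; have e2 : 0 < e / 2 by rewrite divr_gt0.
have [N HN] := Hu _ e2; have [N' HN'] := Hv _ e2; exists (maxn N N') => n; rewrite geq_max => /andP[le le'].
rewrite opprD addrACA (splitr e); apply: le_lt_trans (ler_normD _ _) _.
by apply: ltrD; [apply: HN | apply: HN'].
Qed.
Lemma tendsZ a u l : tends u l -> tends (fun n => a * u n) (a * l).
Proof.
move=> Hu e e0; have a1 : 0 < `|a| + 1 by rewrite ltr_wpDl.
have [N HN] := Hu _ (divr_gt0 e0 a1); exists N => n /HN; rewrite ltr_pdivlMr // => H.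
rewrite -mulrBr normrM; apply: le_lt_trans H; rewrite mulrC ler_wpM2l //.
by rewrite lerDl.
Qed.
Lemma tends_sub_eq u v l : tends (fun n => u n - v n) 0 -> tends v l -> tends u l.
Proof.
by move=> H1 /(tendsD H1); rewrite add0r; apply: tends_ext => n; rewrite subrK.
Qed.
Lemma tends_unique u l m : tends u l -> tends u m -> l = m.
Proof.
move=> Hl Hm; apply/eqP; rewrite -subr_eq0 -normr_eq0; apply/negPn/negP => H.
have e0 : 0 < `|l - m| by rewrite lt_def H normr_ge0.
have [N HN] := tendsD Hl (tendsZ (-1) Hm) e0.
by have := HN N (leqnn N); rewrite !mulN1r subrr subr0 ltxx.
Qed.
Lemma tends_shift u l : tends u l -> tends (fun n => u n.+1) l.
Proof. by move=> H e /H [N HN]; exists N => n le; apply: HN; apply: leqW. Qed.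
Lemma tends_norm_le u l C N0 : tends u l -> (forall n, (N0 <= n)%N -> `|u n| <= C) -> `|l| <= C.
Proof.
move=> H HC; have rC : C \is Num.real by apply: ger0_real; apply: le_trans (HC N0 (leqnn _)).
rewrite real_leNgt ?normr_real //; apply/negP => lt.
have e0 : 0 < `|l| - C by rewrite subr_gt0.
have [N' HN'] := H _ e0; set N := maxn N0 N'.
have := HN' N (leq_maxr _ _); apply/negP; rewrite -real_leNgt ?normr_real ?rpredB ?normr_real //.
rewrite lerBlDr -[X in `|X| <= _](subrK (u N)); apply: le_trans (ler_normD _ _) _.
by rewrite lerD2l HC // leq_maxl.
Qed.
Lemma ler_norm_pos (x : K) : 0 <= x -> x <= `|x|. Proof. by move=> x0; rewrite ger0_norm. Qed.
Lemma tends_unshift u l : tends (fun n => u n.+1) l -> tends u l.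
Proof. by move=> H e /H [N HN]; exists N.+1 => -[|n] // le; apply: HN. Qed.
Lemma tends_squeeze u v : tends v 0 -> (forall n, `|u n| <= v n) -> tends u 0.
Proof.
move=> H Huv e /H [N HN]; exists N => n /HN; rewrite !sub0r !normrN; apply: le_lt_trans.
by apply: le_trans (Huv n) _; apply: ler_norm_pos; apply: le_trans (Huv n).
Qed.

Definition sq (t : nat -> nat -> K) n := \sum_(i < n) \sum_(j < n) t i j.
Definition abss (t : nat -> nat -> K) i j := `|t i j|.

Lemma sq_norm t n : `|sq t n| <= sq (abss t) n.
Proof.
apply: le_trans (ler_norm_sum _ _ _) _; apply: ler_sum => i _; exact: ler_norm_sum.
Qed.
Lemma sqD t t' n : sq (fun i j => t i j + t' i j) n = sq t n + sq t' n.
Proof. by rewrite /sq -big_split; apply: eq_bigr => i _; rewrite -big_split. Qed.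
Lemma sqZ a t n : sq (fun i j => a * t i j) n = a * sq t n.
Proof. by rewrite /sq mulr_sumr; apply: eq_bigr => i _; rewrite mulr_sumr. Qed.
Lemma sq_le t t' n : (forall i j, t i j <= t' i j) -> sq t n <= sq t' n.
Proof. by move=> H; apply: ler_sum => i _; apply: ler_sum => j _. Qed.
Lemma eq_sq t t' n : (forall i j, t i j = t' i j) -> sq t n = sq t' n.
Proof. by move=> H; apply: eq_bigr => i _; apply: eq_bigr => j _. Qed.
Lemma sqT t n : sq (fun i j => t j i) n = sq t n.
Proof. by rewrite /sq exchange_big. Qed.

(** The single completeness assumption on the field, established for complex numbers in
    [complex_complete_abs]. *)
Hypothesis complete_abs : forall t (M : K), (forall n, sq (abss t) n <= M) -> exists s, tends (sq t) s.

Definition dsum t s := (exists M : K, forall n, sq (abss t) n <= M) /\ tends (sq t) s.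

Lemma dsum_ext t t' s : (forall i j, t i j = t' i j) -> dsum t s -> dsum t' s.
Proof.
move=> E [[M HM] Ht]; split.
  by exists M => n; rewrite -(@eq_sq (abss t)) // => i j; rewrite /abss E.
by apply: tends_ext Ht => n; apply: eq_sq.
Qed.
Lemma dsumD t t' s s' : dsum t s -> dsum t' s' -> dsum (fun i j => t i j + t' i j) (s + s').
Proof.
move=> [[M HM] Ht] [[M' HM'] Ht']; split.
  exists (M + M') => n; apply: le_trans (lerD (HM n) (HM' n)).
  by rewrite -sqD; apply: sq_le => i j; apply: ler_normD.
by apply: tends_ext (tendsD Ht Ht') => n; rewrite sqD.
Qed.
Lemma dsumZ a t s : dsum t s -> dsum (fun i j => a * t i j) (a * s).
Proof.
move=> [[M HM] Ht]; split.
  exists (`|a| * M) => n; apply: le_trans (ler_wpM2l (normr_ge0 a) (HM n)).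
  by rewrite -sqZ; apply: sq_le => i j; rewrite /abss normrM.
by apply: tends_ext (tendsZ a Ht) => n; rewrite sqZ.
Qed.
Lemma dsum_unique t s s' : dsum t s -> dsum t s' -> s = s'.
Proof. by move=> [_ H] [_ H']; apply: tends_unique H H'. Qed.
Lemma dsumT t s : dsum t s -> dsum (fun i j => t j i) s.
Proof.
move=> [[M HM] Ht]; split; last by apply: tends_ext Ht => n; rewrite sqT.
by exists M => n; rewrite (sqT (abss t)).
Qed.

Lemma sq_rect t n : (forall j, t 0%N j = 0) ->
  sq (fun i j => t i.+1 j) n = sq t n.+1 - \sum_(i < n.+1) t i n.
Proof.
move=> t0; rewrite /sq -sumrB big_ord_recl /= big_ord_recr /=.
have -> : \sum_(i < n) t 0%N i = 0 by rewrite big1.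
rewrite add0r subrr add0r; apply: eq_bigr => i _.
by rewrite big_ord_recr /= addrK.
Qed.

Lemma col_le (t : nat -> nat -> K) n :
  `|\sum_(i < n.+1) t i n| <= sq (abss t) n.+1 - sq (abss t) n.
Proof.
have -> : sq (abss t) n.+1 = sq (abss t) n + \sum_(j < n) abss t n j + \sum_(i < n.+1) abss t i n.
  transitivity (\sum_(i < n.+1) (\sum_(j < n) abss t i j + abss t i n)).
    by apply: eq_bigr => i _; rewrite big_ord_recr.
  by rewrite big_split /= [X in X + _]big_ord_recr.
rewrite -!addrA addrC -!addrA addNr addr0; apply: le_trans (ler_norm_sum _ _ _) _.
by rewrite lerDr; apply: sumr_ge0 => j _; apply: normr_ge0.
Qed.

(** A shift of one index turns squares into rectangles. The discrepancy is the last column, bounded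
    by the increment of the absolute square sums, and these increments tend to 0 since the absolute
    sums converge. *)
Lemma dsum_shift t s : (forall j, t 0%N j = 0) -> dsum t s <-> dsum (fun i j => t i.+1 j) s.
Proof.
move=> t0.
have a0 j : abss t 0%N j = 0 by rewrite /abss t0 normr0.
have le1 n : sq (abss (fun i j => t i.+1 j)) n <= sq (abss t) n.+1.
  by rewrite (sq_rect n a0) lerBlDr lerDl; apply: sumr_ge0 => i _; apply: normr_ge0.
have le2 n : sq (abss t) n <= sq (abss (fun i j => t i.+1 j)) n.
  case: n => [|n]; first by rewrite /sq !big_ord0.
  rewrite /sq big_ord_recl big1 ?add0r => [|j _]; last exact: a0.
  rewrite [X in _ <= X]big_ord_recr /= lerDl; apply: sumr_ge0 => j _; exact: normr_ge0.
have key M : (forall n, sq (abss t) n <= M) -> tends (fun n => sq (fun i j => t i.+1 j) n - sq t n.+1) 0.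
  move=> HM; have [n|b Hb] := @complete_abs (abss t) M.
    by apply: le_trans (HM n); apply: sq_le => i j; rewrite /abss normr_id.
  have H0 : tends (fun n => sq (abss t) n.+1 + -1 * sq (abss t) n) 0.
    by have := tendsD (tends_shift Hb) (tendsZ (-1) Hb); rewrite mulN1r subrr.
  apply: tends_squeeze H0 _ => n; rewrite mulN1r (sq_rect n t0) addrAC subrr sub0r normrN.
  exact: col_le.
split=> [[[M HM] Ht]|[[M HM] Ht]].
  split; first by exists M => n; apply: le_trans (le1 n) (HM _).
  exact: tends_sub_eq (key M HM) (tends_shift Ht).
have HM' n : sq (abss t) n <= M by apply: le_trans (le2 n) (HM n).
split; first by exists M.
apply: tends_unshift; apply: tends_sub_eq Ht.
have := tendsZ (-1) (key M HM'); rewrite mulr0; apply: tends_ext => n.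
by rewrite mulN1r opprB.
Qed.

Definition evs (c : S) (x y : K) (s : K) := dsum (fun i j => c i j * x ^+ i * y ^+ j) s.

Lemma evs_unique c x y s s' : evs c x y s -> evs c x y s' -> s = s'.
Proof. exact: dsum_unique. Qed.
Lemma evsD c d x y s t : evs c x y s -> evs d x y t -> evs (c + d) x y (s + t).
Proof.
move=> H1 H2; apply: dsum_ext (dsumD H1 H2) => i j.
by rewrite cD !mulrDl.
Qed.
Lemma evsC a c x y s : evs c x y s -> evs (C2 a * c) x y (a * s).
Proof. by move=> H; apply: dsum_ext (dsumZ a H) => i j; rewrite cCM !mulrA. Qed.
Lemma evsN c x y s : evs c x y s -> evs (- c) x y (- s).
Proof. by move=> /(evsC (-1)); rewrite rmorphN1 !mulN1r. Qed.
Lemma evsB c d x y s t : evs c x y s -> evs d x y t -> evs (c - d) x y (s - t).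
Proof. by move=> H1 /evsN; apply: evsD. Qed.
Lemma evsz c x y s : evs c x y s -> evs (z * c) x y (x * s).
Proof.
move=> H; apply/dsum_shift; first by move=> j; rewrite cXzM !mul0r.
by apply: dsum_ext (dsumZ x H) => i j; rewrite cXzM exprS; ring.
Qed.
Lemma evsw c x y s : evs c x y s -> evs (w * c) x y (y * s).
Proof.
move=> H; rewrite /evs; apply: (dsumT (t := fun j i => (w * c) i j * x ^+ i * y ^+ j)).
apply/dsum_shift; first by move=> j; rewrite cXwM !mul0r.
by apply: dsum_ext (dsumT (dsumZ y H)) => i j; rewrite cXwM exprS; ring.
Qed.

(* Second order Taylor estimate of monomials: the remainder is controlled by a Cauchy-type majorant,
   so that it can be summed against any absolutely convergent series. *)
Definition taylor2 (t : K) (f : K -> K) (f0 f1 B : K) :=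
  exists R : K, [/\ 0 <= R, `|f0| + t * `|f1| + R <= B &
    forall h, `|h| <= t -> `|f h - f0 - h * f1| <= (`|h| / t) ^+ 2 * R].

Lemma le_norm4 (A B C D y a b c d : K) : `|A| <= y * a -> `|B| <= y * b -> `|C| <= y * c -> `|D| <= y * d ->
  `|A + B + C + D| <= y * (a + b + c + d).
Proof.
move=> HA HB HC HD; rewrite !mulrDr.
by do 3!(apply: le_trans (ler_normD _ _) _; apply: lerD => //).
Qed.

(** Expand (f0 + h f1 + r) (g0 + h g1 + s). Each term of second order is bounded by its share of the
    product of the two majorants, and the shares together with the terms of order 0 and 1 stay below
    A B. *)
Lemma taylor2M (t : K) f g f0 f1 g0 g1 A B : 0 < t -> taylor2 t f f0 f1 A -> taylor2 t g g0 g1 B ->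
  taylor2 t (fun h => f h * g h) (f0 * g0) (f1 * g0 + f0 * g1) (A * B).
Proof.
move=> t0 [R [R0 RA HR]] [T [T0 TB HT]].
exists (t ^+ 2 * `|f1| * `|g1| + (`|f0| + t * `|f1|) * T + R * (`|g0| + t * `|g1|) + R * T).
have t0' := ltW t0.
have n0 (a : K) : 0 <= `|a| by [].
split.
- by rewrite !addr_ge0 // !mulr_ge0 ?addr_ge0 ?mulr_ge0 ?exprn_ge0.
- apply: le_trans (ler_pM _ _ RA TB); rewrite ?addr_ge0 ?mulr_ge0 //.
  have H : `|f1 * g0 + f0 * g1| <= `|f1| * `|g0| + `|f0| * `|g1|.
    by rewrite -!normrM; apply: ler_normD.
  apply: le_trans (_ : `|f0| * `|g0| + t * (`|f1| * `|g0| + `|f0| * `|g1|) +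
    (t ^+ 2 * `|f1| * `|g1| + (`|f0| + t * `|f1|) * T + R * (`|g0| + t * `|g1|) + R * T) <= _).
    by rewrite normrM !lerD2r lerD2l ler_wpM2l.
  by rewrite le_eqVlt; apply/orP; left; apply/eqP; ring.
move=> h ht; set x := `|h| / t.
have x0 : 0 <= x by rewrite divr_ge0.
have x1 : x <= 1 by rewrite ler_pdivrMr // mul1r.
have hx : `|h| = x * t by rewrite divfK // gt_eqF.
set r := f h - f0 - h * f1; set s := g h - g0 - h * g1.
have Hr : `|r| <= x ^+ 2 * R by exact: HR.
have Hs : `|s| <= x ^+ 2 * T by exact: HT.
have -> : f h * g h - f0 * g0 - h * (f1 * g0 + f0 * g1) =
   h ^+ 2 * f1 * g1 + (f0 + h * f1) * s + r * (g0 + h * g1) + r * s by rewrite /r /s; ring.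
have lin (a b : K) : `|a + h * b| <= `|a| + t * `|b|.
  by apply: le_trans (ler_normD _ _) _; rewrite lerD2l normrM ler_wpM2r.
apply: le_norm4.
- by rewrite (normrM _ g1) (normrM _ f1) normrX hx exprMn -!mulrA.
- by rewrite normrM mulrCA ler_pM.
- by rewrite normrM mulrA ler_pM.
rewrite normrM mulrA ler_pM //; apply: le_trans Hs _.
by rewrite ler_piMl // exprn_ile1.
Qed.

Lemma taylor2_lin (t a b : K) : 0 < t -> taylor2 t (fun h => a + h * b) a b (`|a| + t * `|b|).
Proof.
move=> t0; exists 0; split => // [|h _]; first by rewrite addr0.
have -> : a + h * b - a - h * b = 0 by ring.
by rewrite normr0 mulr0.
Qed.
Lemma taylor2_one (t : K) : 0 < t -> taylor2 t (fun=> 1) 1 0 1.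
Proof.
move=> t0; exists 0; split => // [|h _]; first by rewrite normr0 mulr0 !addr0 normr1.
by rewrite mulr0 subr0 subrr normr0 mulr0.
Qed.
Lemma taylor2X (t a b : K) n : 0 < t -> taylor2 t (fun h => (a + h * b) ^+ n) (a ^+ n) (a ^+ n.-1 * b *+ n)
  ((`|a| + t * `|b|) ^+ n).
Proof.
move=> t0; elim: n => [|n IH].
  by have := taylor2_one t0; rewrite !expr0 mulr0n.
have := taylor2M t0 (taylor2_lin a b t0) IH; rewrite -!exprS.
have -> : b * a ^+ n + a * (a ^+ n.-1 * b *+ n) = a ^+ n.+1.-1 * b *+ n.+1.
  by case: n {IH} => [|n]; rewrite ?mulr0n ?mulr0 ?addr0 /= ?mulr1n 1?mulrC // mulrS exprS -mulrnAr; ring.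
by rewrite (_ : (fun h => _) = (fun h => (a + h * b) ^+ n.+1)) //; apply/funext => h; rewrite exprS.
Qed.

Lemma nrm_sq n (r : K) c : 0 <= r -> nrm n r c = sq (abss (fun i j => c i j * r ^+ i * r ^+ j)) n.
Proof.
move=> r0; apply: eq_bigr => i _; apply: eq_bigr => j _.
by rewrite /abss -mulrA -exprD normrM normrX (ger0_norm r0).
Qed.

Lemma abs_bound (t : nat -> nat -> K) (c : S) (r M : K) : (forall n, nrm n r c <= M) ->
  (forall i j, `|t i j| <= `|c i j| * r ^+ (i + j)) -> exists s, dsum t s.
Proof.
move=> HM Ht; have H n : sq (abss t) n <= M.
  by apply: le_trans (HM n); apply: (@sq_le (abss t) (fun i j => `|c i j| * r ^+ (i + j))).
by have [s Hs] := complete_abs H; exists s; split => //; exists M.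
Qed.

Section Deriv.
Variables (c : S) (r M x y : K).
Hypotheses (r0 : 0 < r) (HM : forall n, nrm n r c <= M).

Lemma pow_le i (a : K) : `|a| <= r -> `|a ^+ i| <= r ^+ i.
Proof. by move=> H; rewrite normrX lerXn2r ?nnegrE ?(ltW r0). Qed.

Lemma ev_abs : `|x| <= r -> `|y| <= r -> exists s, evs c x y s.
Proof.
move=> Hx Hy; apply: (abs_bound HM) => i j.
by rewrite -mulrA normrM ler_wpM2l // normrM exprD ler_pM // pow_le.
Qed.

(** Cauchy estimate for the derivative of a power, read off the majorant in [taylor2X]. *)
Lemma pow1_le (t a : K) i : 0 < t -> `|a| + t <= r -> t * `|a ^+ i.-1 *+ i| <= r ^+ i.
Proof.
move=> t0 H; have [R [R0 RB _]] := taylor2X a 1 i t0.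
rewrite normr1 !mulr1 in RB; apply: le_trans (_ : (`|a| + t) ^+ i <= _).
  by apply: le_trans RB; rewrite addrAC lerDr addr_ge0.
by rewrite lerXn2r ?nnegrE ?(ltW r0) // addr_ge0 // ltW.
Qed.

Lemma ev_d1 t : 0 < t -> `|x| + t <= r -> `|y| <= r ->
  exists s, evs (d1 c) x y s /\ dsum (fun i j => c i j * ((x ^+ i.-1 *+ i) * y ^+ j)) s.
Proof.
move=> t0 Hx Hy; have HM' n : nrm n r (C2 t^-1 * c) <= `|t^-1| * M.
  by rewrite nrmCM ler_wpM2l.
have [i j|s Hs] := abs_bound (t := fun i j => c i j * ((x ^+ i.-1 *+ i) * y ^+ j)) HM'.
  rewrite cCM normrM (normrM (t^-1)) normfV (gtr0_norm t0) normrM exprD (mulrC t^-1) -[X in _ <= X]mulrA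
    ler_wpM2l // mulrA.
  by rewrite ler_pM ?pow_le // -ler_pdivrMl ?invr_gt0 // invrK pow1_le.
exists s; split => //; set t1 := fun i j : nat => _ in Hs.
have t10 j : t1 0%N j = 0 by rewrite /t1 mulr0n mul0r mulr0.
have H := (dsum_shift s t10).1 Hs; apply: dsum_ext H => i j.
rewrite cd1 /t1 -pred_Sn -(mulr_natr (c i.+1 j)) -(mulr_natr (x ^+ i)); ring.
Qed.

Lemma ev_d2 t : 0 < t -> `|y| + t <= r -> `|x| <= r ->
  exists s, evs (d2 c) x y s /\ dsum (fun i j => c i j * (x ^+ i * (y ^+ j.-1 *+ j))) s.
Proof.
move=> t0 Hy Hx; have HM' n : nrm n r (C2 t^-1 * c) <= `|t^-1| * M.
  by rewrite nrmCM ler_wpM2l.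
have [i j|s Hs] := abs_bound (t := fun i j => c i j * (x ^+ i * (y ^+ j.-1 *+ j))) HM'.
  rewrite cCM normrM (normrM (t^-1)) normfV (gtr0_norm t0) normrM exprD (mulrC t^-1) -[X in _ <= X]mulrA
    ler_wpM2l // mulrCA.
  by rewrite ler_pM ?pow_le // -ler_pdivrMl ?invr_gt0 // invrK pow1_le.
exists s; split => //; set t1 := fun i j : nat => _ in Hs.
have t10 j : t1 j 0%N = 0 by rewrite /t1 mulr0n !mulr0.
have H := (dsum_shift s (t := fun j i => t1 i j) t10).1 (dsumT Hs).
apply: (dsumT (t := fun j i => d2 c i j * x ^+ i * y ^+ j)).
apply: dsum_ext H => i j.
rewrite cd2 /t1 -pred_Sn -(mulr_natr (c _ i.+1)) -(mulr_natr (y ^+ i)); ring.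
Qed.

(** Summing the estimates for monomials gives a remainder quadratic in h, from which the directional
    derivative follows without interchanging limits. *)
Lemma taylor_sum t v1 v2 h s0 sh s1 s2 : 0 < t -> `|x| + t * `|v1| <= r -> `|y| + t * `|v2| <= r -> `|h| <= t ->
  evs c x y s0 -> evs c (x + h * v1) (y + h * v2) sh ->
  dsum (fun i j => c i j * ((x ^+ i.-1 *+ i) * y ^+ j)) s1 ->
  dsum (fun i j => c i j * (x ^+ i * (y ^+ j.-1 *+ j))) s2 ->
  `|sh - s0 - h * (v1 * s1 + v2 * s2)| <= (`|h| / t) ^+ 2 * M.
Proof.
move=> t0 Hx Hy Hh H0 Hsh H1 H2.
have := dsumD (dsumD Hsh (dsumZ (-1) H0)) (dsumZ (- h) (dsumD (dsumZ v1 H1) (dsumZ v2 H2))).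
rewrite mulN1r mulNr => -[_ T]; apply: (tends_norm_le (N0 := 0%N) T) => n _.
apply: le_trans (sq_norm _ _) _.
apply: le_trans (_ : (`|h| / t) ^+ 2 * nrm n r c <= _); last first.
  by rewrite ler_wpM2l // exprn_ge0 // divr_ge0 // ltW.
rewrite -(sqZ _ (fun i j => `|c i j| * r ^+ (i + j))); apply: sq_le => i j.
have [R [R0 RB HR]] := taylor2M t0 (taylor2X x v1 i t0) (taylor2X y v2 j t0).
have -> : abss (fun i j => c i j * (x + h * v1) ^+ i * (y + h * v2) ^+ j + -1 * (c i j * x ^+ i * y ^+ j) +
    - h * (v1 * (c i j * (x ^+ i.-1 *+ i * y ^+ j)) + v2 * (c i j * (x ^+ i * (y ^+ j.-1 *+ j))))) i j =
   `|c i j| * `|(x + h * v1) ^+ i * (y + h * v2) ^+ j - x ^+ i * y ^+ j -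
      h * (x ^+ i.-1 * v1 *+ i * y ^+ j + x ^+ i * (y ^+ j.-1 * v2 *+ j))|.
  rewrite /abss -normrM; congr `|_|; ring.
rewrite mulrCA ler_wpM2l //; apply: le_trans (HR h Hh) _.
rewrite ler_wpM2l // ?exprn_ge0 // ?divr_ge0 // ?(ltW t0) //.
apply: le_trans (_ : (`|x| + t * `|v1|) ^+ i * (`|y| + t * `|v2|) ^+ j <= _).
  by apply: le_trans RB; rewrite lerDr addr_ge0 // mulr_ge0 // ltW.
have p0 (a b : K) : 0 <= `|a| + t * `|b| by rewrite addr_ge0 // mulr_ge0 // ltW.
by rewrite exprD ler_pM ?exprn_ge0 // lerXn2r ?nnegrE // ltW.
Qed.
End Deriv.

Lemma evs_nrm c (r s : K) : 0 <= r -> evs c r r s -> exists M : K, forall n, nrm n r c <= M.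
Proof. by move=> r0 [[M HM] _]; exists M => n; rewrite nrm_sq. Qed.

Lemma poly_small (p : {poly K}) : (forall a : K, `|a| <= 1 -> p.[a] = 0) -> p = 0.
Proof.
move=> H; apply/eqP/negPn/negP => p0.
pose rs := [seq (n.+1%:R : K)^-1 | n <- iota 0 (size p)].
have := max_poly_roots (rs := rs) p0; rewrite size_map size_iota ltnn.
have -> : all (root p) rs.
  apply/allP => a /mapP [n _ ->]; apply/rootP/H.
  by rewrite normfV normr_nat invf_le1 ?ltr0n // ler1n.
suff -> : uniq rs by move=> /(_ isT isT).
rewrite map_inj_uniq ?iota_uniq // => m n /invr_inj /eqP; rewrite eqr_nat eqSS => /eqP //.
Qed.

(** Identity theorem, by induction on the order. If c has order N, then at (a h, h) its part of
    degree N is h^N p(a) for a polynomial p, and the rest is at most (h / r)^(N + 1) M0. For small h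
    this forces p(a) = 0 for all a of norm at most 1, hence p = 0. *)
Lemma evs_inj c (d : K) : 0 < d -> (forall x y, `|x| < d -> `|y| < d -> evs c x y 0) -> c = 0.
Proof.
move=> d0 Hc; pose r := d / 2.
have r0 : 0 < r by rewrite divr_gt0.
have rd : r < d by rewrite ltr_pdivrMr // mulr_natr mulr2n ltrDl.
have [||M0 HM0] := @evs_nrm c r 0; [exact: ltW | by apply: Hc; rewrite gtr0_norm|].
have M00 : 0 <= M0 by apply: le_trans (HM0 0%N); apply: nrm_ge0; apply: ltW.
apply: ord_eq => N; rewrite subr0; elim: N => [|N IH]; first exact: ord_0.
pose cN : S := Fps (fun i => Fps (fun j => if (i + j == N)%N then c i j else 0)).
have ccN i j : cN i j = if (i + j)%N == N then c i j else 0 by [].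
have HO : ord N.+1 (c - cN).
  move=> i j; rewrite ltnS leq_eqVlt cB ccN => /orP[eN|lt]; first by rewrite eN subrr.
  by rewrite (IH _ _ lt) (ltn_eqF lt) subr0.
have HB n : nrm n r (c - cN) <= M0.
  apply: le_trans (HM0 n); apply: nrm_le; first exact: ltW.
  by move=> i j; rewrite cB ccN; case: ifP; rewrite ?subrr ?normr0 ?subr0.
pose p := \poly_(i < N.+1) c i (N - i)%N.
suff p0 : p = 0.
  move=> i j; rewrite ltnS leq_eqVlt => /orP[/eqP eN|]; last exact: IH.
  have := congr1 (fun q : {poly K} => q`_i) p0; rewrite coef_poly coef0 ifT; last by rewrite -eN ltnS leq_addr.
  by rewrite -eN addKn.
apply: poly_small => a Ha; set H := p.[a].
apply/eqP; rewrite -normr_eq0; apply/negPn/negP => e0.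
have {}e0 : 0 < `|H| by rewrite lt_def e0 normr_ge0.
pose C := M0 / r ^+ N.+1.
have C0 : 0 <= C by rewrite divr_ge0 // exprn_ge0 // ltW.
have den : 0 < `|H| + r * C by rewrite ltr_pwDl // mulr_ge0 // ltW.
(* Chosen so that h <= r and h C < |H|, where C is the constant of the remainder of order N + 1. *)
pose h := r * `|H| / (`|H| + r * C).
have h0 : 0 < h by rewrite divr_gt0 // mulr_gt0.
have hr : h <= r.
  by rewrite /h -mulrA ler_piMr ?(ltW r0) // ler_pdivrMr // mul1r lerDl mulr_ge0 // ltW.
have hC : h * C < `|H|.
  rewrite /h mulrAC ltr_pdivrMr // mulrDr mulrAC [X in X < _]mulrC ltrDr.
  by rewrite mulr_gt0.
have hd : h < d by apply: le_lt_trans rd.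
have key : `|h ^+ N * H| <= (h / r) ^+ N.+1 * M0.
  have Ev : evs c (a * h) h 0.
    apply: Hc; last by rewrite gtr0_norm.
    by rewrite normrM (gtr0_norm h0); apply: le_lt_trans hd; rewrite ler_piMl // ltW.
  have [_ T] := Ev.
  have T' : tends (fun n => h ^+ N * H + -1 * sq (fun i j => c i j * (a * h) ^+ i * h ^+ j) n) (h ^+ N * H).
    have := tendsD (u := fun=> h ^+ N * H) (l := h ^+ N * H) _ (tendsZ (-1) T).
    rewrite mulr0 addr0; apply=> e e1; exists 0%N => n _; by rewrite subrr normr0.
  apply: (tends_norm_le (N0 := N.+1) T') => n nN.
  have EN : h ^+ N * H = sq (fun i j => cN i j * (a * h) ^+ i * h ^+ j) n.
    rewrite /H /p horner_poly mulr_sumr (big_ord_widen n (fun i => h ^+ N * (c i (N - i)%N * a ^+ i))) // big_mkcond.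
    apply: eq_bigr => i _; case: ifP => iN; last first.
      by rewrite big1 // => j _; rewrite ccN; case: eqP => [E|]; rewrite ?mul0r //; move: iN;
        rewrite -E ltnS leq_addr.
    have lt : (N - i < n)%N := leq_ltn_trans (leq_subr i N) nN.
    rewrite (bigD1 (Ordinal lt)) //= big1 ?addr0 => [|j]; last first.
      rewrite -val_eqE /= => ne; case: eqP => [E|]; rewrite ?mul0r //; by case/eqP: ne; rewrite -E addKn.
    rewrite ltnS in iN; rewrite subnKC // eqxx.
    have -> : h ^+ N = h ^+ i * h ^+ (N - i) by rewrite -exprD subnKC.
    by rewrite (exprMn i a h); ring.
  rewrite EN mulN1r -opprB normrN.
  have -> : sq (fun i j => c i j * (a * h) ^+ i * h ^+ j) n - sq (fun i j => cN i j * (a * h) ^+ i * h ^+ j) n =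
     sq (fun i j => (c - cN) i j * (a * h) ^+ i * h ^+ j) n.
    by rewrite -mulN1r -sqZ -sqD; apply: eq_sq => i j; rewrite cB; ring.
  apply: le_trans (sq_norm _ _) _.
  apply: le_trans (_ : nrm n h (c - cN) <= _).
    apply: (@sq_le _ (fun i j => `|(c - cN) i j| * h ^+ (i + j))) => i j;
      rewrite /abss -mulrA normrM ler_wpM2l // normrM !normrX normrM (gtr0_norm h0) (exprMn i _ h) (exprD h).
    by rewrite -mulrA ler_piMl ?mulr_ge0 ?exprn_ge0 ?(ltW h0) // exprn_ile1.
  apply: le_trans (nrm_scale n r0 _ HO) _; first by rewrite hr ltW.
  by rewrite ler_wpM2l // exprn_ge0 // divr_ge0 // ltW.
have E : (h / r) ^+ N.+1 * M0 = h ^+ N * (h * C).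
  have G (A B D m : K) : A * B * D * m = A * (B * (m * D)) by ring.
  by rewrite (expr_div_n h r) (exprSr h) /C G.
move: key; rewrite E (normrM (h ^+ N)) (normrX N h) (gtr0_norm h0) ler_pM2l ?exprn_gt0 //.
by move=> /le_lt_trans/(_ hC); rewrite ltxx.
Qed.
End Sums.

Import numFieldNormedType.Exports.
Local Open Scope classical_set_scope.
Local Open Scope ring_scope.

(** * Functions with a power series expansion and their directional derivatives *)

Section Analytic.
Variable K : numFieldType.
Notation S := (fps (fps K)).
Hypothesis complete_abs : forall t (M : K), (forall n, sq (abss t) n <= M) -> exists s, tends (sq t) s.

Lemma tendsP (u : nat -> K) l : (u @ \oo --> l) <-> tends u l.
Proof.
split=> [/cvgrPdist_lt H e e0|H].
  by have [N _ HN] := H e e0; exists N => n le; apply: HN.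
by apply/cvgrPdist_lt => e e0; have [N HN] := H e e0; exists N => // n; apply: HN.
Qed.

Lemma near0P (P : K * K -> Prop) :
  (\forall p \near (0 : K * K), P p) <-> (exists d : K, 0 < d /\ forall x y, `|x| < d -> `|y| < d -> P (x, y)).
Proof.
split=> [/nbhs_ballP [d d0 H]|[d [d0 H]]].
  exists d; split=> // x y Hx Hy; apply: H; split; rewrite /ball /= sub0r normrN //.
apply/nbhs_ballP; exists d => // -[x y] [/= Hx Hy].
by apply: H; move: Hx Hy; rewrite /ball /= !sub0r !normrN.
Qed.

Definition has_expansion (F : K * K -> K) (c : S) (r M : K) :=
  [/\ 0 < r, forall n, nrm n r c <= M & forall x y, `|x| < r -> `|y| < r -> evs c x y (F (x, y))].

Lemma tends_evs (c : S) x y s r M : `|x| <= r -> `|y| <= r -> 0 < r -> (forall n, nrm n r c <= M) ->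
  tends (sq (fun i j => c i j * x ^+ i * y ^+ j)) s -> evs c x y s.
Proof.
move=> Hx Hy r0 HM H; split => //; exists M => n; apply: le_trans (HM n).
apply: (@sq_le _ _ (fun i j => `|c i j| * r ^+ (i + j))) => i j.
rewrite /abss -mulrA normrM ler_wpM2l // normrM !normrX exprD.
by rewrite ler_pM ?exprn_ge0 // lerXn2r ?nnegrE // ltW.
Qed.

Lemma power_series_expansionP F (c : nat -> nat -> K) :
  power_series_at0 F c <-> exists r M, has_expansion F (Fps (fun i => Fps (c i))) r M.
Proof.
split=> [[r [r0 [M HM] H]]|[r [M [r0 HM H]]]].
  exists r, M; split => // x y Hx Hy.
  apply: (@tends_evs (Fps (fun i => Fps (c i))) x y _ r M) => //; rewrite ?ltW //.
  by apply/tendsP; apply: H.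
exists r; split => //; first by exists M.
move=> x y Hx Hy; have [_ ] := H x y Hx Hy.
by move/tendsP.
Qed.

Lemma small_both (a b : K) : 0 < a -> 0 < b -> exists d : K, [/\ 0 < d, d < a & d < b].
Proof.
move=> a0 b0; have ab : 0 < a + b by rewrite addr_gt0.
exists (a * b / (a + b)); split; first by rewrite divr_gt0 // mulr_gt0.
  by rewrite ltr_pdivrMr // ltr_pM2l // ltrDr.
by rewrite ltr_pdivrMr // mulrC ltr_pM2l // ltrDl.
Qed.

Lemma derive_expansion F c r M x y (v : K * K) : has_expansion F c r M -> `|x| < r -> `|y| < r ->
  exists s1 s2, [/\ evs (d1 c) x y s1, evs (d2 c) x y s2 & 'D_v F (x, y) = v.1 * s1 + v.2 * s2].
Proof.
move=> [r0 HM H] Hx Hy.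
have [d [d0 dx dy]] := @small_both (r - `|x|) (r - `|y|) ltac:(by rewrite subr_gt0) ltac:(by rewrite subr_gt0).
rewrite ltrBrDl in dx; rewrite ltrBrDl in dy.
have [s1 [E1 D1]] := ev_d1 complete_abs r0 HM d0 (ltW dx) (ltW Hy).
have [s2 [E2 D2]] := ev_d2 complete_abs r0 HM d0 (ltW dy) (ltW Hx).
exists s1, s2; split => //.
have q0 : 0 < 1 + `|v.1| + `|v.2| by rewrite -addrA ltr_pwDl // addr_ge0.
(* With this bound on h the point (x, y) + h v stays in the polydisc of convergence. *)
pose t := d / (1 + `|v.1| + `|v.2|).
have t0 : 0 < t by rewrite divr_gt0.
have tv1 : t * `|v.1| <= d.
  rewrite /t mulrAC ler_pdivrMr // ler_pM2l // addrAC lerDr; by rewrite addr_ge0.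
have tv2 : t * `|v.2| <= d.
  rewrite /t mulrAC ler_pdivrMr // ler_pM2l // lerDr; by rewrite addr_ge0.
have M0 : 0 <= M by apply: le_trans (HM 0%N); apply: nrm_ge0; apply: ltW.
apply: cvg_lim; first exact: norm_hausdorff.
apply/cvgrPdist_lt => e e0.
have C0 : 0 < M / t ^+ 2 + 1 by rewrite ltr_wpDl // divr_ge0 // exprn_ge0 // ltW.
have [d' [d'0 d't d'e]] := small_both t0 (divr_gt0 e0 C0).
apply/nbhs_ballP; exists d' => // h; rewrite /ball /= sub0r normrN => hd' hn.
have Hh : `|h| <= t by apply: ltW; apply: lt_trans d't.
have lt (a b : K) : `|a| + d < r -> t * `|b| <= d -> `|a + h * b| < r.
  move=> Ha Hb; apply: le_lt_trans Ha; apply: le_trans (ler_normD _ _) _.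
  rewrite lerD2l normrM; apply: le_trans Hb; by rewrite ler_wpM2r.
have le (a b : K) : `|a| + d < r -> t * `|b| <= d -> `|a| + t * `|b| <= r.
  by move=> Ha Hb; apply: le_trans (ltW Ha); rewrite lerD2l.
have Ev := H _ _ (lt _ _ dx tv1) (lt _ _ dy tv2).
have T := taylor_sum r0 HM t0 (le _ _ dx tv1) (le _ _ dy tv2) Hh (H _ _ Hx Hy) Ev D1 D2.
have -> : F (h *: v + (x, y)) = F (x + h * v.1, y + h * v.2).
  by congr F; case: v {tv1 tv2 lt le Ev T q0 t t0 C0 d' d'0 d't d'e hd' Hh} => v1 v2; congr pair; rewrite addrC.
rewrite -(ltr_pM2l (x := `|h|)) ?normr_gt0 // -normrM.
apply: le_lt_trans (_ : _ <= (`|h| / t) ^+ 2 * M) _.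
  set A := v.1 * s1 + v.2 * s2 in T *; set B := F (x, y) in T *; set C := F _ in T *.
  have -> : h * (A - h^-1 *: (C - B)) = - (C - B - h * A).
    rewrite opprB mulrBr; congr (_ - _).
    by transitivity (h * (h^-1 * (C - B))); [|rewrite mulVKf].
  by rewrite normrN.
rewrite expr_div_n expr2 -!mulrA ltr_pM2l ?normr_gt0 // mulrCA mulrC.
move: hd' => /lt_trans/(_ d'e); rewrite ltr_pdivlMr // => /(le_lt_trans _); apply.
by rewrite -[X in X <= _]mulrA ler_wpM2l // lerDl.
Qed.
End Analytic.

Local Open Scope classical_set_scope.
Local Open Scope ring_scope.

(** * Equivalence of formal and analytic linearizability *)

Section Bridge.
Variable K : numFieldType.
Notation S := (fps (fps K)).
Notation z := (Xz K).
Notation w := (Xw K).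
Hypothesis complete_abs : forall t (M : K), (forall n, sq (abss t) n <= M) -> exists s, tends (sq t) s.

(** Multiplication by [P] acts on sums as multiplication by [Pf]. For the polynomial components of a
    field this follows from shifts and linear combinations, which avoids the Cauchy product of two
    general convergent series. *)
Definition multev (P : S) (Pf : K -> K -> K) :=
  forall c x y s, evs c x y s -> evs (P * c) x y (Pf x y * s).

(** From functions to series by the identity theorem for the difference of the two sides; from
    series to functions by uniqueness of sums. *)
Lemma expansion_vf (P Q : S) Pf Qf (l : K) F c r M : multev P Pf -> multev Q Qf -> has_expansion F c r M ->
  (\forall p \near (0 : K * K), 'D_(Pf p.1 p.2, Qf p.1 p.2) F p = l * F p) <-> vf P Q c = C2 l * c.
Proof.
move=> HP HQ HA; have [r0 HM HF] := HA; split=> [/near0P [d [d0 Hd]]|E].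
  have [e [e0 er ed]] := small_both r0 d0.
  apply/eqP; rewrite -subr_eq0; apply/eqP; apply: (evs_inj e0) => x y Hx Hy.
  have Hx' := lt_trans Hx er; have Hy' := lt_trans Hy er.
  have [s1 [s2 [E1 E2 ED]]] := derive_expansion complete_abs (Pf x y, Qf x y) HA Hx' Hy'.
  have ER := Hd x y (lt_trans Hx ed) (lt_trans Hy ed); rewrite ED /= in ER.
  rewrite -[X in evs _ _ _ X](subrr (l * F (x, y))) -[X in evs _ _ _ (X - _)]ER; apply: (evsB (evsD _ _) (evsC _ _)).
  - exact: HP.
  - exact: HQ.
  - exact: HF.
apply/near0P; exists r; split => // x y Hx Hy.
have [s1 [s2 [E1 E2 ->]]] := derive_expansion complete_abs (Pf x y, Qf x y) HA Hx Hy.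
have H1 := evsD (HP _ _ _ _ E1) (HQ _ _ _ _ E2).
rewrite -/(vf P Q c) E in H1; exact: evs_unique H1 (evsC l (HF _ _ Hx Hy)).
Qed.

Lemma expansion_ex (c : S) : conv c -> exists F r M, has_expansion F c r M.
Proof.
move=> [r [M [r0 HM]]]; exists (fun p => xget 0 [set s | evs c p.1 p.2 s]), r, M; split => // x y Hx Hy.
by have [s Hs] := ev_abs complete_abs r0 HM (ltW Hx) (ltW Hy); apply: (xgetPex 0); exists s.
Qed.

Lemma analytic_expansionP F l m : analytic_with_linear_part F l m <->
  exists c r M, has_expansion F c r M /\ ord 2 (c - (C2 l * z + C2 m * w)).
Proof.
split=> [[c [/power_series_expansionP [r [M HA]] c0 c1 c2]]|[c [r [M [HA HO]]]]].
  exists (Fps (fun i => Fps (c i))), r, M; split => // -[|[|i]] [|[|j]] //= _;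
    rewrite cB cD !cCM cXz cXw /= ?c0 ?c1 ?c2 ?mulr0 ?mulr1 ?addr0 ?add0r ?subrr ?oppr0 //.
have co i j : (i + j < 2)%N -> c i j = l * (z i j) + m * (w i j).
  by move/HO; rewrite cB cD !cCM => /eqP; rewrite subr_eq0 => /eqP.
exists (fun i j => c i j); split.
- apply/power_series_expansionP; exists r, M; case: HA => r0 HM HF; split => //.
- by rewrite co // cXz cXw /= !mulr0 addr0.
- by rewrite co // cXz cXw /= mulr0 mulr1 addr0.
- by rewrite co // cXz cXw /= mulr0 mulr1 add0r.
Qed.

(** From right to left the given formal linearization may diverge; it is first replaced by a
    convergent one. *)
Theorem analytically_linearizableP (p q : S) Pf Qf : ord 2 p -> ord 2 q -> conv p -> conv q ->
  multev (z + p) Pf -> multev (- w + q) Qf ->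
  analytically_linearizable (fun p => (Pf p.1 p.2, Qf p.1 p.2)) <->
  exists Z W, linearizes (z + p) (- w + q) Z W.
Proof.
move=> Op Oq Cp Cq HP HQ; split.
  move=> [Z [W [/analytic_expansionP [c [r [M [Hc Oc]]]] /analytic_expansionP [c' [r' [M' [Hc' Oc']]]] H]]].
  exists c, c'; split.
  - by move: Oc; rewrite rmorph1 rmorph0 mul1r mul0r addr0.
  - by move: Oc'; rewrite rmorph1 rmorph0 mul1r mul0r add0r.
  - have := (expansion_vf 1 HP HQ Hc).1; rewrite rmorph1 mul1r; apply.
    by apply: filterS H => x [-> _]; rewrite mul1r.
  - have := (expansion_vf (-1) HP HQ Hc').1; rewrite rmorphN1 mulN1r; apply.
    by apply: filterS H => x [_ ->]; rewrite mulN1r.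
move=> /(convergent_linearization Op Oq Cp Cq) [Z [W [[OZ OW EZ EW] CZ CW]]].
have [F [r [M HF]]] := expansion_ex CZ; have [G [r' [M' HG]]] := expansion_ex CW.
exists F, G; split.
- by apply/analytic_expansionP; exists Z, r, M; split => //; rewrite rmorph1 rmorph0 mul1r mul0r addr0.
- by apply/analytic_expansionP; exists W, r', M'; split => //; rewrite rmorph1 rmorph0 mul1r mul0r add0r.
have H1 := (expansion_vf 1 HP HQ HF).2; have H2 := (expansion_vf (-1) HP HQ HG).2.
rewrite rmorph1 mul1r in H1; rewrite rmorphN1 mulN1r in H2.
by apply: filterS2 (H1 EZ) (H2 EW) => x; rewrite mul1r mulN1r.
Qed.
End Bridge.

(** * Absolutely bounded double series of complex numbers converge *)

Section Complex.
Variable R : realType.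
Notation C := R[i].
Local Open Scope complex_scope.

Lemma tends_real (u : nat -> R) (M : R) : (forall n, u n <= u n.+1) -> (forall n, u n <= M) ->
  exists l, forall e : R, 0 < e -> exists N, forall n, (N <= n)%N -> `|l - u n| < e.
Proof.
move=> H HM; have inc : {homo u : m n / (m <= n)%N >-> m <= n}.
  by apply/nondecreasing_seqP.
have /(nondecreasing_is_cvgn inc) /cvg_ex [l Hl] : has_ubound (range u) by exists M => _ [n _ <-].
by exists l => e e0; move/cvgrPdist_lt: Hl => /(_ _ e0) [N _ HN]; exists N => n; apply: HN.
Qed.

Lemma sq_incr (t : nat -> nat -> R) n : (forall i j, 0 <= t i j) ->
  \sum_(i < n) \sum_(j < n) t i j <= \sum_(i < n.+1) \sum_(j < n.+1) t i j.
Proof.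
move=> H; rewrite [X in _ <= X]big_ord_recr /=; apply: ler_wpDr; first by apply: sumr_ge0.
by apply: ler_sum => i _; rewrite big_ord_recr /= lerDl.
Qed.

(** Write t = (a + t) - a: both series have nonnegative terms and bounded square sums, which are
    monotone. *)
Lemma real_abs_cvg (t a : nat -> nat -> R) (M : R) : (forall i j, `|t i j| <= a i j) ->
  (forall n, \sum_(i < n) \sum_(j < n) a i j <= M) ->
  exists l, forall e : R, 0 < e -> exists N, forall n, (N <= n)%N -> `|l - \sum_(i < n) \sum_(j < n) t i j| < e.
Proof.
move=> Ht HM; have a0 i j : 0 <= a i j by apply: le_trans (Ht i j).
have ta i j : - a i j <= t i j /\ t i j <= a i j by apply/andP; rewrite -ler_norml.
have [|l Hl] := tends_real (fun n => sq_incr n a0) (M := M); first by [].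
have at0 i j : 0 <= a i j + t i j by have [H _] := ta i j; rewrite -lerBlDl sub0r.
have [|l' Hl'] := tends_real (fun n => sq_incr n at0) (M := M + M).
  move=> n; apply: le_trans (lerD (HM n) (HM n)); rewrite -big_split; apply: ler_sum => i _.
  rewrite -big_split; apply: ler_sum => j _; rewrite lerD2l; exact: (ta i j).2.
exists (l' - l) => e e0; have e2 : 0 < e / 2 by rewrite divr_gt0.
have [N HN] := Hl _ e2; have [N' HN'] := Hl' _ e2; exists (maxn N N') => n; rewrite geq_max => /andP[le le'].
have -> : \sum_(i < n) \sum_(j < n) t i j =
   \sum_(i < n) \sum_(j < n) (a i j + t i j) - \sum_(i < n) \sum_(j < n) a i j.
  by rewrite -sumrB; apply: eq_bigr => i _; rewrite -sumrB; apply: eq_bigr => j _; rewrite addrC addKr.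
set X := \sum_(i < n) _; set Y := \sum_(i < n) _.
rewrite (_ : l' - l - (X - Y) = (l' - X) - (l - Y)); last by ring.
rewrite (splitr e); apply: le_lt_trans (ler_normB _ _) _.
by apply: ltrD; [apply: HN' | apply: HN].
Qed.

Lemma Re_sum n (f : 'I_n -> C) : complex.Re (\sum_i f i) = \sum_i complex.Re (f i).
Proof. exact: (raddf_sum (@complex.Re R)). Qed.
Lemma Im_sum n (f : 'I_n -> C) : complex.Im (\sum_i f i) = \sum_i complex.Im (f i).
Proof. exact: (raddf_sum (@complex.Im R)). Qed.

Lemma normC_le (x y : R) : `|x +i* y| <= (`|x| + `|y|)%:C.
Proof.
rewrite normc_def /= lecR -[X in _ <= X]ger0_norm ?addr_ge0 // -sqrtr_sqr ler_wsqrtr //.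
by rewrite sqrrD !real_normK ?num_real // addrAC lerDl mulrn_wge0 // mulr_ge0.
Qed.

Lemma complex_complete_abs (t : nat -> nat -> C) (M : C) :
  (forall n, sq (abss t) n <= M) -> exists s, tends (sq t) s.
Proof.
move=> HM; pose a i j : R := complex.Re `|t i j|.
have aE i j : `|t i j| = (a i j)%:C by rewrite /a normc_def.
have HM' n : \sum_(i < n) \sum_(j < n) a i j <= complex.Re M.
  have := HM n; rewrite lecE => /andP[_]; apply: le_trans.
  by rewrite le_eqVlt; apply/orP; left; apply/eqP; rewrite /sq Re_sum; apply: eq_bigr => i _; rewrite Re_sum.
have ReN i j : `|complex.Re (t i j)| <= a i j.
  by have := normc_ge_Re (t i j); rewrite aE lecR.
have ImN i j : `|complex.Im (t i j)| <= a i j.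
  rewrite -lecR -aE normc_def; case: (t i j) => x y /=; rewrite lecR -sqrtr_sqr ler_wsqrtr // lerDr sqr_ge0 //.
have [l Hl] := real_abs_cvg ReN HM'; have [m Hm] := real_abs_cvg ImN HM'.
(* A positive complex number has zero imaginary part, so the tolerance is a positive real. *)
exists (l +i* m) => -[e e'] ; rewrite ltcE /= => /andP[/eqP -> e0].
have e2 : 0 < e / 2 by rewrite divr_gt0.
have [N HN] := Hl _ e2; have [N' HN'] := Hm _ e2; exists (maxn N N') => n; rewrite geq_max => /andP[le le'].
set u := sq t n; have -> : l +i* m - u = (l - complex.Re u) +i* (m - complex.Im u) by case: u.
apply: le_lt_trans (normC_le _ _) _; rewrite ltcE /= eqxx /= (splitr e); apply: ltrD.
  by rewrite /u /sq Re_sum; under eq_bigr do rewrite Re_sum; apply: HN.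
by rewrite /u /sq Im_sum; under eq_bigr do rewrite Im_sum; apply: HN'.
Qed.
End Complex.

Local Open Scope classical_set_scope.
Local Open Scope ring_scope.

(** * The polynomial fields of the theorem and the conclusion *)

Section Fields.
Variable K : numFieldType.
Notation S := (fps (fps K)).
Notation z := (Xz K).
Notation w := (Xw K).

Hypothesis complete_abs : forall t (M : K), (forall n, sq (abss t) n <= M) -> exists s, tends (sq t) s.

Lemma multevz : multev z (fun x _ => x). Proof. by move=> c x y s; apply: (evsz complete_abs). Qed.
Lemma multevw : multev w (fun _ y => y). Proof. by move=> c x y s; apply: (evsw complete_abs). Qed.
Lemma multevC (a : K) : multev (C2 a) (fun _ _ => a). Proof. by move=> c x y s; apply: evsC. Qed.
Lemma multevD (P Q : S) f g : multev P f -> multev Q g -> multev (P + Q) (fun x y => f x y + g x y).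
Proof. by move=> HP HQ c x y s Hs; rewrite !mulrDl; apply: evsD; [apply: HP | apply: HQ]. Qed.
Lemma multevN (P : S) f : multev P f -> multev (- P) (fun x y => - f x y).
Proof. by move=> HP c x y s Hs; rewrite !mulNr; apply/evsN/HP. Qed.
Lemma multevM (P Q : S) f g : multev P f -> multev Q g -> multev (P * Q) (fun x y => f x y * g x y).
Proof. by move=> HP HQ c x y s Hs; rewrite -!mulrA; apply/HP/HQ. Qed.
Lemma multevX (P : S) f n : multev P f -> multev (P ^+ n) (fun x y => f x y ^+ n).
Proof.
move=> HP; elim: n => [|n IH]; first by move=> c x y s; rewrite !expr0 !mul1r.
by move=> c x y s Hs; rewrite !exprS; apply: (multevM HP IH).
Qed.

Definition fev (a : cubic K) (x y : K) : K :=
  k20 a * x ^+ 2 + k11 a * x * y + k02 a * y ^+ 2 + k30 a * x ^+ 3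
  + k21 a * x ^+ 2 * y + k12 a * x * y ^+ 2 + k03 a * y ^+ 3.

Lemma multev_fld (a : cubic K) (P Q : S) f g : multev P f -> multev Q g -> multev (fld a P Q) (fun x y =>
  fev a (f x y) (g x y)).
Proof.
move=> HP HQ; have C := multevC; have X n := multevX n HP; have Y n := multevX n HQ.
exact: (multevD (multevD (multevD (multevD (multevD (multevD (multevM (C _) (X _)) (multevM (multevM (C _) HP) HQ))
  (multevM (C _) (Y _))) (multevM (C _) (X _))) (multevM (multevM (C _) (X _)) HQ)) (multevM (multevM (C _)
    HP) (Y _)))
  (multevM (C _) (Y _))).
Qed.

(** Convergence with radius fixed to 1, so that sums and products of polynomials need no choice of a
    common radius. *)
Definition bounded (f : S) := exists M : K, forall n, nrm n 1 f <= M.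
Lemma boundedD f g : bounded f -> bounded g -> bounded (f + g).
Proof.
move=> [M HM] [N HN]; exists (M + N) => n.
by apply: le_trans (nrmD ler01 _ _ _) _; apply: lerD.
Qed.
Lemma boundedN f : bounded f -> bounded (- f).
Proof. by move=> [M HM]; exists M => n; rewrite nrmN. Qed.
Lemma boundedM f g : bounded f -> bounded g -> bounded (f * g).
Proof.
move=> [M HM] [N HN]; exists (M * N) => n.
by apply: le_trans (nrmM ler01 _ _ _) _; apply: ler_pM; rewrite ?nrm_ge0.
Qed.
Lemma boundedX f k : bounded f -> bounded (f ^+ k).
Proof.
move=> Hf; elim: k => [|k IH]; last by rewrite exprS; apply: boundedM.
by exists 1 => n; rewrite expr0; apply: nrm1.
Qed.
Lemma boundedC (a : K) : bounded (C2 a).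
Proof.
exists (`|a| * 1) => n; rewrite -[C2 a]mulr1 nrmCM ler_wpM2l //; exact: nrm1.
Qed.
Lemma bounded_fld (a : cubic K) (P Q : S) : bounded P -> bounded Q -> bounded (fld a P Q).
Proof.
move=> HP HQ; have C := boundedC; have X n := boundedX n HP; have Y n := boundedX n HQ.
exact: (boundedD (boundedD (boundedD (boundedD (boundedD (boundedD (boundedM (C _) (X _)) (boundedM
  (boundedM (C _) HP) HQ))
  (boundedM (C _) (Y _))) (boundedM (C _) (X _))) (boundedM (boundedM (C _) (X _)) HQ)) (boundedM (boundedM
    (C _) HP) (Y _)))
  (boundedM (C _) (Y _))).
Qed.
Lemma boundedz : bounded z. Proof. by exists 1 => n; apply: nrmz. Qed.
Lemma boundedw : bounded w. Proof. by exists 1 => n; apply: nrmw. Qed.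
Lemma bounded_conv f : bounded f -> conv f.
Proof. by move=> [M HM]; exists 1, M. Qed.
End Fields.

Lemma analytically_linearizable_ext (K : numFieldType) (X Y : K * K -> K * K) :
  (forall p, X p = Y p) -> analytically_linearizable X -> analytically_linearizable Y.
Proof. by move=> /funext ->. Qed.

Lemma analytically_linearizable_plin (R : realType) (a b : cubic R[i]) :
  analytically_linearizable (fun p => (p.1 + fev a p.1 p.2, - p.2 - fev b p.2 p.1)) <-> plin a b.
Proof.
have Hz := multevz (@complex_complete_abs R); have Hw := multevw (@complex_complete_abs R).
apply: (@analytically_linearizableP _ (@complex_complete_abs R) (fld a (Xz _) (Xw _)) (- fld b (Xw _) (Xz _))
  (fun x y => x + fev a x y) (fun x y => - y - fev b y x)).
- exact: ord_fldz.
- exact: ord_fldw.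
- by apply/bounded_conv/bounded_fld; [apply: boundedz | apply: boundedw].
- by apply/bounded_conv/boundedN/bounded_fld; [apply: boundedw | apply: boundedz].
- by apply: multevD => //; apply: (multev_fld a Hz Hw).
- by apply: multevD; apply: multevN => //; apply: (multev_fld b Hw Hz).
Qed.

Local Open Scope complex_scope.

Theorem theorem4p1 (R : realType)
    (a20 a11 a02 a30 a21 a12 a03 b20 b11 b02 b30 b21 b12 b03 : R[i]) :
  weakly_persistent_isochronous_center
    (fun (eps : R) (p : R[i] * R[i]) =>
       let: (z, w) := p in
       (z + eps%:C * (a20 * z ^+ 2 + a11 * z * w + a02 * w ^+ 2
                      + a30 * z ^+ 3 + a21 * z ^+ 2 * w
                      + a12 * z * w ^+ 2 + a03 * w ^+ 3),
        - w - eps%:C * (b20 * w ^+ 2 + b11 * z * w + b02 * z ^+ 2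
                        + b30 * w ^+ 3 + b21 * z * w ^+ 2
                        + b12 * z ^+ 2 * w + b03 * z ^+ 3)))
  <->
  [/\ a21 = 0, b21 = 0 &
   (* I01 *) vanish [:: a20; a30; b11; b02; b12; b03] \/
   (* I02 *) vanish [:: b20; b30; a11; a02; a12; a03] \/
   (* I03 *) vanish [:: a11; a02; a12; a03; b11; b30] \/
   (* I04 *) vanish [:: b11; b02; b12; b03; a11; a30] \/
   (* I05 *) vanish [:: a11; a02; a12; a03; b11; b02; b12; b03] \/
   (* I06 *) vanish [:: a11; b11; a02; a03; b03; a12 + b30; a30 + b12] \/
   (* I07 *) vanish [:: a11; b11; b02; b03; a03; a30 + b12; a12 + b30] \/
   (* I08 *) vanish [:: a20; a02; a12; a03; b11; b02; b12; b03;
                        2 * a11 - b20] \/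
   (* I09 *) vanish [:: b20; b02; b12; b03; a11; a02; a12; a03;
                        2 * b11 - a20] \/
   (* I10 *) vanish [:: a20; a02; a12; a03; b11; b30; b03;
                        2 * a11 + b20; 2 * a30 + b12] \/
   (* I11 *) vanish [:: b20; b02; b12; b03; a11; a30; a03;
                        a20 + 2 * b11; a12 + 2 * b30] \/
   (* I12 *) vanish [:: a20; a02; a30; a12; a03; b11; b02; b30; b12;
                        3 * a11 + b20] \/
   (* I13 *) vanish [:: b20; b02; b30; b12; b03; a11; a02; a30; a12;
                        a20 + 3 * b11] \/
   (* I14 *) vanish [:: a20; a02; a30; a03; b11; b02; b12;
                        3 * a11 - b20; 3 * a12 + b30] \/
   (* I15 *) vanish [:: b20; b02; b30; b03; a11; a02; a12;
                        3 * b11 - a20; a30 + 3 * b12] \/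
   (* I16 *) vanish [:: a20; a11; a02; a30; a03; b20; b11; b12; b03;
                        2 * a12 + b30] \/
   (* I17 *) vanish [:: b20; b11; b02; b30; b03; a20; a11; a12; a03;
                        a30 + 2 * b12] \/
   (* I18 *) vanish [:: a02; b02; a03; b03; a11 + b20; a20 + b11;
                        a12 + b30; a30 + b12;
                        a30 * b20 ^+ 2 - a20 ^+ 2 * b30] \/
   (* I19 *) (a20 * b20 <> 0 /\
              vanish [:: a30; a12; a03; b30; b12; b03;
                         7 * a11 + 6 * b20; 6 * a20 + 7 * b11;
                         7 * a02 * a20 - 3 * b20 ^+ 2;
                         - (3 * a20 ^+ 2) + 7 * b02 * b20]) \/
   (* I20 *) (a20 * b20 <> 0 /\
              vanish [:: a30; a12; a03; b30; b12; b03;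
                         5 * a11 + 2 * b20; 2 * a20 + 5 * b11;
                         5 * a02 * a20 + 3 * b20 ^+ 2;
                         3 * a20 ^+ 2 + 5 * b02 * b20]) \/
   (* I21 *) (a30 * b30 <> 0 /\
              vanish [:: a20; a11; a02; b20; b11; b02;
                         7 * a12 + 3 * b30; 3 * a30 + 7 * b12;
                         49 * a03 * b03 - 16 * a30 * b30;
                         a03 * a30 ^+ 2 - b03 * b30 ^+ 2])].

Proof.
split=> [H|H eps].
  (* The natural values of eps already separate the homogeneous parts of the obstructions. *)
  apply: necessary => e; apply/analytically_linearizable_plin.
  apply: (analytically_linearizable_ext _ (H e%:R)) => -[z w].
  by rewrite /fev /= rmorph_nat; congr pair; ring.
apply: (analytically_linearizable_ext _ ((analytically_linearizable_plin _ _).2 (sufficient eps%:C H))) => -[z w].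
by rewrite /fev /=; congr pair; ring.
Qed.
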